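(* Let $n\in\mathbb{N}$ and let $f\in \mathrm{VMO}(\mathbb{C}^n)\cap L^\infty(\mathbb{C}^n)$. Then $\lim_{t\to 0}\|H_f^{(t)}\|_t=0$ and, in particular, $$\lim_{t\to 0}\big\|T_f^{(t)}T_g^{(t)}-T_{fg}^{(t)}\big\|_t=0$$ for all $g\in L^\infty(\mathbb{C}^n)$ and all $g\in\mathrm{UC}(\mathbb{C}^n)$.
   Context: For $t>0$ let $d\mu_t(z)=\frac{1}{(4\pi t)^n}e^{-|z|^2/(4t)}\,dv(z)$ on $\mathbb{C}^n$, where $dv$ is Lebesgue measure, let $L_t^2=L^2(\mathbb{C}^n,d\mu_t)$ with norm $\|\cdot\|_t$, let $H_t^2$ be the closed subspace of entire functions in $L_t^2$, and let $P^{(t)}:L_t^2\to H_t^2$ be the orthogonal projection. For a measurable function $f$ on $\mathbb{C}^n$ and $h\in H_t^2$ with $fh\in L_t^2$, define the Toeplitz operator $T_f^{(t)}h=P^{(t)}(fh)$ and the Hankel operator $H_f^{(t)}h=(I-P^{(t)})(fh)$. For a linear operator $X$ with domain and range in $L_t^2$, $\|X\|_t=\sup\{\|Xh\|_t/\|h\|_t : h\neq 0 \text{ in the domain of } X\}$. $\mathrm{UC}(\mathbb{C}^n)$ denotes the space of all (not necessarily bounded) uniformly continuous complex-valued functions on $\mathbb{C}^n$. When symbols are unbounded, each operator is taken on its natural domain: $T_f^{(t)}$ and $H_f^{(t)}$ on $\{h\in H_t^2: fh\in L_t^2\}$, and $T_f^{(t)}T_g^{(t)}-T_{fg}^{(t)}$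 on $\{h\in H_t^2: gh\in L_t^2,\ fP^{(t)}(gh)\in L_t^2,\ fgh\in L_t^2\}$. Identify $\mathbb{C}^n$ with $\mathbb{R}^{2n}$. For a locally integrable function $f$ and a bounded measurable set $E$ of positive measure $|E|$, put $f_E=\frac1{|E|}\int_E f\,dv$ and $\mathrm{Osc}_E(f)=\frac{1}{|E|}\int_E|f-f_E|\,dv$. Then $f\in\mathrm{VMO}(\mathbb{C}^n)$ means that $\{\mathrm{Osc}_E(f): E \text{ a cube in } \mathbb{R}^{2n}\}$ is bounded and $\lim_{a\to0}\sup\{\mathrm{Osc}_E(f): E\text{ a cube},\ |E|\le a\}=0$. *)

(* Defs.v *)
From HB Require Import structures.
From mathcomp Require Import all_boot all_order all_algebra complex.
From mathcomp Require Import all_classical all_reals all_analysis.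
From mathcomp Require Import measurable_realfun ess_sup_inf.

Set Implicit Arguments.
Unset Strict Implicit.
Unset Printing Implicit Defensive.
Import Order.TTheory GRing.Theory Num.Theory.
Import numFieldNormedType.Exports.

Local Open Scope classical_set_scope.
Local Open Scope ring_scope.

(* R[i] packed as a numClosedFieldType: this is what makes the topology, the
   norm and complex differentiability of mathcomp-analysis available on it. *)
Definition cplx (R : realType) : numClosedFieldType := R[i].

Notation Cn R n := 'rV[cplx R]_n.

Section LebesgueC.
Context (R : realType).

Definition coordC n (i : 'I_n) (z : Cn R n) : R * R :=
  (complex.Re (z 0 i), complex.Im (z 0 i)).

Definition Cn_display : measure_display. Proof. exact. Qed.

(* Product sigma-algebra of R^2n, i.e. the Borel sets of C^n. *)
HB.instance Definition _ n :=
  @isMeasurable.Build Cn_display (Cn R n)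
    (g_sigma_preimage (@coordC n))
    (@sigma_algebra0 _ setT _) (@sigma_algebraC _ _)
    (@sigma_algebra_bigcup _ setT _).

Lemma measurable_coordC n (i : 'I_n) : measurable_fun setT (@coordC n i).
Proof.
move=> _ Y mY; rewrite setTI; apply: sub_sigma_algebra => /=.
rewrite -bigcup_seq/=; exists i => /=; first by rewrite mem_index_enum.
by exists Y => //; rewrite setTI.
Qed.

Lemma measurable_coordCP d (T : measurableType d) n (f : T -> Cn R n) :
  (forall i, measurable_fun setT (@coordC n i \o f)) -> measurable_fun setT f.
Proof.
move=> mf; apply: measurability; first by [].
move=> _ [A + <-]; rewrite -bigcup_seq/= => -[i _ [B mB <-]].
rewrite setTI; have := mf i measurableT B mB.
by rewrite !setTI.
Qed.

Definition consC n (p : measurableTypeR R * measurableTypeR R * Cn R n) :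
    Cn R n.+1 :=
  \row_i oapp (p.2 0) (p.1.1 +i* p.1.2)%C (unlift ord0 i).

Lemma coordC_consC0 n p : coordC ord0 (@consC n p) = p.1.
Proof. by rewrite /coordC /consC !mxE unlift_none/=; case: p => -[]. Qed.

Lemma coordC_consCS n p i :
  coordC (lift ord0 i) (@consC n p) = coordC i p.2.
Proof. by rewrite /coordC /consC !mxE liftK. Qed.

Definition unconsC n (z : Cn R n.+1) :
    measurableTypeR R * measurableTypeR R * Cn R n :=
  (coordC ord0 z, \row_i z 0 (lift ord0 i)).

Lemma coordC_inj n (z w : Cn R n) :
  (forall i, coordC i z = coordC i w) -> z = w.
Proof.
move=> zw; apply/rowP => i; have := zw i.
by rewrite /coordC; case: (z _ _) (w _ _) => [a b] [c d] [/= -> ->].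
Qed.

Lemma consCK n : cancel (@consC n) (@unconsC n).
Proof.
move=> p; rewrite /unconsC coordC_consC0 [RHS]surjective_pairing; congr pair.
by apply: coordC_inj => i; rewrite -coordC_consCS /coordC !mxE.
Qed.

Lemma measurable_consC n : measurable_fun setT (@consC n).
Proof.
apply: measurable_coordCP => i; have [->|] := eqVneq i ord0.
  rewrite (_ : _ \o _ = fst); first exact: measurable_fst.
  by apply/funext => p; exact: coordC_consC0.
rewrite eq_sym => /unlift_some[j -> _].
rewrite (_ : _ \o _ = coordC j \o snd).
  apply: measurableT_comp; first exact: measurable_coordC.
  exact: measurable_snd.
by apply/funext => p; exact: coordC_consCS.
Qed.

Lemma measurable_unconsC n : measurable_fun setT (@unconsC n).
Proof.
apply/measurable_fun_pair; first exact: measurable_coordC.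
apply: measurable_coordCP => i.
rewrite (_ : _ \o _ = coordC (lift ord0 i)); first exact: measurable_coordC.
by apply/funext => z; rewrite /coordC/= !mxE.
Qed.

Section sigma_finite_product.
Local Open Scope ereal_scope.
Context d1 d2 (T1 : measurableType d1) (T2 : measurableType d2).
Variables (m1 : {sigma_finite_measure set T1 -> \bar R}).
Variables (m2 : {sigma_finite_measure set T2 -> \bar R}).

(* An alias of m1 \x m2: on the latter, the canonical instance that is found for
   the sigma-finite structures only applies to subprobabilities. *)
Definition sfprod : set (T1 * T2) -> \bar R := m1 \x m2.

HB.instance Definition _ := Measure.on sfprod.

Let sfprod_sigma_finite : sigma_finite setT sfprod.
Proof.
have /sigma_finiteP[F [TF ndF Foo]] := sigma_finiteT m1.
have /sigma_finiteP[G [TG ndG Goo]] := sigma_finiteT m2.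
exists (fun n => F n `*` G n).
  rewrite -setXTT TF TG predeqE => -[x y]; split.
    move=> [/= [n _ Fnx] [k _ Gky]]; exists (maxn n k) => //; split.
    - by move: x Fnx; exact/subsetPset/ndF/leq_maxl.
    - by move: y Gky; exact/subsetPset/ndG/leq_maxr.
  by move=> [n _ []/= ? ?]; split; exists n.
move=> k; have [? ?] := Foo k; have [? ?] := Goo k.
split; first exact: measurableX.
by rewrite /sfprod product_measure1E// lte_mul_pinfty// ge0_fin_numE.
Qed.

HB.instance Definition _ := Measure_isSigmaFinite.Build _ _ _ sfprod
  sfprod_sigma_finite.

End sigma_finite_product.

Section push_consC.
Local Open Scope ereal_scope.
Variables (n : nat) (m : {sigma_finite_measure
  set (measurableTypeR R * measurableTypeR R * Cn R n)%type -> \bar R}).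

Definition push_consC := pushforward m (@consC n).

Let preimage_consC A : measurable A -> measurable (@consC n @^-1` A).
Proof.
by move=> mA; rewrite -[X in measurable X]setTI; exact: measurable_consC.
Qed.

Let push_consC0 : push_consC set0 = 0.
Proof. by rewrite /push_consC /pushforward preimage_set0 measure0. Qed.

Let push_consC_ge0 A : 0 <= push_consC A.
Proof. by rewrite /push_consC /pushforward measure_ge0. Qed.

Let push_consC_sigma_additive : semi_sigma_additive push_consC.
Proof.
move=> F mF tF mUF; rewrite /push_consC /pushforward preimage_bigcup.
apply: measure_semi_sigma_additive.
- by move=> k; exact: preimage_consC.
- apply/trivIsetP => /= i j _ _ ij; rewrite -preimage_setI.
  by move/trivIsetP : tF => /(_ _ _ _ _ ij) ->//; rewrite preimage_set0.
- by rewrite -preimage_bigcup; exact: preimage_consC.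
Qed.

HB.instance Definition _ := isMeasure.Build _ _ _ push_consC
  push_consC0 push_consC_ge0 push_consC_sigma_additive.

Let push_consC_sigma_finite : sigma_finite setT push_consC.
Proof.
have [F UF mF] := sigma_finiteT m; exists (fun k => @unconsC n @^-1` F k).
  by rewrite -preimage_bigcup -UF.
move=> k; have [mFk Fk] := mF k; split.
  by rewrite -[X in measurable X]setTI; exact: measurable_unconsC.
rewrite /push_consC /pushforward -comp_preimage.
by rewrite (_ : _ \o _ = id)//; apply/funext => p; rewrite /= consCK.
Qed.

HB.instance Definition _ := Measure_isSigmaFinite.Build _ _ _ push_consC
  push_consC_sigma_finite.

End push_consC.

Fixpoint lebesgueC n : {sigma_finite_measure set (Cn R n) -> \bar R} :=
  if n is m.+1 then
    push_consC (sfprod (sfprod lebesgue_measure lebesgue_measure) (lebesgueC m))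
  else \d_(0 : Cn R 0).

End LebesgueC.

Notation modC := Normc.normc.

Section Fock.
Context (R : realType) (n : nat).
Local Notation Cn := (Cn R n).
Local Notation fctC := (Cn -> cplx R).
Local Notation dv := (lebesgueC R n).

Definition normsq (z : Cn) : R :=
  \sum_(i < n) ((coordC i z).1 ^+ 2 + (coordC i z).2 ^+ 2).

(* d mu_t = gaussian_density t dv for t > 0. The absolute value only serves to
   make gaussC t below a measure for every real t. *)
Definition gaussian_density (t : R) (z : Cn) : R :=
  expR (- normsq z / (4 * t)) / `|4 * pi * t| ^+ n.

Definition gaussC (t : R) (A : set Cn) : \bar R :=
  (\int[dv]_(z in A) (gaussian_density t z)%:E)%E.

Section gaussC_measure.
Variable t : R.

Lemma gaussian_density_ge0 z : 0 <= gaussian_density t z.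
Proof. by rewrite divr_ge0 ?expR_ge0 ?exprn_ge0. Qed.

Lemma measurable_gaussian_density : measurable_fun setT (gaussian_density t).
Proof.
apply: measurable_funM => //; apply: (measurableT_comp (@measurable_expR R)).
apply: measurable_funM => //; apply: measurable_funN.
apply: measurable_sum => i; apply: measurable_funD; apply: measurable_funX.
- exact: (measurableT_comp measurable_fst (@measurable_coordC R n i)).
- exact: (measurableT_comp measurable_snd (@measurable_coordC R n i)).
Qed.

Let gaussC0 : gaussC t set0 = 0%E.
Proof. by rewrite /gaussC integral_set0. Qed.

Let gaussC_ge0 A : (0 <= gaussC t A)%E.
Proof.
apply: integral_ge0 => z _; rewrite lee_fin; exact: gaussian_density_ge0.
Qed.

Let gaussC_sigma_additive : semi_sigma_additive (gaussC t).
Proof.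
apply: semi_sigma_additive_nng_induced => [|z].
  by apply/measurable_EFinP; exact: measurable_gaussian_density.
by rewrite lee_fin; exact: gaussian_density_ge0.
Qed.

HB.instance Definition _ := isMeasure.Build _ _ _ (gaussC t)
  gaussC0 gaussC_ge0 gaussC_sigma_additive.

End gaussC_measure.

Definition measurableC (f : fctC) : Prop :=
  measurable_fun setT (fun z => complex.Re (f z)) /\
  measurable_fun setT (fun z => complex.Im (f z)).

Definition integralC (mu : {measure set Cn -> \bar R}) (D : set Cn) (f : fctC) :
    cplx R :=
  ((\int[mu]_(z in D) complex.Re (f z)) +i*
   (\int[mu]_(z in D) complex.Im (f z)))%C.

Definition normL2 (t : R) (u : fctC) : \bar R :=
  ('N[gaussC t]_2%:E[EFin \o (@modC R \o u)])%E.

Definition L2 (t : R) : set fctC :=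
  [set u | measurableC u /\ (normL2 t u < +oo)%E].

Definition dotL2 (t : R) (u v : fctC) : cplx R :=
  integralC (gaussC t) setT (fun z => u z * (v z)^* ).

Definition entire (h : fctC) : Prop := forall z, differentiable h z.

Definition H2 (t : R) : set fctC := [set h | entire h /\ L2 t h].

(* The orthogonal projection of u on H2 t: the element p of H2 t (unique, for an
   entire function is determined by its class) such that u - p is orthogonal to
   H2 t. Meaningful only for u in L2 t. *)
Definition projH2 (t : R) (u : fctC) : fctC :=
  xget (cst 0) [set p | H2 t p /\ forall h, H2 t h -> dotL2 t (u \- p) h = 0].

Definition toeplitz (t : R) (f h : fctC) : fctC := projH2 t (f \* h).

Definition hankel (t : R) (f h : fctC) : fctC :=
  (f \* h) \- projH2 t (f \* h).

Definition dom_mul (t : R) (f : fctC) : set fctC :=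
  [set h | H2 t h /\ L2 t (f \* h)].

Definition semicommutator (t : R) (f g h : fctC) : fctC :=
  toeplitz t f (toeplitz t g h) \- toeplitz t (f \* g) h.

Definition dom_semicommutator (t : R) (f g : fctC) : set fctC :=
  [set h | [/\ H2 t h, L2 t (g \* h), L2 t (f \* projH2 t (g \* h))
             & L2 t (f \* g \* h)]].

Definition opnorm (t : R) (D : set fctC) (X : fctC -> fctC) : \bar R :=
  ereal_sup [set (normL2 t (X h) / normL2 t h)%E
             | h in [set h | D h /\ h <> cst 0]].

Definition Linfty : set fctC :=
  [set f | measurableC f /\ ('N[dv]_+oo[EFin \o (@modC R \o f)] < +oo)%E].

Definition UC : set fctC := [set f | unif_continuous f].

(* Cubes of R^2n, with sides parallel to the axes. *)
Definition cube : set (set Cn) :=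
  [set E | exists (a : Cn) (s : R), 0 < s /\
    E = [set z | forall i,
      (coordC i a).1 <= (coordC i z).1 <= (coordC i a).1 + s /\
      (coordC i a).2 <= (coordC i z).2 <= (coordC i a).2 + s]].

Definition locally_integrableC (f : fctC) : Prop :=
  measurableC f /\
  forall K : set Cn, compact K -> (\int[dv]_(z in K) (modC (f z))%:E < +oo)%E.

Definition mean (f : fctC) (E : set Cn) : cplx R :=
  ((fine (dv E))^-1)%:C%C * integralC dv E f.

Definition osc (f : fctC) (E : set Cn) : \bar R :=
  ((dv E)^-1 * \int[dv]_(z in E) (modC (f z - mean f E))%:E)%E.

Definition VMO : set fctC :=
  [set f | [/\ locally_integrableC f,
    exists M : R, forall E, cube E -> (osc f E <= M%:E)%E
    & ereal_sup [set osc f E | E in [set E | cube E /\ (dv E <= a%:E)%E]]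
        @[a --> 0^'+] --> 0%E]].

End Fock.

(* Main.v *)
Require Import Defs.
From HB Require Import structures.
From mathcomp Require Import all_boot all_order all_algebra complex.
From mathcomp Require Import all_classical all_reals all_analysis.
From mathcomp Require Import measurable_realfun ess_sup_inf ring lra.
Set Implicit Arguments.
Unset Strict Implicit.
Unset Printing Implicit Defensive.
Import Order.TTheory GRing.Theory Num.Theory.
Import numFieldNormedType.Exports.
Local Open Scope classical_set_scope.
Local Open Scope ring_scope.

(* The space H2 has the reproducing kernel K(z, w) = exp(z . conj w / 4t): this is the mean
   value property on circles, averaged against the Gaussian after a translation. So P is
   the integral operator with kernel K, and weighting by the square root of the Gaussian
   density turns |K| into the convolution kernel gk(z - w), a Gaussian of width sqrt t.
   Schur's test then bounds |H_f|^2 by 4^n times the supremum over x of the integral of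
   |f z - f w|^2 gk(z - w) gk(w - x) over z and w. If f is bounded and in VMO, this is
   small with t: on a cube of side 2 L sqrt t around x it is at most a constant times the
   oscillation of f, and the complement contributes a Gaussian tail in L. If g is
   uniformly continuous, |g z - g w| <= e exp(|z - w|^2 / 32t) for small t.
   Finally T_f T_g - T_(fg) = - P f H_g. For g uniformly continuous this is small since
   |P| and |f| are bounded and H_g is small; for g bounded, since P f (I - P) is the
   adjoint of the Hankel operator of conj f, which is small as f is. *)

(** * Invariance of Lebesgue measure *)

(** The averaging in [hankel_bound] is what VMO forces. A plain Schur test would need the integral
    of |f z - f w|^2 gk(z - w) over z to be small uniformly in w. For a bounded f in VMO this can
    fail on sets of positive measure: thin spikes of fixed height may have arbitrarily small mean
    oscillation. Oscillation over cubes controls only the average over w as well, and the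
    reproducing formula supplies that average, since |h w|^2 is dominated by a Gaussian average of
    |h|^2. Boundedness of f enters twice: |f z - f w|^2 <= 2M |f z - f w| reduces to first powers,
    which is what [osc] measures, and outside the cube f is bounded by M. The parameter L is fixed
    first, from the tail alone; t follows, so that the cube is small enough. Constants such as 4^n
    are far from sharp (a projection has norm 1), but they do not depend on t, and only this
    matters. The projection is given by orthogonality and entire functions by differentiability
    alone, so the kernel formula is built from Goursat's theorem upwards: circles, then Gaussian
    means by rotation invariance, then translation. *)

Definition preserves d (T : measurableType d) (R : realType)
    (mu : set T -> \bar R) (phi : T -> T) : Prop :=
  measurable_fun setT phi /\
  forall f : T -> \bar R, measurable_fun setT f -> (forall x, (0 <= f x)%E) ->
    (\int[mu]_x f (phi x) = \int[mu]_x f x)%E.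

Lemma preserves_comp d (T : measurableType d) (R : realType)
    (mu : set T -> \bar R) (phi psi : T -> T) :
  preserves mu phi -> preserves mu psi -> preserves mu (psi \o phi).
Proof.
move=> [mphi iphi] [mpsi ipsi]; split; first exact: measurableT_comp.
move=> f mf f0; rewrite -[RHS]ipsi//= (iphi (fun x => f (psi x)))//.
exact: measurableT_comp.
Qed.

Section invariance.
Context {R : realType}.
Local Notation leb := (@lebesgue_measure R).
Local Notation mR := (measurableTypeR R).
Local Open Scope ereal_scope.

Lemma lebesgue_preserves_shift (c : R) :
  preserves leb (fun x : mR => (x + c)%R : mR).
Proof.
have mc : measurable_fun [set: mR] (fun x : mR => (x + c)%R : mR).
  exact: measurable_funD.
split=> // f mf f0.
pose phi : {mfun mR >-> mR} :=
  HB.pack (fun x : mR => (x + c)%R : mR) (isMeasurableFun.Build _ _ _ _ _ mc).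
(* The translated measure agrees with Lebesgue measure on the intervals []a, b]], and this
   determines it. *)
have E (A : set mR) : measurable A -> leb A = pushforward leb phi A.
  apply: (@lebesgue_measure_unique R (pushforward leb phi)) => _ [[a b]] _ <- /=.
  rewrite /pushforward (_ : _ @^-1` _ = `](a - c)%R, (b - c)%R]%classic).
    rewrite !lebesgue_measure_itv/= !lte_fin ltrD2r.
    by case: ifP => // _; rewrite -!EFinB; congr EFin; ring.
  by apply/seteqP; split=> x /=; rewrite !in_itv/= ltrBlDr lerBrDr.
transitivity (\int[pushforward leb phi]_x f x).
  by rewrite ge0_integral_pushforward//= preimage_setT.
by apply: eq_measure_integral => A mA _; exact/esym/E.
Qed.

Definition leb2 := sfprod leb leb.

Lemma leb2_tonelli1 (f : mR * mR -> \bar R) :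
  measurable_fun setT f -> (forall z, 0 <= f z) ->
  \int[leb2]_p f p = \int[leb]_x \int[leb]_y f (x, y).
Proof. exact: fubini_tonelli1. Qed.

Lemma leb2_tonelli2 (f : mR * mR -> \bar R) :
  measurable_fun setT f -> (forall z, 0 <= f z) ->
  \int[leb2]_p f p = \int[leb]_y \int[leb]_x f (x, y).
Proof. exact: fubini_tonelli2. Qed.

(** With the second coordinate frozen a shear is a translation of the first, so Tonelli with the
    sheared variable inside reduces to the line. *)
Lemma leb2_shear1 (a c : R) :
  preserves leb2 (fun p : mR * mR => ((p.1 + a * p.2 + c)%R, p.2) : mR * mR).
Proof.
have mphi : measurable_fun setT
   (fun p : mR * mR => ((p.1 + a * p.2 + c)%R, p.2) : mR * mR).
  apply/measurable_fun_pair => /=; last exact: measurable_snd.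
  apply: measurable_funD => //; apply: measurable_funD; first exact: measurable_fst.
  by apply: measurable_funM => //; exact: measurable_snd.
split=> // f mf f0.
etransitivity; first exact: (leb2_tonelli2 (measurableT_comp mf mphi) (fun=> f0 _)).
etransitivity; last exact/esym/(leb2_tonelli2 mf f0).
apply: eq_integral => y _.
rewrite -[RHS](proj2 (lebesgue_preserves_shift (a * y + c)))//.
  by apply: eq_integral => x _ /=; rewrite addrA.
exact: measurableT_comp.
Qed.

Lemma leb2_shear2 (a c : R) :
  preserves leb2 (fun p : mR * mR => (p.1, (p.2 + a * p.1 + c)%R) : mR * mR).
Proof.
have mphi : measurable_fun setT
   (fun p : mR * mR => (p.1, (p.2 + a * p.1 + c)%R) : mR * mR).
  apply/measurable_fun_pair => /=; first exact: measurable_fst.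
  apply: measurable_funD => //; apply: measurable_funD; first exact: measurable_snd.
  by apply: measurable_funM => //; exact: measurable_fst.
split=> // f mf f0.
etransitivity; first exact: (leb2_tonelli1 (measurableT_comp mf mphi) (fun=> f0 _)).
etransitivity; last exact/esym/(leb2_tonelli1 mf f0).
apply: eq_integral => x _.
rewrite -[RHS](proj2 (lebesgue_preserves_shift (a * x + c)))//.
  by apply: eq_integral => y _ /=; rewrite addrA.
exact: measurableT_comp.
Qed.

Lemma leb2_shift (c1 c2 : R) :
  preserves leb2 (fun p : mR * mR => ((p.1 + c1)%R, (p.2 + c2)%R) : mR * mR).
Proof.
have := preserves_comp (leb2_shear1 0 c1) (leb2_shear2 0 c2).
congr preserves; apply/funext => -[x y] /=.
by rewrite !mul0r !addr0.
Qed.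

(* A rotation is a product of three shears. *)
Lemma leb2_rotation (th : R) : (- pi < th < pi)%R ->
  preserves leb2 (fun p : mR * mR => ((cos th * p.1 - sin th * p.2)%R,
    (sin th * p.1 + cos th * p.2)%R) : mR * mR).
Proof.
move=> thpi; pose a := (th / 2)%R.
(* The outer shears have slope [- tan (th / 2)], which is why [th] stays strictly between [- pi] and
   [pi]. The endpoints are negligible when angles are averaged. *)
have ca : cos a != 0%R.
  rewrite gt_eqF// cos_gt0_pihalf// /a; move: thpi => /andP[? ?]; lra.
have := preserves_comp (leb2_shear1 (- tan a) 0)
  (preserves_comp (leb2_shear2 (sin th) 0) (leb2_shear1 (- tan a) 0)).
have tha : th = (a + a)%R by rewrite /a; lra.
have cs : (cos a * cos a + sin a * sin a = 1)%R.
  by rewrite -!expr2 cos2Dsin2.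
have E1 : (1 - tan a * sin th = cos th)%R.
  rewrite tha sinD cosD /tan.
  transitivity ((cos a * cos a + sin a * sin a) - 2 * sin a * sin a)%R.
    by rewrite cs; field.
  by ring.
have E2 : (tan a + cos th * tan a = sin th)%R.
  rewrite tha sinD cosD /tan.
  transitivity (((cos a * cos a + sin a * sin a) + (cos a * cos a - sin a * sin a)) * (sin a / cos a))%R.
    by rewrite cs; ring.
  by field.
congr preserves; apply/funext => -[x y] /=.
congr pair; last by rewrite -E1; ring.
transitivity ((1 - tan a * sin th) * x -
  (tan a + (1 - tan a * sin th) * tan a) * y)%R; last by rewrite E1 E2.
by ring.
Qed.

Lemma lebesgueC_tonelli n (f : Cn R n.+1 -> \bar R) :
  measurable_fun setT f -> (forall z, 0 <= f z) ->
  \int[lebesgueC R n.+1]_z f z =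
  \int[lebesgueC R n]_w \int[leb2]_p f (@consC R n (p, w)).
Proof.
move=> mf f0 /=.
rewrite /push_consC ge0_integral_pushforward//=; last exact: measurable_consC.
rewrite preimage_setT /sfprod fubini_tonelli2//.
by apply: measurableT_comp => //; exact: measurable_consC.
Qed.

(** The family is indexed by the coordinate because a translation moves each coordinate by its own
    amount; a rotation uses a constant family. *)
Definition mapC n (m : 'I_n -> mR * mR -> mR * mR) (z : Cn R n) : Cn R n :=
  \row_i ((m i (coordC i z)).1 +i* (m i (coordC i z)).2)%C.

Lemma coordC_mapC n (m : 'I_n -> mR * mR -> mR * mR) (z : Cn R n) i :
  coordC i (mapC m z) = m i (coordC i z).
Proof. by rewrite {1}/coordC /mapC mxE/= -surjective_pairing. Qed.

Lemma measurable_mapC n (m : 'I_n -> mR * mR -> mR * mR) :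
  (forall i, measurable_fun setT (m i)) -> measurable_fun setT (mapC m).
Proof.
move=> mm; apply: measurable_coordCP => i.
rewrite (_ : _ \o _ = m i \o coordC i).
  by apply: measurableT_comp; [exact: mm|exact: measurable_coordC].
by apply/funext => z; rewrite /= coordC_mapC.
Qed.

Lemma mapC_consC n (m : 'I_n.+1 -> mR * mR -> mR * mR) p (w : Cn R n) :
  mapC m (consC (p, w)) = consC (m ord0 p, mapC (fun i => m (lift ord0 i)) w).
Proof.
apply: coordC_inj => i; rewrite coordC_mapC.
have [->|] := eqVneq i ord0; first by rewrite !coordC_consC0.
by rewrite eq_sym => /unlift_some[j -> _]; rewrite !coordC_consCS coordC_mapC.
Qed.

Lemma measurable_consC_section n (w : Cn R n) :
  measurable_fun setT (fun p : mR * mR => consC (p, w)).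
Proof.
apply: measurable_coordCP => i; have [->|] := eqVneq i ord0.
  rewrite (_ : _ \o _ = id); first exact: measurable_id.
  by apply/funext => p; exact: coordC_consC0.
rewrite eq_sym => /unlift_some[j -> _].
rewrite (_ : _ \o _ = cst (coordC j w)); first exact: measurable_cst.
by apply/funext => p; exact: coordC_consCS.
Qed.

(** Induction on the dimension: after Tonelli the inner integral absorbs [m ord0], and the outer one
    absorbs the other maps by induction. *)
Lemma lebesgueC_preserves_mapC n (m : 'I_n -> mR * mR -> mR * mR) :
  (forall i, preserves leb2 (m i)) -> preserves (lebesgueC R n) (mapC m).
Proof.
move=> mm; split; first by apply: measurable_mapC => i; exact: (mm i).1.
elim: n m mm => [|n IH] m mm f mf f0.
  by apply: eq_integral => z _; congr f; apply: coordC_inj => -[].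
have mm' i : measurable_fun setT (m i) := (mm i).1.
have mfc := measurableT_comp mf (@measurable_consC R n).
pose m' i := m (lift ord0 i).
etransitivity.
  exact: (lebesgueC_tonelli (measurableT_comp mf (measurable_mapC mm'))
    (fun=> f0 _)).
etransitivity; last exact/esym/(lebesgueC_tonelli mf f0).
transitivity (\int[lebesgueC R n]_w
    \int[leb2]_p f (consC (p, mapC m' w))).
  apply: eq_integral => w _ /=.
  under eq_integral do rewrite mapC_consC.
  apply: (proj2 (mm ord0) (fun p => f (consC (p, mapC m' w)))) => //.
  exact: (measurableT_comp mf (measurable_consC_section _)).
apply: (IH m' _ (fun w => \int[leb2]_p f (consC (p, w)))) => [i||w].
- exact: mm.
- exact: (measurable_fun_fubini_tonelli_G (m1 := leb2) _ mfc (fun=> f0 _)).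
- exact: integral_ge0.
Qed.

Lemma lebesgueC_shift n (a : Cn R n) : preserves (lebesgueC R n) (fun z => z + a)%R.
Proof.
have := lebesgueC_preserves_mapC (fun i : 'I_n => leb2_shift (coordC i a).1 (coordC i a).2).
congr preserves; apply/funext => z; apply: coordC_inj => i.
by rewrite coordC_mapC /coordC/= !mxE; case: (z _ _) (a _ _) => [? ?] [? ?].
Qed.

Lemma lebesgueC_rotation n (th : R) : (- pi < th < pi)%R ->
  preserves (lebesgueC R n) (fun z : Cn R n => (cos th +i* sin th)%C *: z)%R.
Proof.
move=> thpi.
have := lebesgueC_preserves_mapC (fun i : 'I_n => leb2_rotation thpi).
congr preserves; apply/funext => z; apply: coordC_inj => i.
rewrite coordC_mapC /coordC/= !mxE; case: (z _ _) => [? ?] //=.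
by congr pair; rewrite addrC.
Qed.

End invariance.

(** * Densities and Gaussian integrals *)

Section density.
Context d (T : measurableType d) (R : realType).
Variables (mu nu : {measure set T -> \bar R}) (g : T -> R).
Hypotheses (mg : measurable_fun setT g) (g0 : forall x, 0 <= g x).
Hypothesis nuE : forall A, measurable A ->
  nu A = (\int[mu]_(x in A) (g x)%:E)%E.
Local Open Scope ereal_scope.
Import HBNNSimple.

Let mgE : measurable_fun setT (EFin \o g).
Proof. exact/measurable_EFinP. Qed.

Let int_density_nnsfun (h : {nnsfun T >-> R}) :
  \int[nu]_x (h x)%:E = \int[mu]_x (h x * g x)%:E.
Proof.
have mh r : measurable (h @^-1` [set r]) by [].
rewrite integralT_nnsfun sintegralE.
transitivity (\int[mu]_x (\sum_(k \in range h)
    (k * \1_(h @^-1` [set k]) x * g x)%:E)).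
  rewrite ge0_integral_fsum//; last 2 first.
  - move=> k; apply/measurable_EFinP; apply: measurable_funM => //.
    exact: measurable_funM.
  - move=> k x _; rewrite lee_fin mulr_ge0//.
    by rewrite -lee_fin nnfun_muleindic_ge0.
  apply: eq_fsbigr => k /[!inE] -[x _ hxk].
  rewrite nuE// -ge0_integralZl//; last first.
  - by rewrite lee_fin -hxk.
  - by move=> y _; rewrite lee_fin.
  - exact: measurable_funTS.
  rewrite integral_mkcond; apply: eq_integral => y _.
  rewrite patchE indicE; case: ifPn => hy; first by rewrite mulr1.
  by rewrite mulr0 mul0r.
apply: eq_integral => x _; rewrite fsumEFin//; congr EFin.
rewrite fimfunE !fsbig_finite//= mulr_suml.
by apply: eq_bigr.
Qed.

Lemma ge0_integral_density (f : T -> \bar R) :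
  measurable_fun setT f -> (forall x, 0 <= f x) ->
  \int[nu]_x f x = \int[mu]_x (f x * (g x)%:E).
Proof.
move=> mf f0; pose f_ := nnsfun_approx measurableT mf.
have f_f x : (EFin \o f_ ^~ x) n @[n --> \oo] --> f x.
  by apply: cvg_nnsfun_approx.
have ndf x m n : (m <= n)%N -> (f_ m x <= f_ n x)%R.
  by move=> mn; exact/lefP/nd_nnsfun_approx.
transitivity (limn (fun n => \int[nu]_x (f_ n x)%:E)).
  rewrite -monotone_convergence//.
  - by apply: eq_integral => y _; apply/esym/cvg_lim => //; exact: f_f.
  - by move=> n; exact/measurable_EFinP/measurable_funP.
  - by move=> n y _; rewrite lee_fin.
  - by move=> y _ m n mn; rewrite lee_fin ndf.
rewrite [X in limn X](_ : _ = (fun n => \int[mu]_x (f_ n x * g x)%:E)); last first.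
  by apply/funext => n; exact: int_density_nnsfun.
rewrite -monotone_convergence//.
- apply: eq_integral => y _; apply/cvg_lim => //.
  under eq_fun do rewrite EFinM.
  by apply: cvgeZr => //; exact: f_f.
- by move=> n; apply/measurable_EFinP; exact: measurable_funM.
- by move=> n y _; rewrite lee_fin mulr_ge0.
- by move=> y _ m n mn; rewrite lee_fin ler_wpM2r// ndf.
Qed.

(** Positive and negative parts transform separately, so the identity covers non-integrable
    functions too; [dotL2E] can then rewrite scalar products of functions known only to be
    measurable. *)
Lemma integral_density (f : T -> R) : measurable_fun setT f ->
  \int[nu]_x (f x)%:E = \int[mu]_x (f x * g x)%:E.
Proof.
move=> mf; rewrite [LHS]integralE [RHS]integralE.
have mfE : measurable_fun setT (EFin \o f) by exact/measurable_EFinP.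
rewrite !ge0_integral_density//; [|exact: measurable_funeneg|
  exact: measurable_funepos].
congr (_ - _); apply: eq_integral => x _.
  by rewrite !funeposE/= EFinM (@maxe_pMl _ (g x)%:E)// ?mul0e// lee_fin.
by rewrite !funenegE EFinM -mulNe (@maxe_pMl _ (g x)%:E)// ?mul0e// lee_fin.
Qed.

End density.

(** * The Cauchy-Schwarz inequality for a weighted measure *)

Section cauchy_schwarz.
Context d (T : measurableType d) (R : realType).
Variables (mu : {measure set T -> \bar R}).
Local Open Scope ereal_scope.

(** Hölder's inequality with exponents 2 and 2 for the product of [a * sqrt g] and [sqrt g]. The
    weight will be a translate of [gk], whose mass is known. *)
Lemma cauchy_schwarz_weight (a g : T -> R) :
  measurable_fun setT a -> measurable_fun setT g ->
  (forall x, 0 <= a x)%R -> (forall x, 0 <= g x)%R ->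
  (\int[mu]_x (a x * g x)%:E) ^+ 2 <=
  (\int[mu]_x (g x)%:E) * \int[mu]_x (a x ^+ 2 * g x)%:E.
Proof.
move=> ma mg a0 g0.
pose sg x := Num.sqrt (g x).
have msg : measurable_fun setT sg.
  have ms : measurable_fun setT (@Num.sqrt R).
    by apply: continuous_measurable_fun; exact: sqrt_continuous.
  exact: measurableT_comp ms mg.
have aE x : (a x * g x = `|a x * sg x * sg x|)%R.
  by rewrite -mulrA -expr2 sqr_sqrtr// ger0_norm// mulr_ge0.
have two : (2^-1 + 2^-1 = 1 :> R)%R by lra.
have := @hoelder _ _ _ mu _ _ 2%R 2%R (measurable_funM ma msg) msg
  (ltr0n _ 2) (ltr0n _ 2) two.
rewrite Lnorm1 unlock/= !poweR12_sqrt ?integral_ge0// => H.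
under eq_integral do rewrite aE.
rewrite -lee_sqr ?mule_ge0 ?sqrte_ge0 ?integral_ge0// in H.
apply: (le_trans H).
rewrite expe2 muleACA -!expe2 !sqr_sqrte ?integral_ge0//.
rewrite muleC le_eqVlt; apply/orP; left; apply/eqP; congr (_ * _);
  apply: eq_integral => x _; congr EFin.
  by rewrite powR_mulrn// ger0_norm ?sqrtr_ge0// sqr_sqrtr.
by rewrite powR_mulrn// real_normK ?num_real// exprMn sqr_sqrtr.
Qed.

End cauchy_schwarz.

(** * Gaussian integrals on C^n *)

Section gaussian.
Context {R : realType}.
Local Notation leb := (@lebesgue_measure R).
Local Notation mR := (measurableTypeR R).

Lemma normsq_ge0 n (z : Cn R n) : 0 <= normsq z.
Proof. by apply: sumr_ge0 => i _; rewrite addr_ge0 ?sqr_ge0. Qed.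

Lemma normsqN n (z : Cn R n) : normsq (- z) = normsq z.
Proof.
by apply: eq_bigr => i _; rewrite /coordC/= !mxE !raddfN/= !sqrrN.
Qed.

Lemma measurable_coordC1 n (i : 'I_n) :
  measurable_fun setT (fun z : Cn R n => (coordC i z).1).
Proof. exact: (measurableT_comp measurable_fst (@measurable_coordC R n i)). Qed.

Lemma measurable_coordC2 n (i : 'I_n) :
  measurable_fun setT (fun z : Cn R n => (coordC i z).2).
Proof. exact: (measurableT_comp measurable_snd (@measurable_coordC R n i)). Qed.

Lemma measurable_normsq n : measurable_fun setT (@normsq R n).
Proof.
apply: measurable_sum => i; apply: measurable_funD; apply: measurable_funX.
- exact: measurable_coordC1.
- exact: measurable_coordC2.
Qed.

Lemma measurable_addC n :
  measurable_fun setT (fun p : Cn R n * Cn R n => p.1 + p.2).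
Proof.
apply: measurable_coordCP => i; apply/measurable_fun_pair => /=.
  rewrite (_ : (fun _ => _) = (fun p => (coordC i p.1).1 + (coordC i p.2).1)).
    apply: measurable_funD.
      exact: (measurableT_comp (measurable_coordC1 i) measurable_fst).
    exact: (measurableT_comp (measurable_coordC1 i) measurable_snd).
  by apply/funext => p; rewrite /coordC /= !mxE raddfD.
rewrite (_ : (fun _ => _) = (fun p => (coordC i p.1).2 + (coordC i p.2).2)).
  apply: measurable_funD.
    exact: (measurableT_comp (measurable_coordC2 i) measurable_fst).
  exact: (measurableT_comp (measurable_coordC2 i) measurable_snd).
by apply/funext => p; rewrite /coordC /= !mxE raddfD.
Qed.

Lemma measurable_oppC n : measurable_fun setT (fun z : Cn R n => - z).
Proof.
apply: measurable_coordCP => i; apply/measurable_fun_pair => /=.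
  rewrite (_ : (fun _ => _) = (fun p => - (coordC i p).1)).
    by apply: measurable_funN; exact: measurable_coordC1.
  by apply/funext => p; rewrite /coordC /= !mxE raddfN.
rewrite (_ : (fun _ => _) = (fun p => - (coordC i p).2)).
  by apply: measurable_funN; exact: measurable_coordC2.
by apply/funext => p; rewrite /coordC /= !mxE raddfN.
Qed.

Lemma measurable_subC n :
  measurable_fun setT (fun p : Cn R n * Cn R n => p.1 - p.2).
Proof.
have mq : measurable_fun setT (fun p : Cn R n * Cn R n => (p.1, - p.2)).
  apply/measurable_fun_pair; first exact: measurable_fst.
  by apply: measurableT_comp; [exact: measurable_oppC|exact: measurable_snd].
exact: (measurableT_comp (@measurable_addC n) mq).
Qed.

(** Read off from the total mass 1 of the normal law of variance s/2. *)
Lemma integral_gauss1 (s : R) : 0 < s ->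
  (\int[leb]_x (expR (- x ^+ 2 / s))%:E = (Num.sqrt (pi * s))%:E)%E.
Proof.
move=> s0; pose sg := Num.sqrt (s / 2).
have sg0 : sg != 0 by rewrite gt_eqF// sqrtr_gt0 divr_gt0.
have sg2 : sg ^+ 2 *+ 2 = s.
  by rewrite sqr_sqrtr ?divr_ge0 ?ltW// -mulr_natr divfK.
have pk : normal_peak sg = (Num.sqrt (pi * s))^-1.
  rewrite /normal_peak -sg2; congr (Num.sqrt _)^-1.
  by move: (@pi R) (sg ^+ 2) => a b; ring.
have := integral_normal_pdf 0 sg.
rewrite normal_pdfE// pk => /(congr1 (fun x => (Num.sqrt (pi * s))%:E * x)%E).
rewrite mule1 => <-.
rewrite -ge0_integralZl//.
- apply: eq_integral => x _; rewrite -EFinM mulrA divff ?mul1r; last first.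
    by rewrite gt_eqF// sqrtr_gt0 mulr_gt0// pi_gt0.
  by rewrite /normal_fun subr0 sg2.
- apply/measurable_EFinP; apply: measurable_funM => //.
  exact: measurable_normal_fun.
- by move=> x _; rewrite lee_fin mulr_ge0// ?invr_ge0// normal_fun_ge0.
Qed.

Lemma measurable_gauss n (s : R) :
  measurable_fun setT (fun z : Cn R n => expR (- normsq z / s)).
Proof.
apply: (measurableT_comp (@measurable_expR R)).
by apply: measurable_funM => //; apply: measurable_funN; exact: measurable_normsq.
Qed.

Lemma normsq_consC n p (w : Cn R n) :
  normsq (consC (p, w)) = p.1 ^+ 2 + p.2 ^+ 2 + normsq w.
Proof.
rewrite /normsq big_ord_recl coordC_consC0; congr (_ + _).
by apply: eq_bigr => i _; rewrite coordC_consCS.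
Qed.

Lemma integral_gauss n (s : R) : 0 < s ->
  (\int[lebesgueC R n]_z (expR (- normsq z / s))%:E = ((pi * s) ^+ n)%:E)%E.
Proof.
move=> s0.
have ps0 : 0 <= pi * s by rewrite mulr_ge0 ?pi_ge0 ?ltW.
elim: n => [|n IH].
  rewrite /= integral_dirac//= ?diracT ?mul1e; last first.
    by apply/measurable_EFinP; exact: measurable_gauss.
  by rewrite /normsq big_ord0 oppr0 mul0r expR0 expr0.
etransitivity.
  apply: lebesgueC_tonelli; first by apply/measurable_EFinP; exact: measurable_gauss.
  by move=> z; rewrite lee_fin expR_ge0.
have m1 : measurable_fun [set: mR] (fun x : mR => (expR (- x ^+ 2 / s))).
  apply: (measurableT_comp (@measurable_expR R)).
  by apply: measurable_funM => //; apply: measurable_funN; exact: measurable_funX.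
pose S := Num.sqrt (pi * s).
have I1 (c : R) : 0 <= c ->
    (\int[leb]_x (c * expR (- x ^+ 2 / s))%:E = (c * S)%:E)%E.
  move=> c0; under eq_integral do rewrite EFinM.
  rewrite ge0_integralZl//; first by rewrite integral_gauss1.
  exact/measurable_EFinP.
have I2 (k : R) : 0 <= k -> (\int[leb2]_p (expR (- (p.1 ^+ 2) / s) *
     expR (- (p.2 ^+ 2) / s) * k)%:E = (pi * s * k)%:E)%E.
  move=> k0; etransitivity.
    apply: leb2_tonelli1; last first.
      by move=> z; rewrite lee_fin !mulr_ge0 ?expR_ge0.
    apply/measurable_EFinP; apply: measurable_funM => //; apply: measurable_funM.
      exact: (measurableT_comp m1 measurable_fst).
    exact: (measurableT_comp m1 measurable_snd).
  transitivity (\int[leb]_x ((k * S) * expR (- x ^+ 2 / s))%:E)%E.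
    apply: eq_integral => x _ /=.
    rewrite mulrAC mulrC -I1 ?mulr_ge0 ?expR_ge0//.
    by apply: eq_integral => y _; congr EFin; ring.
  rewrite I1 ?mulr_ge0 ?sqrtr_ge0//; congr EFin.
  by rewrite -mulrA mulrC -expr2 sqr_sqrtr.
transitivity (\int[lebesgueC R n]_w ((pi * s)%:E * (expR (- normsq w / s))%:E))%E.
  apply: eq_integral => w _; rewrite -EFinM -I2 ?expR_ge0//.
  apply: eq_integral => p _; rewrite normsq_consC -!expRD; congr (expR _)%:E.
  by rewrite !opprD !mulrDl.
rewrite ge0_integralZl//; first by rewrite IH -EFinM exprS.
by apply/measurable_EFinP; exact: measurable_gauss.
Qed.

Lemma integral_gauss_shift n (s : R) (a : Cn R n) : 0 < s ->
  (\int[lebesgueC R n]_z (expR (- normsq (z - a) / s))%:E = ((pi * s) ^+ n)%:E)%E.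
Proof.
move=> s0; rewrite -(integral_gauss n s0).
apply: (proj2 (lebesgueC_shift (- a)) (fun z => (expR (- normsq z / s))%:E)).
  by apply/measurable_EFinP; exact: measurable_gauss.
by move=> z; rewrite lee_fin expR_ge0.
Qed.

End gaussian.

(** * Complex numbers and holomorphic functions *)

(* The embedding of R in C with codomain cplx R, so that the order and the norm of
   cplx R are found. *)
Definition rC (R : realType) (x : R) : cplx R := (x%:C)%C.

Section complex_basics.
Context {R : realType}.
Local Notation C := (cplx R).
Local Notation Re := (@complex.Re R).
Local Notation Im := (@complex.Im R).
Local Open Scope complex_scope.
Implicit Types z w : C.

Lemma normC_modC z : `|z| = rC (modC z).
Proof. by case: z => a b; rewrite normc_def. Qed.

Lemma modC_ge0 z : 0 <= modC z.
Proof. by case: z => a b /=; rewrite sqrtr_ge0. Qed.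

Lemma modCM z w : modC (z * w) = modC z * modC w.
Proof. exact: Normc.normcM. Qed.

Lemma modCD z w : modC (z + w) <= modC z + modC w.
Proof. exact: le_normcD. Qed.

Lemma modCN z : modC (- z) = modC z.
Proof. exact: normcN. Qed.

Lemma modCB z w : modC (z - w) <= modC z + modC w.
Proof. by rewrite -(modCN w) modCD. Qed.

Lemma modC_sqr z : modC z ^+ 2 = Re z ^+ 2 + Im z ^+ 2.
Proof. by case: z => a b /=; rewrite sqr_sqrtr ?addr_ge0 ?sqr_ge0. Qed.

Lemma modC_conj z : modC z^*%C = modC z.
Proof. by case: z => a b /=; rewrite sqrrN. Qed.

Lemma modC_real (x : R) : modC (rC x) = `|x|.
Proof. by rewrite /= expr0n/= addr0 sqrtr_sqr. Qed.

Lemma cRe_rC (x : R) : Re (rC x) = x. Proof. by []. Qed.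
Lemma cIm_rC (x : R) : Im (rC x) = 0. Proof. by []. Qed.

Lemma rCM (x y : R) : rC (x * y) = rC x * rC y.
Proof. exact: rmorphM. Qed.

Lemma rCB (x y : R) : rC (x - y) = rC x - rC y.
Proof. exact: rmorphB. Qed.

Lemma modC0 : modC (0 : C) = 0.
Proof. by have := modC_real 0; rewrite normr0. Qed.

Lemma modC_eq0 z : modC z = 0 -> z = 0.
Proof. exact: Normc.eq0_normc. Qed.

Lemma ler_Re_modC z : `|Re z| <= modC z.
Proof.
rewrite -(@ler_pXn2r _ 2%N)// ?nnegrE ?modC_ge0//.
by rewrite modC_sqr real_normK ?num_real// lerDl sqr_ge0.
Qed.

Lemma ler_Im_modC z : `|Im z| <= modC z.
Proof.
rewrite -(@ler_pXn2r _ 2%N)// ?nnegrE ?modC_ge0//.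
by rewrite modC_sqr real_normK ?num_real// lerDr sqr_ge0.
Qed.

Lemma modC_le_ReIm z : modC z <= `|Re z| + `|Im z|.
Proof.
rewrite -(@ler_pXn2r _ 2%N)// ?nnegrE ?modC_ge0 ?addr_ge0//.
by rewrite modC_sqr sqrrD !real_normK ?num_real// addrAC lerDl mulrn_wge0.
Qed.

Lemma cReD z w : Re (z + w) = Re z + Re w. Proof. exact: raddfD. Qed.
Lemma cImD z w : Im (z + w) = Im z + Im w. Proof. exact: raddfD. Qed.
Lemma cReN z : Re (- z) = - Re z. Proof. exact: raddfN. Qed.
Lemma cImN z : Im (- z) = - Im z. Proof. exact: raddfN. Qed.
Lemma cReB z w : Re (z - w) = Re z - Re w. Proof. exact: raddfB. Qed.
Lemma cImB z w : Im (z - w) = Im z - Im w. Proof. exact: raddfB. Qed.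
Lemma cReM z w : Re (z * w) = Re z * Re w - Im z * Im w.
Proof. by case: z w => [a b] [c d]. Qed.
Lemma cImM z w : Im (z * w) = Re z * Im w + Im z * Re w.
Proof. by case: z w => [a b] [c d]. Qed.
Lemma cReJ z : Re z^*%C = Re z. Proof. by case: z. Qed.
Lemma cImJ z : Im z^*%C = - Im z. Proof. by case: z. Qed.

Lemma cplx_eq z w : Re z = Re w -> Im z = Im w -> z = w.
Proof. by case: z w => [a b] [c d] /= -> ->. Qed.

Lemma leCR (x y : R) : (rC x <= rC y) = (x <= y).
Proof. exact: lecR. Qed.

Lemma ltCR (x y : R) : (rC x < rC y) = (x < y).
Proof. exact: ltcR. Qed.

Lemma le0CR (x : R) : (0 <= rC x) = (0 <= x).
Proof. exact: ler0c. Qed.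

Lemma pos_cplx (e : C) : 0 < e -> exists2 r : R, 0 < r & e = rC r.
Proof.
case: e => a b; rewrite ltcE/= => /andP[/eqP -> a0].
by exists a.
Qed.

End complex_basics.

(** * Complex differentiability with real epsilons *)

Section differentiability.
Context {R : realType}.
Local Notation C := (cplx R).
Local Open Scope complex_scope.

(** Norms on spaces over [cplx R] take values in [cplx R] itself. This lemma and its converse
    exchange the positive complex epsilons of [differentiable] for real ones. *)
Lemma differentiable_epsE (V W : normedModType C) (f : V -> W) (x : V) :
  differentiable f x -> exists df : {linear V -> W}, continuous df /\
  forall e : R, 0 < e -> \forall h \near 0,
    `|f (h + x) - f x - df h| <= rC e * `|h|.
Proof.
move=> /diff_locallyP [dfc]; move=> /eqaddoP H; exists ('d f x); split=> // e e0.
have := H (rC e); rewrite ltCR => /(_ e0); apply: filterS => h /=.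
by rewrite opprD addrA.
Qed.

Lemma differentiable_epsI (V W : normedModType C) (f : V -> W) (x : V)
  (df : {linear V -> W}) : continuous df ->
  (forall e : R, 0 < e -> \forall h \near 0,
    `|f (h + x) - f x - df h| <= rC e * `|h|) ->
  differentiable f x.
Proof.
move=> cdf H.
have E : f \o shift x = cst (f x) + df +o_ 0 id.
  apply/eqaddoP => _/posnumP[e]; have [r r0 er] := pos_cplx [gt0 of e%:num].
  rewrite er; apply: filterS (H r r0) => h /=.
  by rewrite opprD addrA.
apply/diff_locallyP.
have -> : 'd f x = df :> (V -> W) by exact: diff_unique.
by split.
Qed.

(** Differentiability at every point, with the real-valued modulus and closed discs. Nothing is said
    about continuity of the derivative, hence Goursat's argument instead of Green's formula. *)
Definition holo (phi : C -> C) := forall z0, exists c : C, forall e : R, 0 < e ->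
  exists2 dl : R, 0 < dl & forall z, modC (z - z0) <= dl ->
    modC (phi z - phi z0 - c * (z - z0)) <= e * modC (z - z0).

Lemma nbhs0_normP (V : normedModType C) (P : V -> Prop) :
  (\forall h \near 0, P h) ->
  exists2 r : R, 0 < r & forall h : V, `|h| < rC r -> P h.
Proof.
move=> /nbhs_norm0P[e /= e0 H].
have [r r0 er] := pos_cplx e0.
by exists r => // h hr; apply: H => /=; rewrite er.
Qed.

Lemma entire_line_holo n (g : Cn R n -> C) (w b : Cn R n) : entire g ->
  holo (fun z => g (z *: w + b)).
Proof.
move=> eg z0; have [df [_ H]] := differentiable_epsE (eg (z0 *: w + b)).
exists (df w) => e e0.
(* A strict upper bound of [|w|], so that dividing by it is safe even for [w = 0]. *)
have [W W0 Ww] : exists2 W : R, 0 < W & `|w| < rC W.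
  have : 0 < `|w| + 1 by apply: ltr_wpDl.
  move=> /pos_cplx[W W0 E]; exists W => //.
  by rewrite -E ltrDl.
have eW : 0 < e / W by rewrite divr_gt0.
have [r r0 Hr] := nbhs0_normP (H _ eW).
(* Halved because [holo] uses closed discs while the neighbourhood is an open ball. *)
exists (r / W / 2); first by rewrite !divr_gt0.
move=> z zz0.
have hw : `|(z - z0) *: w| <= rC (modC (z - z0)) * rC W.
  by rewrite normrZ normC_modC ler_wpM2l ?le0CR ?modC_ge0 // ltW.
have := Hr ((z - z0) *: w).
rewrite linearZ/= addrA scalerBl subrK => Hr'.
rewrite -leCR -normC_modC mulrC; apply: (le_trans (Hr' _)).
  rewrite -scalerBl; apply: (le_lt_trans hw); rewrite -rCM ltCR.
  have : modC (z - z0) < r / W by apply: (le_lt_trans zz0); rewrite gtr_pMr ?divr_gt0// invf_lt1// ltr1n.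
  by rewrite ltr_pdivlMr.
rewrite -scalerBl; apply: (le_trans (ler_wpM2l _ hw)).
  by rewrite le0CR ltW.
by rewrite -!rCM leCR mulrCA divfK ?gt_eqF// mulrC.
Qed.

End differentiability.

(** * Goursat's theorem and the mean value property on circles *)

Section line_integral.
Context {R : realType}.
Local Notation C := (cplx R).
Local Notation Re := (@complex.Re R).
Local Notation Im := (@complex.Im R).
Local Notation leb := (@lebesgue_measure R).
Local Open Scope complex_scope.
Implicit Types (F G : R -> C) (a b : R).

Definition rint a b (f : R -> R) : R := \int[leb]_(x in `[a, b]) f x.

Definition cint a b F : C := rint a b (Re \o F) +i* rint a b (Im \o F).

Definition ccont F := continuous (Re \o F : R -> R) /\ continuous (Im \o F : R -> R).

Lemma continuous_int a b (f : R -> R) : continuous f ->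
  leb.-integrable `[a, b] (EFin \o f).
Proof.
move=> cf; apply: continuous_compact_integrable; first exact: segment_compact.
exact: continuous_subspaceT.
Qed.

Lemma rint_split a m b (f : R -> R) : continuous f -> a <= m -> m <= b ->
  rint a b f = rint a m f + rint m b f.
Proof.
move=> cf am mb; rewrite /rint.
rewrite (@itv_bndbnd_setU _ _ (BLeft a) (BRight m)) ?bnd_simp//.
rewrite Rintegral_setU//=.
- congr (_ + _).
  rewrite Rintegral_itv_obnd_cbnd//; apply: integrableS (continuous_int _ _ cf) => //.
  by apply: subset_itvr; rewrite bnd_simp.
- rewrite -itv_bndbnd_setU ?bnd_simp//; exact: continuous_int.
- rewrite disj_set2E; apply/eqP/seteqP; split=> // x /=.
  rewrite !in_itv/= => -[/andP[_ xm] /andP[mx _]].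
  by move: (lt_le_trans mx xm); rewrite ltxx.
Qed.

Lemma rint_bound a b k e (f : R -> R) : continuous f -> a <= b ->
  (forall x, a <= x <= b -> `|f x - k| <= e) ->
  `|rint a b f - k * (b - a)| <= e * (b - a).
Proof.
move=> cf ab H.
have leb_ab : fine (leb `[a, b]) = b - a.
  rewrite lebesgue_measure_itv/= lte_fin; case: ltP => // ba.
  by rewrite (@le_anti _ _ a b) ?subrr// ab ba.
have cst_int c : rint a b (fun=> c) = c * (b - a).
  by rewrite /rint Rintegral_cst// leb_ab.
have icst c : leb.-integrable `[a, b] (EFin \o (fun=> c : R)).
  by apply: continuous_int => x; exact: cst_continuous.
rewrite -cst_int /rint -RintegralB//; last exact: continuous_int.
apply: (@le_trans _ _ (rint a b (fun x => `|f x - k|))).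
  apply: le_normr_Rintegral => //.
  by apply: continuous_int => x; apply: continuousB; [exact: cf|exact: cst_continuous].
rewrite -cst_int; apply: le_Rintegral => //.
apply: continuous_int => x; apply: (@continuous_comp _ _ _ (fun x => f x - k) Num.norm).
  by apply: continuousB; [exact: cf|exact: cst_continuous].
exact: norm_continuous.
Qed.

Lemma rintB a b (f g : R -> R) : continuous f -> continuous g ->
  rint a b (fun x => f x - g x) = rint a b f - rint a b g.
Proof. by move=> cf cg; rewrite /rint RintegralB//; exact: continuous_int. Qed.

Lemma ccontB F G : ccont F -> ccont G -> ccont (fun x => F x - G x).
Proof.
move=> [F1 F2] [G1 G2]; split.
  rewrite (_ : _ \o _ = (fun x => (Re \o F) x - (Re \o G) x)).
    by move=> x; apply: continuousB; [exact: F1|exact: G1].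
  by apply/funext => x /=; rewrite cReB.
rewrite (_ : _ \o _ = (fun x => (Im \o F) x - (Im \o G) x)).
  by move=> x; apply: continuousB; [exact: F2|exact: G2].
by apply/funext => x /=; rewrite cImB.
Qed.

Lemma cint_split a m b F : ccont F -> a <= m -> m <= b ->
  cint a b F = cint a m F + cint m b F.
Proof.
move=> [F1 F2] am mb; rewrite /cint (rint_split F1 am mb) (rint_split F2 am mb).
by [].
Qed.

Lemma cintB a b F G : ccont F -> ccont G ->
  cint a b (fun x => F x - G x) = cint a b F - cint a b G.
Proof.
move=> [F1 F2] [G1 G2]; apply: cplx_eq; rewrite ?cReB ?cImB /=.
  by rewrite -rintB//; congr rint; apply/funext => x /=; rewrite cReB.
by rewrite -rintB//; congr rint; apply/funext => x /=; rewrite cImB.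
Qed.

(** The factor 2 comes from estimating real and imaginary parts separately; [goursat] compensates
    for it in its choice of epsilon. *)
Lemma cint_bound a b (k : C) (e : R) F : ccont F -> a <= b ->
  (forall x, a <= x <= b -> modC (F x - k) <= e) ->
  modC (cint a b F - k * rC (b - a)) <= 2 * e * (b - a).
Proof.
move=> [F1 F2] ab H; apply: (le_trans (modC_le_ReIm _)).
rewrite -mulrA mulr_natl mulr2n lerD//.
  rewrite cReB cReM cRe_rC cIm_rC mulr0 subr0; apply: rint_bound => // x /H.
  by apply: le_trans; rewrite /= -cReB ler_Re_modC.
rewrite cImB cImM cRe_rC cIm_rC mulr0 add0r; apply: rint_bound => // x /H.
by apply: le_trans; rewrite /= -cImB ler_Im_modC.
Qed.

End line_integral.

(** * Goursat's bisection argument *)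

Section goursat.
Context {R : realType}.
Local Notation C := (cplx R).
Local Open Scope complex_scope.

(** Goursat's argument for any function of rectangles (corner [x], [y], sides [u], [v]) that is
    additive under quartering and o((u + v)^2) at each point. If it is not zero, one quarter always
    keeps a quarter of the modulus; the nested quarters shrink to a point, where the local estimate
    is violated. *)
Lemma rectangle_bisection (J : R -> R -> R -> R -> C) :
  (forall x y u v, 0 < u -> 0 < v -> J x y u v =
     J x y (u / 2) (v / 2) + J (x + u / 2) y (u / 2) (v / 2) +
     J x (y + v / 2) (u / 2) (v / 2) + J (x + u / 2) (y + v / 2) (u / 2) (v / 2)) ->
  (forall x0 y0 (e : R), 0 < e -> exists2 dl : R, 0 < dl & forall x y u v,
     0 < u -> 0 < v -> u <= dl -> v <= dl -> x <= x0 <= x + u -> y <= y0 <= y + v ->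
     modC (J x y u v) <= e * (u + v) ^+ 2) ->
  forall x y u v, 0 < u -> 0 < v -> J x y u v = 0.
Proof.
move=> Jadd Jo x y u v u0 v0; apply: modC_eq0; apply/eqP.
rewrite eq_le modC_ge0 andbT leNgt; apply/negP.
set eta := modC _ => eta0.
pose q k : R := 2^-1 ^+ k.
have q0 k : 0 < q k by rewrite exprn_gt0.
have qS k : q k.+1 = q k / 2 by rewrite /q exprSr.
(* A state holds the level k and the corner of a rectangle of sides [u / 2 ^ k], [v / 2 ^ k] that
   still carries modulus at least [eta / 4 ^ k]. *)
pose bad (s : nat * (R * R)) :=
  eta * q s.1 ^+ 2 <= modC (J s.2.1 s.2.2 (u * q s.1) (v * q s.1)).
pose mk s (h : bad s) : {s | bad s} := exist (fun s => is_true (bad s)) s h.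
pose nxt (s s' : {s | bad s}) := let: (k, (a, b)) := sval s in
  let: (k', (a', b')) := sval s' in
  [/\ k' = k.+1, a <= a' /\ a' + u * q k' <= a + u * q k &
    b <= b' /\ b' + v * q k' <= b + v * q k].
have step s : {s' | nxt s s'}.
  apply: cid; case: s => -[k [a b]] bs.
  pose uk := u * q k; pose vk := v * q k.
  have bs1 : eta * q k ^+ 2 <= modC (J a b uk vk) := bs.
  have uk0 : 0 < uk by rewrite mulr_gt0.
  have vk0 : 0 < vk by rewrite mulr_gt0.
  have uS : u * q k.+1 = uk / 2 by rewrite qS mulrA.
  have vS : v * q k.+1 = vk / 2 by rewrite qS mulrA.
  have eS : eta * q k.+1 ^+ 2 = (eta * q k ^+ 2) / 4.
    by rewrite qS expr_div_n mulrA -natrX.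
  have H a' b' : bad (k.+1, (a', b')) -> a' = a \/ a' = a + uk / 2 ->
    b' = b \/ b' = b + vk / 2 ->
    exists s' : {s | bad s}, nxt (mk _ bs) s'.
    move=> bs' Ha Hb; exists (mk _ bs'); rewrite /nxt/= uS vS -/uk -/vk.
    by split=> //; [case: Ha => ->|case: Hb => ->]; lra.
  pose T a' b' := modC (J a' b' (uk / 2) (vk / 2)).
  have bT a' b' : eta * q k ^+ 2 / 4 <= T a' b' -> bad (k.+1, (a', b')).
    by rewrite /bad [_.1]/= eS uS vS.
  have le4 : eta * q k ^+ 2 <= T a b + T (a + uk / 2) b + T a (b + vk / 2) +
      T (a + uk / 2) (b + vk / 2).
    apply: (le_trans bs1); rewrite Jadd//.
    do 3 (apply: (le_trans (modCD _ _)); rewrite lerD2r).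
    by [].
  have [h1|h1] := lerP (eta * q k ^+ 2 / 4) (T a b).
    by apply: H; [exact: bT h1|left|left].
  have [h2|h2] := lerP (eta * q k ^+ 2 / 4) (T (a + uk / 2) b).
    by apply: H; [exact: bT h2|right|left].
  have [h3|h3] := lerP (eta * q k ^+ 2 / 4) (T a (b + vk / 2)).
    by apply: H; [exact: bT h3|left|right].
  apply: (H (a + uk / 2) (b + vk / 2)); [|by right|by right].
  by apply: bT; lra.
have bad0 : bad (0, (x, y)) by rewrite /bad /q/= expr0 expr1n !mulr1.
have [s [s0 sS]] := dependent_choice step (mk _ bad0).
pose X k := (sval (s k)).2.1; pose Y k := (sval (s k)).2.2.
have sk k : (sval (s k)).1 = k.
  elim: k => [|k IH]; first by rewrite s0.
  have := sS k; rewrite /nxt.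
  case: (sval (s k)) IH => k' [a b] /= ->.
  by case: (sval (s k.+1)) => k'' [a' b'] [].
have XS k : X k <= X k.+1 /\ X k.+1 + u * q k.+1 <= X k + u * q k.
  have := sS k; rewrite /nxt /X; have := sk k; have := sk k.+1.
  case: (sval (s k)) => k' [a b] /= + ->.
  by case: (sval (s k.+1)) => k'' [a' b'] /= -> [].
have YS k : Y k <= Y k.+1 /\ Y k.+1 + v * q k.+1 <= Y k + v * q k.
  have := sS k; rewrite /nxt /Y; have := sk k; have := sk k.+1.
  case: (sval (s k)) => k' [a b] /= + ->.
  by case: (sval (s k.+1)) => k'' [a' b'] /= -> [].
have nested (Z : nat -> R) (w : R) : 0 < w ->
    (forall k, Z k <= Z k.+1 /\ Z k.+1 + w * q k.+1 <= Z k + w * q k) ->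
    exists z, forall k, Z k <= z <= Z k + w * q k.
  move=> w0 ZS.
  have Zup k m : Z k <= Z (m + k)%N.
    by elim: m => // m IH; apply: (le_trans IH); exact: (ZS _).1.
  have Zdn k m : Z (m + k)%N + w * q (m + k)%N <= Z k + w * q k.
    by elim: m => // m IH; apply: le_trans IH; exact: (ZS _).2.
  have Zle k m : Z m <= Z k + w * q k.
    have wq j : 0 <= w * q j by rewrite mulr_ge0 ?ltW.
    have [km|ltmk] := leqP k m.
      by rewrite -(subnK km); apply: le_trans (Zdn k (m - k)%N); rewrite lerDl.
    apply: (@le_trans _ _ (Z k)); last by rewrite lerDl.
    by rewrite -(subnK (ltnW ltmk)).
  (* The supremum of the left ends lies below every right end, so it belongs to all the
     intervals. *)
  exists (sup (range Z)) => k; apply/andP; split.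
    apply: ub_le_sup; last by exists k.
    by exists (Z 0 + w * q 0) => _ [m _ <-].
  by apply: ge_sup; [exists (Z 0); exists 0|move=> _ [m _ <-]].
have [x0 Hx0] := nested X u u0 XS.
have [y0 Hy0] := nested Y v v0 YS.
have uv0 : 0 < (u + v) ^+ 2 by rewrite exprn_gt0// addr_gt0.
(* With this epsilon the local estimate gives at most half of the modulus that a bad rectangle
   carries. *)
have e0 : 0 < eta / (2 * (u + v) ^+ 2) by rewrite divr_gt0// mulr_gt0.
have [dl dl0 Hdl] := Jo x0 y0 _ e0.
have [k kdl] : exists k, (u + v) * q k <= dl.
  (* Works because k < 2^k. *)
  exists (Num.bound ((u + v) / dl)).
  rewrite /q exprVn ler_pdivrMr ?exprn_gt0// mulrC -ler_pdivrMr//.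
  apply/ltW; apply: (lt_le_trans (archi_boundP _)).
    by rewrite divr_ge0 ?addr_ge0 ?ltW.
  by rewrite -natrX ler_nat; apply/ltnW; rewrite ltn_expl.
have badk : eta * q k ^+ 2 <= modC (J (X k) (Y k) (u * q k) (v * q k)).
  by have := proj2_sig (s k); rewrite /bad sk.
have := Hdl (X k) (Y k) (u * q k) (v * q k) (mulr_gt0 u0 (q0 k)) (mulr_gt0 v0 (q0 k)).
rewrite mulrDl in kdl.
have uq0 : 0 < u * q k by rewrite mulr_gt0.
have vq0 : 0 < v * q k by rewrite mulr_gt0.
move=> /(_ _ _ (Hx0 k) (Hy0 k)) H.
have {}H : eta * q k ^+ 2 <=
    eta / (2 * (u + v) ^+ 2) * (u * q k + v * q k) ^+ 2.
  by apply: (le_trans badk); apply: H; lra.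
have E : eta / (2 * (u + v) ^+ 2) * (u + v) ^+ 2 = eta / 2.
  by field; rewrite gt_eqF// addr_gt0.
rewrite -mulrDl exprMn [leRHS]mulrA E ler_pM2r ?exprn_gt0// in H; lra.
Qed.

End goursat.

(** * Elementary estimates for exp, sin and cos *)

Section real_bounds.
Context {R : realType}.
Implicit Types x y : R.

(** Both this bound and the next come from 1 + x <= exp x, taken at x and at -x. *)
Lemma normr_expR_sub1 x : `|expR x - 1| <= `|x| * expR `|x|.
Proof.
have h1 : x <= expR x - 1 by have := expR_ge1Dx x; lra.
have h2 : expR x - 1 <= x * expR x.
  have := expR_ge1Dx (- x); rewrite expRN => h.
  have e0 := expR_gt0 x.
  have : (1 - x) * expR x <= (expR x)^-1 * expR x by rewrite ler_pM2r.
  by rewrite mulVf ?gt_eqF//; lra.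
have [x0|x0] := ger0P x.
  by rewrite ger0_norm//; lra.
rewrite ler0_norm; last first.
  by apply: (le_trans h2); rewrite nmulr_rle0 ?expR_ge0.
apply: (@le_trans _ _ (- x)); first lra.
rewrite ler_peMr//; first lra.
by rewrite -expR0 ler_expR; lra.
Qed.

Lemma normr_expR_sub1x x : `|expR x - 1 - x| <= x ^+ 2 * expR `|x|.
Proof.
rewrite ger0_norm; last by have := expR_ge1Dx x; lra.
have h2 : expR x - 1 - x <= x * (expR x - 1).
  have := expR_ge1Dx (- x); rewrite expRN => h.
  have e0 := expR_gt0 x.
  have : (1 - x) * expR x <= (expR x)^-1 * expR x by rewrite ler_pM2r.
  by rewrite mulVf ?gt_eqF//; lra.
apply: (le_trans h2); apply: (le_trans (ler_norm _)).
rewrite normrM -(real_normK (num_real x)) expr2 -mulrA ler_wpM2l//.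
exact: normr_expR_sub1.
Qed.

Lemma normr_sin_le y : `|sin y| <= `|y|.
Proof.
wlog y0 : y / 0 < y => [H|].
  have [/H//|y0|<-] := ltgtP 0 y; last by rewrite sin0.
  by have := H (- y); rewrite oppr_gt0 sinN !normrN => /(_ y0).
have [|c _] := @MVT R sin cos 0 y y0.
  by apply: continuous_subspaceT => x; exact: continuous_sin.
rewrite sin0 !subr0 => ->.
by rewrite normrM ler_piMl// ler_norml cos_geN1 cos_le1.
Qed.

Lemma one_sub_cos y : 1 - cos y = 2 * sin (y / 2) ^+ 2.
Proof.
have {1}-> : y = y / 2 + y / 2 by lra.
rewrite cosD -!expr2; have := cos2Dsin2 (y / 2); lra.
Qed.

Lemma one_sub_cos_le y : `|1 - cos y| <= y ^+ 2.
Proof.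
rewrite one_sub_cos normrM normrX (ger0_norm (ler0n _ _)).
have := normr_sin_le (y / 2); rewrite -(@ler_pXn2r _ 2%N)// ?nnegrE//.
rewrite [in X in _ <= X -> _]real_normK ?num_real//.
by rewrite expr_div_n; have := sqr_ge0 y; lra.
Qed.

(** This linear bound on the derivative of [sin y - y] is what the mean value theorem needs in
    [normr_sin_sub]. *)
Lemma one_sub_cos_le1 y : `|1 - cos y| <= `|y|.
Proof.
rewrite one_sub_cos normrM normrX (ger0_norm (ler0n _ _)).
have h := normr_sin_le (y / 2).
have h1 : `|sin (y / 2)| <= 1 by rewrite ler_norml sin_geN1 sin_le1.
rewrite normrM (ger0_norm (x := 2^-1)) ?invr_ge0// in h.
have : `|sin (y / 2)| ^+ 2 <= `|sin (y / 2)| by rewrite expr2 ler_piMl.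
lra.
Qed.

Lemma normr_sin_sub y : `|sin y - y| <= y ^+ 2.
Proof.
wlog y0 : y / 0 < y => [H|].
  have [/H//|y0|<-] := ltgtP 0 y; last by rewrite sin0 subrr normr0 expr0n.
  have -> : sin y - y = - (sin (- y) - (- y)) by rewrite sinN; ring.
  by rewrite normrN -(sqrrN y); apply: H; rewrite oppr_gt0.
have D (x : R) : x \in `]0, y[ -> is_derive x 1 (sin \- id) (cos x - 1).
  by move=> _; apply: is_deriveB.
have ct : {within `[0, y], continuous (sin \- id : R -> R)}.
  apply: continuous_subspaceT => x; apply: continuousB; first exact: continuous_sin.
  exact: cvg_id.
have [c] := MVT y0 D ct.
rewrite in_itv/= => /andP[c0 cy]; rewrite sin0 !subr0 => ->.
rewrite normrM expr2 distrC (gtr0_norm y0) ler_wpM2r ?(ltW y0)//.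
apply: (le_trans (one_sub_cos_le1 c)).
by rewrite gtr0_norm// ltW.
Qed.

End real_bounds.

(** * The complex exponential *)

Section complex_exponential.
Context {R : realType}.
Local Notation C := (cplx R).
Local Notation Re := (@complex.Re R).
Local Notation Im := (@complex.Im R).
Local Open Scope complex_scope.
Implicit Types z w : C.

Definition expC z : C := (expR (Re z) * cos (Im z)) +i* (expR (Re z) * sin (Im z)).

Lemma expC0 : expC 0 = 1.
Proof. by apply: cplx_eq; rewrite /= expR0 mul1r ?cos0 ?sin0. Qed.

Lemma expCD z w : expC (z + w) = expC z * expC w.
Proof.
apply: cplx_eq; rewrite ?cReM ?cImM /expC/= cReD cImD expRD ?cosD ?sinD; ring.
Qed.

Lemma modC_expC z : modC (expC z) = expR (Re z).
Proof.
rewrite /= !exprMn -mulrDr cos2Dsin2 mulr1 sqrtr_sqr ger0_norm//.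
Qed.

Lemma expCJ z : expC z^*%C = (expC z)^*%C.
Proof. by case: z => a b; rewrite /expC/= cosN sinN mulrN. Qed.

Lemma expC_rC (x : R) : expC (rC x) = rC (expR x).
Proof. by apply: cplx_eq; rewrite /= ?cos0 ?sin0 ?mulr1 ?mulr0. Qed.

(** Real and imaginary part each split into two terms, all of modulus at most m^2 exp m with m the
    modulus of z; this is the 4. *)
Lemma modC_expC_sub z : modC (expC z - 1 - z) <= 4 * modC z ^+ 2 * expR (modC z).
Proof.
apply: (le_trans (modC_le_ReIm _)); rewrite !cReB !cImB /expC/=.
set m := Normc.normc z; set x := Re z; set y := Im z.
have m0 : 0 <= m := modC_ge0 z.
have xm : `|x| <= m := ler_Re_modC z.
have ym : `|y| <= m := ler_Im_modC z.
have sq (r : R) : `|r| <= m -> r ^+ 2 <= m ^+ 2.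
  by move=> rm; rewrite -(real_normK (num_real r)) ler_pXn2r// nnegrE.
have em : expR `|x| <= expR m by rewrite ler_expR.
have exm : expR x <= expR m by rewrite ler_expR; apply: le_trans xm; exact: ler_norm.
have H1 : `|expR x - 1 - x| <= m ^+ 2 * expR m.
  apply: (le_trans (normr_expR_sub1x x)).
  by apply: ler_pM => //; rewrite ?sqr_ge0 ?expR_ge0// sq.
have H2 : `|expR x * (cos y - 1)| <= m ^+ 2 * expR m.
  rewrite normrM distrC mulrC; apply: ler_pM => //.
    by apply: (le_trans (one_sub_cos_le y)); exact: sq.
  by rewrite ger0_norm ?expR_ge0.
have H3 : `|expR x * (sin y - y)| <= m ^+ 2 * expR m.
  rewrite normrM mulrC; apply: ler_pM => //.
    by apply: (le_trans (normr_sin_sub y)); exact: sq.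
  by rewrite ger0_norm ?expR_ge0.
have H4 : `|(expR x - 1) * y| <= m ^+ 2 * expR m.
  rewrite normrM expr2 -mulrA mulrC; apply: ler_pM => //.
  apply: (le_trans (normr_expR_sub1 x)); apply: ler_pM => //.
have -> : expR x * cos y - 1 - x = (expR x - 1 - x) + expR x * (cos y - 1) by ring.
have -> : expR x * sin y - 0 - y = expR x * (sin y - y) + (expR x - 1) * y by ring.
have := ler_normD (expR x - 1 - x) (expR x * (cos y - 1)).
have := ler_normD (expR x * (sin y - y)) ((expR x - 1) * y).
lra.
Qed.

End complex_exponential.

(** * Goursat's theorem and the mean over a circle *)

Section circle_mean.
Context {R : realType}.
Local Notation C := (cplx R).
Local Open Scope complex_scope.
Implicit Types (z w : C) (phi psi : C -> C).

Lemma holo_expC : holo (@expC R).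
Proof.
move=> z0; exists (expC z0) => e e0.
pose M := 4 * modC (expC z0) * expR 1.
have M0 : 0 <= M by rewrite !mulr_ge0 ?modC_ge0 ?expR_ge0.
pose dl := Num.min 1 (e / (M + 1)).
have M1 : 0 < M + 1 by lra.
have dl0 : 0 < dl by rewrite /dl lt_min ltr01 divr_gt0.
exists dl => // z zdl; set h := z - z0.
have -> : z = z0 + h by rewrite /h addrC subrK.
have -> : expC (z0 + h) - expC z0 - expC z0 * h = expC z0 * (expC h - 1 - h).
  by rewrite expCD; ring.
have h0 := modC_ge0 h.
have h1 : modC h <= 1 by apply: (le_trans zdl); rewrite /dl ge_min lexx.
have hM : modC h * (M + 1) <= e.
  by rewrite -ler_pdivlMr//; apply: (le_trans zdl); rewrite /dl ge_min lexx orbT.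
rewrite modCM; apply: (@le_trans _ _ (M * modC h ^+ 2)).
  apply: (le_trans (ler_wpM2l (modC_ge0 _) (modC_expC_sub h))).
  have eh : expR (modC h) <= expR 1 by rewrite ler_expR.
  have -> : modC (expC z0) * (4 * modC h ^+ 2 * expR (modC h)) =
    4 * modC (expC z0) * modC h ^+ 2 * expR (modC h) by ring.
  rewrite /M [leRHS]mulrAC ler_wpM2l// !mulr_ge0 ?modC_ge0 ?sqr_ge0//.
rewrite expr2 mulrA ler_wpM2r// (le_trans _ hM)// mulrC ler_wpM2l//; lra.
Qed.

Lemma holo_lip phi z0 : holo phi -> exists2 M : R, 0 < M &
  exists2 dl : R, 0 < dl & forall z, modC (z - z0) <= dl ->
    modC (phi z - phi z0) <= M * modC (z - z0).
Proof.
move=> /(_ z0)[c /(_ 1 ltr01)[dl dl0 H]].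
exists (1 + modC c); first by rewrite ltr_pwDl// modC_ge0.
exists dl => // z /H h.
rewrite -[phi z - phi z0](subrK (c * (z - z0))).
by apply: (le_trans (modCD _ _)); rewrite modCM mulrDl lerD.
Qed.

Lemma holo_comp phi psi : holo phi -> holo psi -> holo (phi \o psi).
Proof.
move=> hphi hpsi z0; have [c1 H1] := hphi (psi z0); have [c2 H2] := hpsi z0.
have [M M0 [d0 d00 H0]] := holo_lip z0 hpsi.
exists (c1 * c2) => e e0.
have e1 : 0 < e / 2 / M by rewrite !divr_gt0.
have c10 := modC_ge0 c1.
have c1p : 0 < modC c1 + 1 by lra.
have e2 : 0 < e / 2 / (modC c1 + 1) by rewrite !divr_gt0.
have [d1 d10 H1'] := H1 _ e1.
have [d2 d20 H2'] := H2 _ e2.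
exists (Num.min d0 (Num.min d2 (d1 / M))).
  by rewrite !lt_min d00 d20 divr_gt0.
move=> z; rewrite !le_min => /andP[zd0 /andP[zd2 zd1]] /=.
have Hpsi := H0 _ zd0.
have h1 : modC (psi z - psi z0) <= d1.
  by apply: (le_trans Hpsi); rewrite mulrC -ler_pdivlMr.
have K1 := H1' _ h1; have K2 := H2' _ zd2.
have -> : phi (psi z) - phi (psi z0) - c1 * c2 * (z - z0) =
  (phi (psi z) - phi (psi z0) - c1 * (psi z - psi z0)) +
  c1 * (psi z - psi z0 - c2 * (z - z0)) by ring.
apply: (le_trans (modCD _ _)).
have {}K1 : modC (phi (psi z) - phi (psi z0) - c1 * (psi z - psi z0)) <=
    e / 2 * modC (z - z0).
  apply: (le_trans K1); apply: (le_trans (ler_wpM2l (ltW e1) Hpsi)).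
  by rewrite mulrA divfK ?gt_eqF.
rewrite modCM.
have {}K2 : modC c1 * modC (psi z - psi z0 - c2 * (z - z0)) <=
    e / 2 * modC (z - z0).
  apply: (le_trans (ler_wpM2l c10 K2)); rewrite mulrA ler_wpM2r ?modC_ge0//.
  have -> : modC c1 * (e / 2 / (modC c1 + 1)) = e / 2 * (modC c1 / (modC c1 + 1)).
    by ring.
  rewrite ler_piMr ?divr_ge0 ?(ltW e0)//.
  by rewrite ler_pdivrMr//; lra.
have := modC_ge0 (z - z0); lra.
Qed.

Lemma lip_continuous (f : R -> R) :
  (forall t0, exists2 M : R, 0 < M & exists2 dl : R, 0 < dl &
    forall t, `|t - t0| <= dl -> `|f t - f t0| <= M * `|t - t0|) ->
  continuous f.
Proof.
move=> H t0; have [M M0 [dl dl0 Hd]] := H t0.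
apply/cvgrPdist_le => e e0.
have eM : 0 < Num.min dl (e / M) by rewrite lt_min dl0 divr_gt0.
near=> t.
have : `|t - t0| <= Num.min dl (e / M).
  rewrite distrC; near: t; exact: cvgr_dist_le.
rewrite le_min => /andP[tdl te]; rewrite distrC.
by apply: (le_trans (Hd _ tdl)); rewrite mulrC -ler_pdivlMr.
Unshelve. all: by end_near. Qed.

Lemma holo_ccont phi (al be : C) : holo phi ->
  ccont (fun t => phi (al + be * rC t)).
Proof.
move=> hphi.
have H t0 : exists2 M : R, 0 < M & exists2 dl : R, 0 < dl &
    forall t, `|t - t0| <= dl ->
    modC (phi (al + be * rC t) - phi (al + be * rC t0)) <= M * `|t - t0|.
  have [M M0 [dl dl0 Hd]] := holo_lip (al + be * rC t0) hphi.
  have b0 := modC_ge0 be.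
  have b1 : 0 < modC be + 1 by lra.
  exists (M * (modC be + 1)); first by rewrite mulr_gt0.
  exists (dl / (modC be + 1)); first by rewrite divr_gt0.
  move=> t; rewrite ler_pdivlMr// => tdl.
  have E : modC (al + be * rC t - (al + be * rC t0)) = modC be * `|t - t0|.
    have -> : al + be * rC t - (al + be * rC t0) = be * (rC t - rC t0) by ring.
    by rewrite modCM -modC_real rCB.
  have le1 : modC be * `|t - t0| <= `|t - t0| * (modC be + 1).
    by rewrite mulrDr mulr1 mulrC lerDl.
  apply: (le_trans (Hd _ _)); rewrite E; first exact: le_trans tdl.
  by rewrite -mulrA ler_wpM2l ?(ltW M0)// [leRHS]mulrC.
split; apply: lip_continuous => t0; have [M M0 [dl dl0 Hd]] := H t0;
  exists M => //; exists dl => // t /Hd; apply: le_trans => /=.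
  by rewrite -cReB ler_Re_modC.
by rewrite -cImB ler_Im_modC.
Qed.

(** The contour integral along the boundary, counterclockwise: bottom minus top, plus i times right
    minus left. Opposite sides share an integrand, so that an affine [phi] contributes a constant to
    each. *)
Definition rect_int phi (x y u v : R) : C :=
  cint x (x + u) (fun s => phi (s +i* y) - phi (s +i* (y + v))) +
  'i * cint y (y + v) (fun s => phi ((x + u) +i* s) - phi (x +i* s)).

Lemma holo_hor phi y : holo phi -> ccont (fun s => phi (s +i* y)).
Proof.
move=> /(holo_ccont (0 +i* y) 1); congr ccont; apply/funext => s.
by congr phi; apply: cplx_eq => /=; ring.
Qed.

Lemma holo_ver phi x : holo phi -> ccont (fun s => phi (x +i* s)).
Proof.
move=> /(holo_ccont (x +i* 0) 'i); congr ccont; apply/funext => s.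
by congr phi; apply: cplx_eq => /=; ring.
Qed.

Lemma rect_intE phi x y u v : holo phi -> rect_int phi x y u v =
  cint x (x + u) (fun s => phi (s +i* y)) -
  cint x (x + u) (fun s => phi (s +i* (y + v))) +
  'i * (cint y (y + v) (fun s => phi ((x + u) +i* s)) -
        cint y (y + v) (fun s => phi (x +i* s))).
Proof.
by move=> hphi; rewrite /rect_int !cintB//;
  [exact: holo_ver|exact: holo_ver|exact: holo_hor|exact: holo_hor].
Qed.

Lemma goursat phi x y u v : holo phi -> 0 < u -> 0 < v ->
  rect_int phi x y u v = 0.
Proof.
move=> hphi; move: x y u v; apply: rectangle_bisection.
  move=> x y u v u0 v0; rewrite !rect_intE//.
  have xu : x + u = x + u / 2 + u / 2 by lra.
  have yv : y + v = y + v / 2 + v / 2 by lra.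
  have sx F : ccont F ->
      cint x (x + u) F = cint x (x + u / 2) F + cint (x + u / 2) (x + u / 2 + u / 2) F.
    by move=> cF; rewrite (@cint_split _ x (x + u / 2)) -?xu//; lra.
  have sy F : ccont F ->
      cint y (y + v) F = cint y (y + v / 2) F + cint (y + v / 2) (y + v / 2 + v / 2) F.
    by move=> cF; rewrite (@cint_split _ y (y + v / 2)) -?yv//; lra.
  rewrite !sx ?sy; try exact: holo_hor; try exact: holo_ver.
  rewrite -xu -yv; ring.
move=> x0 y0 e e0; have [c /(_ (e / 16))[|dl dl0 H]] := hphi (x0 +i* y0).
  by rewrite divr_gt0.
(* Any point of the rectangle is within [u + v <= dl] of the base point. *)
exists (dl / 2); first by rewrite divr_gt0.
move=> x y u v u0 v0 udl vdl /andP[xx0 x0x] /andP[yy0 y0y].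
have close a b : x <= a <= x + u -> y <= b <= y + v ->
    modC (phi (a +i* b) - phi (x0 +i* y0) - c * ((a - x0) +i* (b - y0))) <=
    e / 16 * (u + v).
  move=> /andP[xa ax] /andP[yb by_].
  have hm : modC ((a +i* b) - (x0 +i* y0)) <= u + v.
    apply: (le_trans (modC_le_ReIm _)); rewrite /= lerD// ler_norml; lra.
  apply: (@le_trans _ _ (e / 16 * modC ((a +i* b) - (x0 +i* y0)))).
    by apply: H; apply: (le_trans hm); lra.
  by rewrite ler_wpM2l// divr_ge0 ?ltW.
(* Along horizontal sides the affine approximation of [phi] differs by exactly [- c * 'i * v]; what
   is left are two remainders of size [e / 16 * (u + v)]. *)
have K1 : modC (cint x (x + u) (fun s => phi (s +i* y) - phi (s +i* (y + v))) -
    (- c * 'i * rC v) * rC (x + u - x)) <= 2 * (e / 8 * (u + v)) * (x + u - x).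
  apply: cint_bound; [by apply: ccontB; exact: holo_hor|lra|move=> s /andP[xs sx]].
  have -> : phi (s +i* y) - phi (s +i* (y + v)) - - c * 'i * rC v =
    (phi (s +i* y) - phi (x0 +i* y0) - c * ((s - x0) +i* (y - y0))) -
    (phi (s +i* (y + v)) - phi (x0 +i* y0) - c * ((s - x0) +i* (y + v - y0))).
    have -> : ((s - x0) +i* (y + v - y0)) = ((s - x0) +i* (y - y0)) + 'i * rC v :> C.
      by apply: cplx_eq => /=; ring.
    by ring.
  apply: (le_trans (modCB _ _)).
  have := close s y; have := close s (y + v); rewrite xs sx.
  move=> /(_ isT)/= h1 /(_ isT)/= h2.
  have {}h1 : modC (phi (s +i* (y + v)) - phi (x0 +i* y0) -
      c * ((s - x0) +i* (y + v - y0))) <= e / 16 * (u + v) by apply: h1; lra.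
  have {}h2 : modC (phi (s +i* y) - phi (x0 +i* y0) -
      c * ((s - x0) +i* (y - y0))) <= e / 16 * (u + v) by apply: h2; lra.
  lra.
have K2 : modC (cint y (y + v) (fun s => phi ((x + u) +i* s) - phi (x +i* s)) -
    (c * rC u) * rC (y + v - y)) <= 2 * (e / 8 * (u + v)) * (y + v - y).
  apply: cint_bound; [by apply: ccontB; exact: holo_ver|lra|move=> s /andP[ys sy]].
  have -> : phi ((x + u) +i* s) - phi (x +i* s) - c * rC u =
    (phi ((x + u) +i* s) - phi (x0 +i* y0) - c * ((x + u - x0) +i* (s - y0))) -
    (phi (x +i* s) - phi (x0 +i* y0) - c * ((x - x0) +i* (s - y0))).
    have -> : ((x + u - x0) +i* (s - y0)) = ((x - x0) +i* (s - y0)) + rC u :> C.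
      by apply: cplx_eq => /=; ring.
    by ring.
  apply: (le_trans (modCB _ _)).
  have := close (x + u) s; have := close x s; rewrite ys sy.
  have -> : x <= x + u <= x + u by lra.
  have -> : x <= x <= x + u by lra.
  move=> /(_ isT isT) h1 /(_ isT isT) h2; lra.
rewrite /rect_int.
set A := cint x _ _ in K1 *; set B := cint y _ _ in K2 *.
(* The affine contributions cancel: [- c 'i v u + 'i c u v = 0]. *)
have -> : A + 'i * B = (A - (- c * 'i * rC v) * rC (x + u - x)) +
   'i * (B - (c * rC u) * rC (y + v - y)).
  have -> : x + u - x = u by ring.
  have -> : y + v - y = v by ring.
  by ring.
apply: (le_trans (modCD _ _)); rewrite modCM.
have -> : modC ('i : C) = 1 by rewrite /= expr0n expr1n add0r sqrtr1.
rewrite mul1r; apply: (le_trans (lerD K1 K2)).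
have := mulr_gt0 e0 (exprn_gt0 2 (addr_gt0 u0 v0)).
have -> : 2 * (e / 8 * (u + v)) * (x + u - x) + 2 * (e / 8 * (u + v)) * (y + v - y)
  = e * (u + v) ^+ 2 / 4 by field.
lra.
Qed.

(* Goursat for phi \o expC on [ln r, 0] x [-pi, pi]: the horizontal sides cancel, so the
   mean over the circle of radius r does not depend on r; let r tend to 0. *)
Lemma circle_mean phi : holo phi ->
  cint (- pi) pi (fun th => phi (cos th +i* sin th)) = phi 0 * rC (2 * pi).
Proof.
move=> hphi; pose psi := phi \o @expC R.
have hpsi : holo psi by apply: holo_comp => //; exact: holo_expC.
have pi0 := @pi_gt0 R.
have pp : - pi + 2 * pi = pi :> R by ring.
have A0 (rho : R) : rho < 0 ->
    cint (- pi) pi (fun s => psi (0 +i* s)) = cint (- pi) pi (fun s => psi (rho +i* s)).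
  move=> r0; have := @goursat psi rho (- pi) (- rho) (2 * pi) hpsi.
  rewrite rect_intE// subrr pp => H.
  have u0 : 0 < - rho by lra.
  have v0 : 0 < 2 * pi :> R by lra.
  have {}H := H u0 v0.
  have E : (fun s : R => psi (s +i* - pi)) = (fun s : R => psi (s +i* pi)).
    by apply/funext => s; congr phi; rewrite /expC/= cosN sinN sinpi oppr0.
  rewrite E subrr add0r in H.
  have i0 : 'i != 0 :> C by apply/eqP => -[/eqP]; rewrite oner_eq0.
  by move/eqP: H; rewrite mulf_eq0 (negbTE i0)/= subr_eq0 => /eqP.
have -> : (fun th : R => phi (cos th +i* sin th)) = (fun s => psi (0 +i* s)).
  by apply/funext => s; congr phi; rewrite /expC/= expR0 !mul1r.
apply/eqP; rewrite -subr_eq0; apply/eqP/modC_eq0/eqP.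
rewrite eq_le modC_ge0 andbT; apply/ler_addgt0Pr => e e0; rewrite add0r.
have e1 : 0 < e / (4 * pi) by rewrite divr_gt0 ?mulr_gt0.
have [M M0 [dl dl0 Hd]] := holo_lip 0 hphi.
(* The bound 1/2 makes [ln r] negative, as a rectangle ending at 0 requires; the others keep [phi]
   on the small circle within [e / (4 * pi)] of [phi 0], and [cint_bound] doubles this. *)
pose r := Num.min (1 / 2) (Num.min dl (e / (4 * pi) / M)).
have r0 : 0 < r.
  by rewrite /r !lt_min dl0 (divr_gt0 e1 M0) divr_gt0.
have r1 : r < 1 by rewrite gt_min; apply/orP; left; lra.
rewrite (A0 (ln r)); last by rewrite ln_lt0// r0.
have -> : phi 0 * rC (2 * pi) = phi 0 * rC (pi - (- pi)).
  by congr (_ * rC _); ring.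
have -> : e = 2 * (e / (4 * pi)) * (pi - (- pi)).
  by move: (@pi R) pi0 => q q0; field; rewrite gt_eqF.
apply: cint_bound; [exact: holo_ver|lra|move=> s _].
have mE : modC (expC (ln r +i* s)) = r by rewrite modC_expC/= lnK.
have := Hd (expC (ln r +i* s)); rewrite !subr0 mE => Hd'.
apply: (le_trans (Hd' _)); first by rewrite /r !ge_min lexx orbT.
by rewrite mulrC -ler_pdivlMr// /r !ge_min lexx !orbT.
Qed.

End circle_mean.

(** * Integrals of complex functions *)

Section complex_integral.
Context d (T : measurableType d) (R : realType).
Local Notation C := (cplx R).
Local Notation Re := (@complex.Re R).
Local Notation Im := (@complex.Im R).
Local Open Scope complex_scope.
Implicit Types (f g : T -> C) (c : C).

(** The same condition as [measurableC], over any measurable space: kernels are functions on the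
    product of C^n with itself. *)
Definition mesC f : Prop :=
  measurable_fun setT (fun x => Re (f x)) /\
  measurable_fun setT (fun x => Im (f x)).

Lemma mesC_cst c : mesC (fun=> c).
Proof. by split; exact: measurable_cst. Qed.

Lemma mesCD f g : mesC f -> mesC g -> mesC (fun x => f x + g x).
Proof.
move=> [f1 f2] [g1 g2]; split.
  by under eq_fun do rewrite cReD; exact: measurable_funD.
by under eq_fun do rewrite cImD; exact: measurable_funD.
Qed.

Lemma mesCN f : mesC f -> mesC (fun x => - f x).
Proof.
move=> [f1 f2]; split.
  by under eq_fun do rewrite cReN; exact: measurable_funN.
by under eq_fun do rewrite cImN; exact: measurable_funN.
Qed.

Lemma mesCB f g : mesC f -> mesC g -> mesC (fun x => f x - g x).
Proof. by move=> mf mg; apply: mesCD => //; exact: mesCN. Qed.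

Lemma mesCM f g : mesC f -> mesC g -> mesC (fun x => f x * g x).
Proof.
move=> [f1 f2] [g1 g2]; split.
  under eq_fun do rewrite cReM.
  by apply: measurable_funB; exact: measurable_funM.
under eq_fun do rewrite cImM.
by apply: measurable_funD; exact: measurable_funM.
Qed.

Lemma mesCJ f : mesC f -> mesC (fun x => (f x)^*%C).
Proof.
move=> [f1 f2]; split; first by under eq_fun do rewrite cReJ.
by under eq_fun do rewrite cImJ; exact: measurable_funN.
Qed.

Lemma mesC_rC (r : T -> R) : measurable_fun setT r -> mesC (fun x => rC (r x)).
Proof. by move=> mr; split => //=; exact: measurable_cst. Qed.

Lemma mesC_sum (I : Type) (s : seq I) (F : I -> T -> C) :
  (forall i, mesC (F i)) -> mesC (fun x => \sum_(i <- s) F i x).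
Proof.
move=> mF; elim: s => [|i s IH].
  by under eq_fun do rewrite big_nil; exact: mesC_cst.
by under eq_fun do rewrite big_cons; exact: mesCD.
Qed.

Lemma mesC_expC f : mesC f -> mesC (fun x => expC (f x)).
Proof.
move=> [f1 f2]; split; apply: measurable_funM.
- exact: measurableT_comp (@measurable_expR R) f1.
- exact: measurableT_comp (continuous_measurable_fun (@continuous_cos R)) f2.
- exact: measurableT_comp (@measurable_expR R) f1.
- exact: measurableT_comp (continuous_measurable_fun (@continuous_sin R)) f2.
Qed.

Lemma measurable_modC f : mesC f -> measurable_fun setT (fun x => modC (f x)).
Proof.
move=> [f1 f2].
have E x : modC (f x) = Num.sqrt (Re (f x) ^+ 2 + Im (f x) ^+ 2).
  by case: (f x).
under eq_fun do rewrite E.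
have ms : measurable_fun setT (@Num.sqrt R).
  by apply: continuous_measurable_fun; exact: sqrt_continuous.
apply: (measurableT_comp ms).
by apply: measurable_funD; exact: measurable_funX.
Qed.

Section integral.
Variable mu : {measure set T -> \bar R}.

Definition intC f : C :=
  ((\int[mu]_x Re (f x)) +i* (\int[mu]_x Im (f x))).

Definition integrableC f : Prop :=
  mu.-integrable setT (EFin \o (fun x => Re (f x))) /\
  mu.-integrable setT (EFin \o (fun x => Im (f x))).

Lemma integrableCP f : mesC f -> (\int[mu]_x (modC (f x))%:E < +oo)%E ->
  integrableC f.
Proof.
move=> mf foo; have mm := measurable_modC mf.
have im : mu.-integrable setT (EFin \o (fun x => modC (f x))).
  apply/integrableP; split; first exact/measurable_EFinP.
  under eq_integral do rewrite /= ger0_norm ?modC_ge0//.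
  exact: foo.
have [f1 f2] := mf.
split; apply: le_integrable im => //; try exact/measurable_EFinP.
  by move=> x _; rewrite /= lee_fin (ger0_norm (modC_ge0 _)) ler_Re_modC.
by move=> x _; rewrite /= lee_fin (ger0_norm (modC_ge0 _)) ler_Im_modC.
Qed.

Lemma integrableC_mesC f : integrableC f -> mesC f.
Proof.
by move=> [/measurable_int/measurable_EFinP f1 /measurable_int/measurable_EFinP f2].
Qed.

Lemma integrableC_modC f : integrableC f ->
  mu.-integrable setT (EFin \o (fun x => modC (f x))).
Proof.
move=> If; have mf := integrableC_mesC If; have mm := measurable_modC mf.
have [f1 f2] := If.
have I2 := integrableD measurableT (integrable_abse f1) (integrable_abse f2).
apply: (le_integrable _ _ _ I2) => //; first exact/measurable_EFinP.
move=> x _ /=; rewrite !lee_fin ger0_norm ?modC_ge0//.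
by rewrite (ger0_norm (addr_ge0 _ _))// modC_le_ReIm.
Qed.

Lemma integrableC_lty f : integrableC f -> (\int[mu]_x (modC (f x))%:E < +oo)%E.
Proof.
move=> /integrableC_modC/integrableP[_].
by under eq_integral do rewrite /= ger0_norm ?modC_ge0//.
Qed.

Lemma intCD f g : integrableC f -> integrableC g ->
  intC (fun x => f x + g x) = intC f + intC g.
Proof.
move=> [f1 f2] [g1 g2]; apply: cplx_eq; rewrite ?cReD ?cImD /=.
  by rewrite -RintegralD//; apply: eq_Rintegral => x _; rewrite cReD.
by rewrite -RintegralD//; apply: eq_Rintegral => x _; rewrite cImD.
Qed.

Lemma integrableCD f g : integrableC f -> integrableC g ->
  integrableC (fun x => f x + g x).
Proof.
move=> [f1 f2] [g1 g2]; split.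
  rewrite (_ : _ \o _ = (EFin \o (fun x => Re (f x))) \+
    (EFin \o (fun x => Re (g x))))%E; first exact: integrableD.
  by apply/funext => x /=; rewrite cReD.
rewrite (_ : _ \o _ = (EFin \o (fun x => Im (f x))) \+
  (EFin \o (fun x => Im (g x))))%E; first exact: integrableD.
by apply/funext => x /=; rewrite cImD.
Qed.

Lemma integrableRZ (a : R) (h : T -> R) : mu.-integrable setT (EFin \o h) ->
  mu.-integrable setT (EFin \o (fun x => a * h x)).
Proof. by move=> ih; exact: (integrableZl measurableT a ih). Qed.

Lemma integrableCZ c f : integrableC f -> integrableC (fun x => c * f x).
Proof.
move=> [f1 f2]; split.
  rewrite (_ : _ \o _ = (EFin \o (fun x => (Re c * Re (f x))%R)) \-
    (EFin \o (fun x => (Im c * Im (f x))%R)))%E.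
    by apply: integrableB => //; exact: integrableRZ.
  by apply/funext => x /=; rewrite cReM.
rewrite (_ : _ \o _ = (EFin \o (fun x => (Re c * Im (f x))%R)) \+
  (EFin \o (fun x => (Im c * Re (f x))%R)))%E.
  by apply: integrableD => //; exact: integrableRZ.
by apply/funext => x /=; rewrite cImM.
Qed.

Lemma intCZ c f : integrableC f -> intC (fun x => c * f x) = c * intC f.
Proof.
move=> [f1 f2]; apply: cplx_eq; rewrite ?cReM ?cImM /=.
  rewrite -!RintegralZl// -RintegralB//; try exact: integrableRZ.
  by apply: eq_Rintegral => x _; rewrite cReM.
rewrite -!RintegralZl// -RintegralD//; try exact: integrableRZ.
by apply: eq_Rintegral => x _; rewrite cImM.
Qed.

Lemma integrableCN f : integrableC f -> integrableC (fun x => - f x).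
Proof.
move=> /(integrableCZ (-1)); congr integrableC.
by apply/funext => x; rewrite mulN1r.
Qed.

Lemma intCN f : integrableC f -> intC (fun x => - f x) = - intC f.
Proof.
move=> If; rewrite -mulN1r -intCZ//; congr intC.
by apply/funext => x; rewrite mulN1r.
Qed.

Lemma intCB f g : integrableC f -> integrableC g ->
  intC (fun x => f x - g x) = intC f - intC g.
Proof. by move=> If Ig; rewrite intCD ?intCN//; exact: integrableCN. Qed.

Lemma integrableCB f g : integrableC f -> integrableC g ->
  integrableC (fun x => f x - g x).
Proof. by move=> If Ig; apply: integrableCD => //; exact: integrableCN. Qed.

Lemma integrableCJ f : integrableC f -> integrableC (fun x => (f x)^*%C).
Proof.
move=> [f1 f2]; split.
  by rewrite (_ : (fun x => _) = (fun x => Re (f x)))//; apply/funext => x; rewrite cReJ.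
rewrite (_ : (fun x => _) = (fun x => -1 * Im (f x))); first exact: integrableRZ.
by apply/funext => x; rewrite cImJ mulN1r.
Qed.

Lemma intCJ f : integrableC f -> intC (fun x => (f x)^*%C) = (intC f)^*%C.
Proof.
move=> [f1 f2]; apply: cplx_eq; rewrite ?cReJ ?cImJ /=.
  by under eq_Rintegral do rewrite cReJ.
rewrite -mulN1r -RintegralZl//.
by apply: eq_Rintegral => x _; rewrite cImJ mulN1r.
Qed.

(** With c the integral of f, |c|^2 is the integral of the real part of conj(c) f, which is at most
    |c| times the integral of |f|. *)
Lemma modC_intC f : integrableC f ->
  ((modC (intC f))%:E <= \int[mu]_x (modC (f x))%:E)%E.
Proof.
move=> If; set c := intC f; have Im := integrableC_modC If.
have -> : (\int[mu]_x (modC (f x))%:E = (\int[mu]_x modC (f x))%R%:E)%E.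
  by rewrite /Rintegral fineK//; exact: integrable_fin_num Im.
rewrite lee_fin; have [c0|c0] := eqVneq (modC c) 0.
  by rewrite c0; apply: Rintegral_ge0 => x _; exact: modC_ge0.
have cp : 0 < modC c by rewrite lt_def c0 modC_ge0.
have H : modC c ^+ 2 = \int[mu]_x Re (c^*%C * f x).
  have -> : \int[mu]_x Re (c^*%C * f x) = Re (intC (fun x => c^*%C * f x)) by [].
  by rewrite intCZ// -/c modC_sqr; case: (c) => a b /=; ring.
rewrite -(ler_pM2l cp) -expr2 H -RintegralZl//.
apply: le_Rintegral => //.
- by have [] := integrableCZ c^*%C If.
- exact: integrableRZ.
- by move=> x _; rewrite -(modC_conj c) -modCM (le_trans (ler_norm _))// ler_Re_modC.
Qed.

Lemma eq_intC f g : (forall x, f x = g x) -> intC f = intC g.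
Proof. by move=> fg; congr intC; exact/funext. Qed.

End integral.
End complex_integral.

Lemma mesC_comp d d' (T : measurableType d) (T' : measurableType d') (R : realType)
    (f : T -> cplx R) (h : T' -> T) :
  measurable_fun setT h -> mesC f -> mesC (fun x => f (h x)).
Proof.
move=> mh [f1 f2]; split; first exact: (measurableT_comp f1 mh).
exact: (measurableT_comp f2 mh).
Qed.

Section transformations.
Context d (T : measurableType d) (R : realType).
Local Notation C := (cplx R).
Local Notation Re := (@complex.Re R).
Local Notation Im := (@complex.Im R).

(** [preserves] speaks of nonnegative functions, for which Tonelli is unconditional; splitting into
    positive and negative parts extends it to signed ones. *)
Lemma preserves_integral (mu : {measure set T -> \bar R}) (phi : T -> T)
    (f : T -> \bar R) : preserves mu phi -> measurable_fun setT f ->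
  (\int[mu]_x f (phi x) = \int[mu]_x f x)%E.
Proof.
move=> [mphi iphi] mf; rewrite [LHS]integralE [RHS]integralE.
have <- := iphi _ (measurable_funepos mf) (fun x => funepos_ge0 f x).
have <- := iphi _ (measurable_funeneg mf) (fun x => funeneg_ge0 f x).
by congr (_ - _)%E; apply: eq_integral => x _; rewrite ?funeposE ?funenegE.
Qed.

Lemma preserves_intC (mu : {measure set T -> \bar R}) (phi : T -> T)
    (f : T -> C) : preserves mu phi -> mesC f ->
  intC mu (fun x => f (phi x)) = intC mu f.
Proof.
move=> pphi [f1 f2]; rewrite /intC /Rintegral.
rewrite -(preserves_integral (f := fun x => (Re (f x))%:E) pphi); last exact/measurable_EFinP.
rewrite -(preserves_integral (f := fun x => (Im (f x))%:E) pphi)//; exact/measurable_EFinP.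
Qed.

Lemma intC_density (mu nu : {measure set T -> \bar R}) (g : T -> R) (f : T -> C) :
  measurable_fun setT g -> (forall x, 0 <= g x) ->
  (forall A, measurable A -> nu A = (\int[mu]_(x in A) (g x)%:E)%E) ->
  mesC f -> intC nu f = intC mu (fun x => f x * rC (g x)).
Proof.
move=> mg g0 nuE [f1 f2]; rewrite /intC /Rintegral.
rewrite (integral_density mg g0 nuE f1) (integral_density mg g0 nuE f2).
by apply: cplx_eq => /=; congr fine; apply: eq_integral => x _; congr EFin;
  rewrite ?cReM ?cImM /= mulr0 ?subr0 ?add0r.
Qed.

End transformations.

(** * Fubini's theorem for complex functions *)

Section fubiniC.
Context d1 d2 (T1 : measurableType d1) (T2 : measurableType d2) (R : realType).
Variables (m1 : {sigma_finite_measure set T1 -> \bar R}).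
Variables (m2 : {sigma_finite_measure set T2 -> \bar R}).
Local Notation C := (cplx R).
Local Notation Re := (@complex.Re R).
Local Notation Im := (@complex.Im R).

Let Rintegral_fubini (f : T1 * T2 -> R) :
  measurable_fun setT f ->
  (\int[m1]_x \int[m2]_y `|f (x, y)|%:E < +oo)%E ->
  (forall x, m2.-integrable setT (fun y => (f (x, y))%:E)) ->
  (forall y, m1.-integrable setT (fun x => (f (x, y))%:E)) ->
  \int[m1]_x (\int[m2]_y f (x, y)) = \int[m2]_y (\int[m1]_x f (x, y)).
Proof.
move=> mf foo I1 I2; have mfE : measurable_fun setT (EFin \o f) by exact/measurable_EFinP.
have If : (m1 \x m2)%E.-integrable setT (EFin \o f).
  by apply/integrable12ltyP.
have := Fubini If => H; rewrite /Rintegral.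
transitivity (fine (\int[m1]_x \int[m2]_y (f (x, y))%:E)%E).
  congr fine; apply: eq_integral => x _; rewrite fineK//.
  exact: integrable_fin_num (I1 x).
transitivity (fine (\int[m2]_y \int[m1]_x (f (x, y))%:E)%E).
  by congr fine; exact: H.
congr fine; apply: eq_integral => x _; rewrite fineK//.
exact: integrable_fin_num (I2 x).
Qed.

(** Integrability of every section, not just almost every one, makes each inner real integral equal
    to the extended one. The kernels to which this is applied satisfy it, since each [ker t z] is in
    L2. *)
Lemma intC_fubini (f : T1 * T2 -> C) : mesC f ->
  (\int[m1]_x \int[m2]_y (modC (f (x, y)))%:E < +oo)%E ->
  (forall x, integrableC m2 (fun y => f (x, y))) ->
  (forall y, integrableC m1 (fun x => f (x, y))) ->
  intC m1 (fun x => intC m2 (fun y => f (x, y))) =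
  intC m2 (fun y => intC m1 (fun x => f (x, y))).
Proof.
move=> mf foo I1 I2; have [f1 f2] := mf; have mm := measurable_modC mf.
have le (h : T1 * T2 -> R) : measurable_fun setT h ->
    (forall p, `|h p| <= modC (f p)) ->
    (\int[m1]_x \int[m2]_y `|h (x, y)|%:E < +oo)%E.
  move=> mh hf; apply: le_lt_trans foo.
  have mh' : measurable_fun setT (fun p => `|h p|%:E).
    by apply/measurable_EFinP; exact: measurableT_comp.
  apply: ge0_le_integral => //.
  - by move=> x _; apply: integral_ge0.
  - exact: (measurable_fun_fubini_tonelli_F (m2 := m2) (fun p => `|h p|%:E)).
  - apply: (measurable_fun_fubini_tonelli_F (m2 := m2) (fun p => (modC (f p))%:E)).
      exact/measurable_EFinP.
    by move=> p; rewrite lee_fin modC_ge0.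
  - move=> x _; apply: ge0_le_integral => //.
    + exact: (measurableT_comp mh' (pair1_measurable _)).
    + by apply/measurable_EFinP; exact: (measurableT_comp mm (pair1_measurable _)).
    + by move=> y _; rewrite lee_fin.
rewrite /intC; apply: cplx_eq => /=.
  apply: (@Rintegral_fubini (fun p => Re (f p))) => //.
  - by apply: (le (fun p => Re (f p))) => // p; exact: ler_Re_modC.
  - by move=> x; have [] := I1 x.
  - by move=> y; have [] := I2 y.
apply: (@Rintegral_fubini (fun p => Im (f p))) => //.
- by apply: (le (fun p => Im (f p))) => // p; exact: ler_Im_modC.
- by move=> x; have [] := I1 x.
- by move=> y; have [] := I2 y.
Qed.

End fubiniC.

(** * The reproducing formula *)

Section gaussian_mean.
Context {R : realType} (n : nat).
Local Notation C := (cplx R).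
Local Notation Re := (@complex.Re R).
Local Notation Im := (@complex.Im R).
Local Notation dv := (lebesgueC R n).
Local Notation leb := (@lebesgue_measure R).
Local Notation mR := (measurableTypeR R).
Implicit Types (t : R) (z w u : Cn R n).

Lemma normsq_modC z : normsq z = \sum_(i < n) modC (z 0 i) ^+ 2.
Proof. by apply: eq_bigr => i _; rewrite modC_sqr. Qed.

Lemma normsqZ (c : C) z : normsq (c *: z) = modC c ^+ 2 * normsq z.
Proof.
rewrite !normsq_modC mulr_sumr; apply: eq_bigr => i _.
by rewrite mxE modCM exprMn.
Qed.

Lemma gaussian_densityE t z : 0 < t ->
  gaussian_density t z = expR (- normsq z / (4 * t)) / (4 * pi * t) ^+ n.
Proof.
by move=> t0; rewrite /gaussian_density ger0_norm// !mulr_ge0 ?pi_ge0// ltW.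
Qed.

Lemma integral_gaussian_density t : 0 < t ->
  (\int[dv]_z (gaussian_density t z)%:E = 1)%E.
Proof.
move=> t0; have c0 : 0 < (4 * pi * t) ^+ n by rewrite exprn_gt0// !mulr_gt0// pi_gt0.
under eq_integral do rewrite gaussian_densityE// mulrC EFinM.
rewrite ge0_integralZl//; last 2 first.
- by apply/measurable_EFinP; exact: measurable_gauss.
- by rewrite lee_fin invr_ge0 ltW.
rewrite integral_gauss ?mulr_gt0// -EFinM (_ : pi * (4 * t) = 4 * pi * t); last by ring.
by rewrite mulVf// gt_eqF.
Qed.

Definition rot (th : R) (z : Cn R n) : Cn R n := (cos th +i* sin th)%C *: z.

Lemma normsq_rot th z : normsq (rot th z) = normsq z.
Proof.
by rewrite /rot normsqZ modC_sqr /= cos2Dsin2 mul1r.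
Qed.

Lemma measurable_rot : measurable_fun setT (fun p : mR * Cn R n => rot p.1 p.2).
Proof.
have mc : measurable_fun setT (fun p : mR * Cn R n => cos p.1).
  exact: (measurableT_comp (continuous_measurable_fun (@continuous_cos R)) measurable_fst).
have ms : measurable_fun setT (fun p : mR * Cn R n => sin p.1).
  exact: (measurableT_comp (continuous_measurable_fun (@continuous_sin R)) measurable_fst).
have m1 i : measurable_fun setT (fun p : mR * Cn R n => (coordC i p.2).1).
  exact: (measurableT_comp (measurable_coordC1 i) measurable_snd).
have m2 i : measurable_fun setT (fun p : mR * Cn R n => (coordC i p.2).2).
  exact: (measurableT_comp (measurable_coordC2 i) measurable_snd).
apply: measurable_coordCP => i; apply/measurable_fun_pair => /=.
  rewrite (_ : (fun _ => _) = (fun p : mR * Cn R n =>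
      cos p.1 * (coordC i p.2).1 - sin p.1 * (coordC i p.2).2)).
    by apply: measurable_funB; exact: measurable_funM.
  by apply/funext => p; rewrite /coordC /rot mxE; case: (p.2 0 i).
rewrite (_ : (fun _ => _) = (fun p : mR * Cn R n =>
    cos p.1 * (coordC i p.2).2 + sin p.1 * (coordC i p.2).1)).
  by apply: measurable_funD; exact: measurable_funM.
by apply/funext => p; rewrite /coordC /rot mxE; case: (p.2 0 i).
Qed.

(** Open, because rotations are only known to preserve the measure for angles strictly between
    [- pi] and [pi]; [int_indic] returns to the closed interval. *)
Let D : set mR := `]- pi, pi[%classic.

Let int_indic (h : R -> R) : continuous h ->
  (\int[leb]_x (\1_D x * h x)%:E = (rint (- pi) pi h)%:E)%E.
Proof.
move=> ch.
have Ih := continuous_int (- pi) pi ch.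
have -> : (\int[leb]_x (\1_D x * h x)%:E = \int[leb]_(x in D) (h x)%:E)%E.
  rewrite [RHS]integral_mkcond; apply: eq_integral => x _.
  by rewrite patchE indicE; case: ifPn => _; rewrite ?mul1r ?mul0r.
have mh : measurable_fun setT (EFin \o (h : mR -> mR)).
  by apply/measurable_EFinP; exact: continuous_measurable_fun.
rewrite integral_itv_bndo_bndc; last exact: measurable_funTS.
rewrite integral_itv_obnd_cbnd; last exact: measurable_funTS.
by rewrite /rint /Rintegral fineK//; exact: integrable_fin_num Ih.
Qed.

Let int_indic_cst (r : R) : (\int[leb]_x (\1_D x * r)%:E = (2 * pi * r)%:E)%E.
Proof.
rewrite int_indic; last by move=> x; exact: cst_continuous.
rewrite /rint Rintegral_cst//= lebesgue_measure_itv/= lte_fin gtrN ?pi_gt0//=.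
by congr EFin; rewrite opprK mulrC; congr (_ * _); ring.
Qed.

(** Integrate [G (rot th z)] against the Gaussian in z and over th, in both orders. For fixed th
    rotation invariance removes th; for fixed z the circle mean gives [G 0], and the Gaussian has
    mass 1. *)
Lemma gauss_mean_real t (G : Cn R n -> R) : 0 < t ->
  measurable_fun setT G ->
  (\int[dv]_z (`|G z| * gaussian_density t z)%:E < +oo)%E ->
  (forall u, continuous (fun th => G (rot th u))) ->
  (forall u, rint (- pi) pi (fun th => G (rot th u)) = 2 * pi * G 0) ->
  (\int[dv]_z (G z * gaussian_density t z)%:E = (G 0)%:E)%E.
Proof.
move=> t0 mG Goo cG mean; pose rho := @gaussian_density R n t.
have rho0 z : 0 <= rho z := gaussian_density_ge0 t z.
have mrho : measurable_fun setT rho := @measurable_gaussian_density R n t.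
have rhoR th z : rho (rot th z) = rho z.
  by rewrite /rho /gaussian_density normsq_rot.
(* The indicator of [D] stands in for a restricted domain, so that Fubini applies on the whole
   product. *)
pose F (p : mR * Cn R n) := (\1_D p.1 * (G (rot p.1 p.2) * rho p.2))%:E.
have mi : measurable_fun setT (\1_D : mR -> R).
  by apply: measurable_indic; exact: measurable_itv.
have mF : measurable_fun setT F.
  apply/measurable_EFinP; apply: measurable_funM.
    exact: (measurableT_comp mi measurable_fst).
  apply: measurable_funM; first exact: (measurableT_comp mG measurable_rot).
  exact: (measurableT_comp mrho measurable_snd).
have mGr : measurable_fun setT (fun z => (G z * rho z)%:E).
  by apply/measurable_EFinP; exact: measurable_funM.
have mGra : measurable_fun setT (fun z => (`|G z| * rho z)%:E).
  by apply/measurable_EFinP; apply: measurable_funM => //; exact: measurableT_comp.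
have rotP th : \1_D th = (0 : R) \/ \1_D th = (1 : R) /\ preserves dv (rot th).
  rewrite indicE; case: (boolP (th \in D)) => [|_]; last by left.
  by rewrite inE /D/= in_itv/= => thD; right; split=> //; exact: lebesgueC_rotation.
have IG : dv.-integrable setT (fun z => (G z * rho z)%:E).
  apply/integrableP; split=> //; apply: le_lt_trans Goo.
  rewrite le_eqVlt; apply/orP; left; apply/eqP; apply: eq_integral => z _.
  by rewrite /= normrM (ger0_norm (rho0 z)).
pose I := (\int[dv]_z (`|G z| * rho z)%:E)%E.
have Ifin : I \is a fin_num by rewrite ge0_fin_numE//; apply: integral_ge0 => z _; rewrite lee_fin mulr_ge0.
have IF : (leb \x dv)%E.-integrable setT F.
  apply/integrable12ltyP => //.
  apply: (@le_lt_trans _ _ (\int[leb]_x (\1_D x * fine I)%:E)%E); last first.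
    by rewrite int_indic_cst ltry.
  rewrite le_eqVlt; apply/orP; left; apply/eqP; apply: eq_integral => th _ /=.
  case: (rotP th) => [->|[-> pth]].
    by under eq_integral do rewrite mul0r normr0; rewrite integral0 mul0r.
  rewrite mul1r (fineK Ifin) /I -(preserves_integral pth mGra).
  by apply: eq_integral => z _; rewrite mul1r normrM (ger0_norm (rho0 z)) rhoR.
have := Fubini IF.
pose r := fine (\int[dv]_z (G z * rho z)%:E)%E.
have rE : (r%:E = \int[dv]_z (G z * rho z)%:E)%E by rewrite fineK//; exact: integrable_fin_num.
have -> : (\int[leb]_x \int[dv]_y F (x, y) = (2 * pi * r)%:E)%E.
  rewrite -int_indic_cst; apply: eq_integral => th _; rewrite /F/=.
  case: (rotP th) => [->|[-> pth]].
    by under eq_integral do rewrite mul0r; rewrite integral0 mul0r.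
  rewrite mul1r rE -(preserves_integral pth mGr).
  by apply: eq_integral => z _; rewrite mul1r rhoR.
have -> : (\int[dv]_y \int[leb]_x F (x, y) = (2 * pi * G 0)%:E)%E.
  transitivity (\int[dv]_y ((2 * pi * G 0)%:E * (rho y)%:E))%E.
    apply: eq_integral => u _; rewrite /F/= -EFinM -(mean u) mulrC.
    have cr : continuous (fun th : R => rho u * G (rot th u)).
      by move=> th; apply: cvgM; [exact: cvg_cst|exact: cG].
    transitivity (\int[leb]_x (\1_D x * (rho u * G (rot x u)))%:E)%E.
      by apply: eq_integral => th _; congr EFin; ring.
    rewrite int_indic// /rint RintegralZl//; exact: continuous_int.
  rewrite integralZl//; last first.
    apply/integrableP; split; first exact/measurable_EFinP.
    under eq_integral do rewrite /= ger0_norm//.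
    by rewrite integral_gaussian_density// ltry.
  by rewrite integral_gaussian_density// mule1.
move=> [/(mulfI _)H]; rewrite -rE H// mulf_neq0//.
by rewrite gt_eqF// pi_gt0.
Qed.

(** Only holomorphy along the complex lines through 0 enters: the rotations [rot th] turn every
    point inside such a line. *)
Lemma gauss_mean t (g : Cn R n -> C) : 0 < t -> mesC g ->
  (\int[dv]_z (modC (g z) * gaussian_density t z)%:E < +oo)%E ->
  (forall u, holo (fun la => g (la *: u))) ->
  intC dv (fun z => g z * rC (gaussian_density t z)) = g 0.
Proof.
move=> t0 mg goo hg; have [m1 m2] := mg.
have mrho := @measurable_gaussian_density R n t.
have rho0 := @gaussian_density_ge0 R n t.
have cc u : ccont (fun th => g (rot th u)).
  have := holo_ver 0 (holo_comp (hg u) (@holo_expC R)); congr ccont.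
  by apply/funext => th; rewrite /rot /= /expC/= expR0 !mul1r.
have cm u := circle_mean (hg u).
have le (h : Cn R n -> R) : measurable_fun setT h -> (forall z, `|h z| <= modC (g z)) ->
    (\int[dv]_z (`|h z| * gaussian_density t z)%:E < +oo)%E.
  move=> mh hm; apply: le_lt_trans goo; apply: ge0_le_integral => //.
  - by move=> z _; rewrite lee_fin mulr_ge0.
  - by apply/measurable_EFinP; apply: measurable_funM => //; exact: measurableT_comp.
  - apply/measurable_EFinP; apply: measurable_funM => //; exact: measurable_modC.
  - by move=> z _; rewrite lee_fin ler_wpM2r.
rewrite /intC /Rintegral; apply: cplx_eq => /=.
  rewrite (_ : (\int[dv]_x _)%E = (Re (g 0))%:E)//.
  rewrite -(@gauss_mean_real t (fun z => Re (g z)))//.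
  - by apply: eq_integral => z _; congr EFin; rewrite cReM cRe_rC cIm_rC mulr0 subr0.
  - by apply: le => // z; exact: ler_Re_modC.
  - by move=> u; have [] := cc u.
  - move=> u; have := congr1 Re (cm u); rewrite cReM cRe_rC cIm_rC mulr0 subr0 scale0r.
    by rewrite mulrC => <-.
rewrite (_ : (\int[dv]_x _)%E = (Im (g 0))%:E)//.
rewrite -(@gauss_mean_real t (fun z => Im (g z)))//.
- by apply: eq_integral => z _; congr EFin; rewrite cImM cRe_rC cIm_rC mulr0 add0r.
- by apply: le => // z; exact: ler_Im_modC.
- by move=> u; have [] := cc u.
- move=> u; have := congr1 Im (cm u); rewrite cImM cRe_rC cIm_rC mulr0 add0r scale0r.
  by rewrite mulrC => <-.
Qed.

End gaussian_mean.

Section holo_mul.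
Context {R : realType}.
Local Notation C := (cplx R).

Lemma holo_scale (a : C) : holo (fun z => a * z).
Proof.
move=> z0; exists a => e e0; exists 1 => // z _.
by rewrite -mulrBr subrr modC0 mulr_ge0 ?(ltW e0) ?modC_ge0.
Qed.

Lemma holo_mul (phi psi : C -> C) : holo phi -> holo psi ->
  holo (fun z => phi z * psi z).
Proof.
move=> hphi hpsi z0.
have [c1 H1] := hphi z0; have [c2 H2] := hpsi z0.
have [M1 M10 [d1 d10 K1]] := holo_lip z0 hphi.
have [M2 M20 [d2 d20 K2]] := holo_lip z0 hpsi.
exists (c1 * psi z0 + phi z0 * c2) => e e0.
set A := modC (psi z0); set B := modC (phi z0).
have A0 : 0 <= A := modC_ge0 _; have B0 : 0 <= B := modC_ge0 _.
have eA : 0 < e / 3 / (A + 1) by rewrite !divr_gt0//; lra.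
have eB : 0 < e / 3 / (B + 1) by rewrite !divr_gt0//; lra.
have [d3 d30 L1] := H1 _ eA; have [d4 d40 L2] := H2 _ eB.
exists (Num.min (Num.min d1 d2) (Num.min (Num.min d3 d4) (e / 3 / (M1 * M2)))).
  by rewrite !lt_min d10 d20 d30 d40 !divr_gt0// mulr_gt0.
move=> z; rewrite !le_min => /andP[/andP[zd1 zd2] /andP[/andP[zd3 zd4] ze]].
set h := z - z0 in zd1 zd2 zd3 zd4 ze *.
have h0 : 0 <= modC h := modC_ge0 _.
have -> : phi z * psi z - phi z0 * psi z0 - (c1 * psi z0 + phi z0 * c2) * h =
  (phi z - phi z0 - c1 * h) * psi z0 + phi z0 * (psi z - psi z0 - c2 * h) +
  (phi z - phi z0) * (psi z - psi z0) by ring.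
have T1 : modC ((phi z - phi z0 - c1 * h) * psi z0) <= e / 3 * modC h.
  rewrite modCM -/A; apply: (le_trans (ler_wpM2r A0 (L1 _ zd3))).
  have -> : e / 3 / (A + 1) * modC h * A = e / 3 * modC h * (A / (A + 1)) by ring.
  rewrite ler_piMr ?mulr_ge0 ?divr_ge0 ?(ltW e0)//.
  by rewrite ler_pdivrMr; lra.
have T2 : modC (phi z0 * (psi z - psi z0 - c2 * h)) <= e / 3 * modC h.
  rewrite modCM -/B; apply: (le_trans (ler_wpM2l B0 (L2 _ zd4))).
  have -> : B * (e / 3 / (B + 1) * modC h) = e / 3 * modC h * (B / (B + 1)) by ring.
  rewrite ler_piMr ?mulr_ge0 ?divr_ge0 ?(ltW e0)//.
  by rewrite ler_pdivrMr; lra.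
have T3 : modC ((phi z - phi z0) * (psi z - psi z0)) <= e / 3 * modC h.
  rewrite modCM.
  apply: (le_trans (ler_pM (modC_ge0 _) (modC_ge0 _) (K1 _ zd1) (K2 _ zd2))).
  have -> : M1 * modC h * (M2 * modC h) = (modC h * (M1 * M2)) * modC h by ring.
  by rewrite ler_wpM2r// -ler_pdivlMr ?mulr_gt0.
apply: (le_trans (modCD _ _)); apply: (le_trans (lerD (modCD _ _) (lexx _))).
lra.
Qed.

End holo_mul.

(** * The reproducing kernel *)

Section kernel.
Context {R : realType} (n : nat).
Local Notation C := (cplx R).
Local Notation Re := (@complex.Re R).
Local Notation dv := (lebesgueC R n).
Implicit Types (t : R) (z w u : Cn R n).
Local Open Scope complex_scope.

Definition dotC z w : C := \sum_(i < n) z 0 i * (w 0 i)^*%C.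

Definition ker t z w : C := expC (rC (4 * t)^-1 * dotC z w).

(** It has the normalising constant of the Gaussian density but twice its exponent scale (8t, not
    4t), hence mass 2^n. *)
Definition gk t z : R := expR (- normsq z / (8 * t)) / (4 * pi * t) ^+ n.

(** The square root of the Gaussian density, see [sr_sqr]. *)
Definition sr t z : R := expR (- normsq z / (8 * t)) / Num.sqrt ((4 * pi * t) ^+ n).

(** Moves the weight into the function: norms for the Gaussian measure become Lebesgue L2 norms of
    [hw], on which convolution with [gk] acts. *)
Definition hw t (f : Cn R n -> C) z : R := modC (f z) * sr t z.

Lemma dotCJ z w : dotC w z = (dotC z w)^*%C.
Proof.
rewrite /dotC rmorph_sum; apply: eq_bigr => i _ /=.
by rewrite rmorphM/= conjcK mulrC.
Qed.

Lemma dotC_addl u z w : dotC (u + z) w = dotC u w + dotC z w.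
Proof. by rewrite -big_split; apply: eq_bigr => i _; rewrite mxE mulrDl. Qed.

Lemma dotC_scalel (c : C) z w : dotC (c *: z) w = c * dotC z w.
Proof. by rewrite /dotC mulr_sumr; apply: eq_bigr => i _; rewrite mxE mulrA. Qed.

Lemma dotC0l w : dotC 0 w = 0.
Proof. by rewrite /dotC big1// => i _; rewrite mxE mul0r. Qed.

Lemma dotC_addr u z w : dotC w (u + z) = dotC w u + dotC w z.
Proof.
by rewrite -big_split; apply: eq_bigr => i _; rewrite mxE rmorphD mulrDr.
Qed.

Lemma dotCzz z : dotC z z = rC (normsq z).
Proof.
rewrite normsq_modC /dotC /rC rmorph_sum; apply: eq_bigr => i _ /=.
by rewrite modC_sqr; case: (z 0 i) => a b; apply: cplx_eq => /=; ring.
Qed.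

Lemma normsqD z w : normsq (z + w) = normsq z + normsq w + 2 * Re (dotC z w).
Proof.
have /(congr1 Re) := dotCzz (z + w).
rewrite dotC_addl !dotC_addr !dotCzz !cReD !cRe_rC (dotCJ z w) cReJ => <-.
by ring.
Qed.

Lemma normsqB z w : normsq (z - w) = normsq z + normsq w - 2 * Re (dotC z w).
Proof.
rewrite normsqD normsqN -scaleN1r (dotCJ _ z) dotC_scalel cReJ cReM /=.
by rewrite (dotCJ z w) cReJ; ring.
Qed.

Lemma kerJ t z w : ker t w z = (ker t z w)^*%C.
Proof.
by rewrite /ker (dotCJ z w) -expCJ; congr expC; apply: cplx_eq;
  rewrite ?cReM ?cImM ?cReJ ?cImJ ?cReM ?cImM cRe_rC cIm_rC; ring.
Qed.

Lemma modC_ker t z w : modC (ker t z w) = expR (Re (dotC z w) / (4 * t)).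
Proof. by rewrite modC_expC cReM cRe_rC cIm_rC mul0r subr0 mulrC. Qed.

Section positive_time.
Variable t : R.
Hypothesis t0 : 0 < t.

Let c0 : 0 < (4 * pi * t) ^+ n.
Proof. by rewrite exprn_gt0// !mulr_gt0// pi_gt0. Qed.

Lemma sr_gt0 z : 0 < sr t z.
Proof. by rewrite divr_gt0 ?expR_gt0// sqrtr_gt0. Qed.

Lemma gk_ge0 z : 0 <= gk t z.
Proof. by rewrite divr_ge0 ?expR_ge0 ?ltW. Qed.

Lemma hw_ge0 f z : 0 <= hw t f z.
Proof. by rewrite mulr_ge0 ?modC_ge0 ?ltW ?sr_gt0. Qed.

Lemma sr_sqr z : sr t z ^+ 2 = gaussian_density t z.
Proof.
rewrite gaussian_densityE// expr_div_n sqr_sqrtr ?ltW// expr2 -expRD.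
by congr (expR _ / _); field; rewrite gt_eqF.
Qed.

(** Polarisation: 2 Re(z . conj w) = |z|^2 + |w|^2 - |z - w|^2, and the two square roots of the
    density cancel the first two terms. *)
Lemma ker_gk z w : modC (ker t z w) * sr t z * sr t w = gk t (z - w).
Proof.
rewrite modC_ker /sr /gk normsqB.
set s := Num.sqrt _.
have s2 : s * s = (4 * pi * t) ^+ n by rewrite -expr2 sqr_sqrtr// ltW.
have s0 : s != 0 by rewrite gt_eqF// sqrtr_gt0.
have -> : - (normsq z + normsq w - 2 * Re (dotC z w)) / (8 * t) =
  Re (dotC z w) / (4 * t) - normsq z / (8 * t) - normsq w / (8 * t).
  by field; rewrite gt_eqF.
rewrite -s2 !expRD !mulNr; field.
exact: s0.
Qed.

Lemma gkN z : gk t (- z) = gk t z.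
Proof. by rewrite /gk normsqN. Qed.

Lemma measurable_gk : measurable_fun setT (gk t).
Proof. by apply: measurable_funM => //; exact: measurable_gauss. Qed.

Lemma measurable_sr : measurable_fun setT (sr t).
Proof. by apply: measurable_funM => //; exact: measurable_gauss. Qed.

Lemma measurable_hw f : mesC f -> measurable_fun setT (hw t f).
Proof.
by move=> mf; apply: measurable_funM; [exact: measurable_modC|exact: measurable_sr].
Qed.

Lemma measurable_gk_sub :
  measurable_fun setT (fun p : Cn R n * Cn R n => gk t (p.1 - p.2)).
Proof. exact: (measurableT_comp measurable_gk (@measurable_subC R n)). Qed.

Lemma integral_gk : (\int[dv]_z (gk t z)%:E = (2 ^+ n)%:E)%E.
Proof.
under eq_integral do rewrite /gk mulrC EFinM.
rewrite ge0_integralZl//; last 2 first.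
- by apply/measurable_EFinP; exact: measurable_gauss.
- by rewrite lee_fin invr_ge0 ltW.
rewrite integral_gauss ?mulr_gt0// -EFinM (_ : pi * (8 * t) = 2 * (4 * pi * t)); last by ring.
by rewrite (exprMn _ 2) mulrCA mulVf ?mulr1// gt_eqF.
Qed.

Lemma integral_gk_shift a : (\int[dv]_z (gk t (z - a))%:E = (2 ^+ n)%:E)%E.
Proof.
rewrite -integral_gk.
apply: (proj2 (lebesgueC_shift (- a)) (fun z => (gk t z)%:E)).
  by apply/measurable_EFinP; exact: measurable_gk.
by move=> z; rewrite lee_fin gk_ge0.
Qed.

Lemma mesC_coord i : mesC (fun z : Cn R n => z 0 i).
Proof. by split; [exact: measurable_coordC1|exact: measurable_coordC2]. Qed.

Lemma mesC_dotC2 : mesC (fun p : Cn R n * Cn R n => dotC p.1 p.2).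
Proof.
apply: mesC_sum => i; apply: mesCM.
  exact: (mesC_comp measurable_fst (mesC_coord i)).
by apply: mesCJ; exact: (mesC_comp measurable_snd (mesC_coord i)).
Qed.

Lemma mesC_ker2 : mesC (fun p : Cn R n * Cn R n => ker t p.1 p.2).
Proof. by apply/mesC_expC/mesCM; [exact: mesC_cst|exact: mesC_dotC2]. Qed.

Lemma mesC_ker z : mesC (ker t z).
Proof. exact: (mesC_comp (pair1_measurable z) mesC_ker2). Qed.

Lemma mesC_rho : mesC (fun z => rC (@gaussian_density R n t z)).
Proof. by apply: mesC_rC; exact: measurable_gaussian_density. Qed.

Lemma reproducing (h : Cn R n -> C) z : entire h -> mesC h ->
  (\int[dv]_w (modC (ker t z w) * modC (h w) * gaussian_density t w)%:E < +oo)%E ->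
  intC dv (fun w => ker t z w * h w * rC (gaussian_density t w)) = h z.
Proof.
move=> eh mh Hoo.
pose f w := ker t z w * h w * rC (gaussian_density t w).
have mf : mesC f by apply/mesCM/mesC_rho; apply: mesCM => //; exact: mesC_ker.
have shz := lebesgueC_shift z.
rewrite -[LHS](preserves_intC shz mf).
pose g u := h (u + z) * expC (- (rC (4 * t)^-1 * dotC u z)).
(* The kernel contributes z . conj u, the shifted density -2 Re(u . conj z); their sum is -(u . conj
   z), so the conjugate-linear dependence on u becomes linear and [g] is holomorphic along lines. *)
have kE u : ker t z (u + z) * rC (gaussian_density t (u + z)) =
    expC (- (rC (4 * t)^-1 * dotC u z)) * rC (gaussian_density t u).
  rewrite /ker !gaussian_densityE// !rCM !mulrA -!expC_rC -!expCD.
  congr (expC _ * _); rewrite normsqD dotC_addr dotCzz (dotCJ u z).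
  apply: cplx_eq; rewrite ?(cReD, cImD, cReM, cImM, cReN, cImN, cReJ, cImJ) !cRe_rC !cIm_rC.
    by field; rewrite gt_eqF.
  by ring.
have fE u : f (u + z) = g u * rC (gaussian_density t u).
  by rewrite /f /g mulrAC kE; ring.
have g0 : g 0 = h z by rewrite /g add0r dotC0l mulr0 oppr0 expC0 mulr1.
have madd : measurable_fun setT (fun u => u + z) := proj1 shz.
rewrite -g0 -(@gauss_mean R n t g t0).
- by apply: eq_intC => u; rewrite fE.
- apply: mesCM; first exact: (mesC_comp madd mh).
  apply/mesC_expC/mesCN/mesCM; first exact: mesC_cst.
  have := mesC_comp (pair2_measurable z) mesC_dotC2; exact.
- have E u : modC (g u) * gaussian_density t u = modC (f (u + z)).
    by rewrite fE modCM modC_real ger0_norm// gaussian_density_ge0.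
  under eq_integral do rewrite E.
  rewrite (proj2 shz (fun w => (modC (f w))%:E)); last 2 first.
  + by apply/measurable_EFinP; exact: measurable_modC.
  + by move=> w; rewrite lee_fin modC_ge0.
  apply: le_lt_trans Hoo; rewrite le_eqVlt; apply/orP; left; apply/eqP.
  apply: eq_integral => w _; rewrite /f !modCM modC_real ger0_norm//.
  exact: gaussian_density_ge0.
- move=> u; apply: holo_mul; first exact: entire_line_holo.
  have := holo_comp (@holo_expC R) (holo_scale (- (rC (4 * t)^-1 * dotC u z))).
  congr holo; apply/funext => la /=; congr expC.
  by rewrite dotC_scalel; ring.
Qed.

End positive_time.
End kernel.

(** * Weighted L2 norms and the Schur test *)

Section L2_norm.
Context {R : realType} (n : nat).
Local Notation C := (cplx R).
Local Notation Cn := (Cn R n).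
Local Notation dv := (lebesgueC R n).
Implicit Types (z w : Cn) (u v f g h : Cn -> C).
Variable t : R.
Hypothesis t0 : 0 < t.

(** The square of the L2 norm as an extended real. Estimates are made for squares; roots are taken
    only in [normL2E] and when passing to operator norms. *)
Definition nsq u : \bar R := (\int[dv]_z (hw t u z ^+ 2)%:E)%E.

Lemma measurable_hw_sqr u : mesC u -> measurable_fun setT (fun z => (hw t u z ^+ 2)%:E).
Proof.
by move=> mu; apply/measurable_EFinP; apply: measurable_funX; exact: measurable_hw.
Qed.

Lemma nsq_ge0 u : (0 <= nsq u)%E.
Proof. by apply: integral_ge0 => z _; rewrite lee_fin sqr_ge0. Qed.

Let rho_ge0 z : 0 <= gaussian_density t z := gaussian_density_ge0 t z.
Let mrho : measurable_fun setT (@gaussian_density R n t) :=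
  @measurable_gaussian_density R n t.

Let gaussC_E (A : set Cn) : measurable A ->
  gaussC t A = (\int[dv]_(z in A) (gaussian_density t z)%:E)%E.
Proof. by []. Qed.

Lemma normL2E u : mesC u -> normL2 t u = sqrte (nsq u).
Proof.
move=> mu; have mm := measurable_modC mu.
rewrite /normL2 unlock /= poweR12_sqrt; last first.
  by apply: integral_ge0 => z _; rewrite lee_fin powR_ge0.
congr sqrte; under eq_integral do rewrite (ger0_norm (modC_ge0 _)) powR_mulrn ?modC_ge0//.
rewrite (ge0_integral_density mrho rho_ge0 gaussC_E)//.
- apply: eq_integral => z _; rewrite -EFinM; congr EFin.
  by rewrite /hw exprMn sr_sqr.
- by apply/measurable_EFinP; exact: measurable_funX.
- by move=> z; rewrite lee_fin sqr_ge0.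
Qed.

Lemma L2P u : L2 t u <-> mesC u /\ (nsq u < +oo)%E.
Proof.
have E : mesC u -> (normL2 t u < +oo)%E = (nsq u < +oo)%E.
  move=> mu; rewrite normL2E//; have := nsq_ge0 u.
  by case: (nsq u) => [r|//|//] _ /=; rewrite !ltry.
by split => -[mu H]; split=> //; move: H; rewrite E.
Qed.

Lemma dotL2E u v : mesC u -> mesC v ->
  dotL2 t u v = intC dv (fun z => u z * (v z)^*%C * rC (gaussian_density t z)).
Proof.
move=> mu mv; rewrite -(intC_density mrho rho_ge0 gaussC_E)//.
by apply: mesCM => //; exact: mesCJ.
Qed.

Lemma hwM u v z : hw t u z * hw t v z = modC (u z) * modC (v z) * gaussian_density t z.
Proof. by rewrite /hw mulrACA -expr2 sr_sqr. Qed.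

Lemma integral_hw_sqrZ u (c : R) : 0 <= c -> mesC u ->
  (\int[dv]_z (c%:E * (hw t u z ^+ 2)%:E) = c%:E * nsq u)%E.
Proof.
move=> c0 mu; apply: ge0_integralZl; [exact: measurableT|exact: measurable_hw_sqr| |].
  by move=> z _; rewrite lee_fin sqr_ge0.
by rewrite lee_fin.
Qed.

Lemma nsq_le (u v : Cn -> C) (c : R) : mesC u -> mesC v -> 0 <= c ->
  (forall z, hw t u z ^+ 2 <= c * hw t v z ^+ 2) -> (nsq u <= c%:E * nsq v)%E.
Proof.
move=> mu mv c0 H.
rewrite -(integral_hw_sqrZ c0 mv); apply: ge0_le_integral => //.
- by move=> z _; rewrite lee_fin sqr_ge0.
- exact: measurable_hw_sqr.
- apply: emeasurable_funM => //.
  exact: measurable_hw_sqr.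
- by move=> z _; rewrite -EFinM lee_fin.
Qed.

Lemma hwB u v z : hw t (fun z => u z - v z) z <= hw t u z + hw t v z.
Proof. by rewrite -mulrDl ler_wpM2r ?modCB// ltW// sr_gt0. Qed.

Lemma nsqB_le u v : mesC u -> mesC v ->
  (nsq (fun z => (u z - v z)%R) <= 2%:E * nsq u + 2%:E * nsq v)%E.
Proof.
move=> mu mv.
have mh2 f : mesC f -> measurable_fun setT (fun z => 2%:E * (hw t f z ^+ 2)%:E)%E.
  by move=> mf; apply: emeasurable_funM => //; exact: measurable_hw_sqr.
have p1 f z : [set: Cn] z -> (0 <= (hw t f z ^+ 2)%:E)%E by rewrite lee_fin sqr_ge0.
have p2 f z : [set: Cn] z -> (0 <= 2%:E * (hw t f z ^+ 2)%:E)%E.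
  by move=> _; rewrite mule_ge0 ?lee_fin ?sqr_ge0.
rewrite /nsq -!ge0_integralZl//; try exact: measurable_hw_sqr; try exact: p1.
rewrite -ge0_integralD//; try exact: mh2; try exact: p2.
apply: ge0_le_integral => //.
- by move=> z _; rewrite lee_fin sqr_ge0.
- by apply: measurable_hw_sqr; exact: mesCB.
- by apply: emeasurable_funD; exact: mh2.
- move=> z _; rewrite -!EFinM -EFinD lee_fin.
  have h1 := hw_ge0 t0 u z; have h2 := hw_ge0 t0 v z.
  apply: (@le_trans _ _ ((hw t u z + hw t v z) ^+ 2)).
    by rewrite ler_pXn2r ?nnegrE ?addr_ge0 ?hw_ge0// hwB.
  have := sqr_ge0 (hw t u z - hw t v z); rewrite sqrrB sqrrD; lra.
Qed.

Lemma L2B u v : L2 t u -> L2 t v -> L2 t (fun z => u z - v z).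
Proof.
move=> /L2P[mu uoo] /L2P[mv voo]; apply/L2P; split; first exact: mesCB.
by apply: (le_lt_trans (nsqB_le mu mv)); rewrite lte_add_pinfty// lte_mul_pinfty.
Qed.

Lemma hw_prod_lty u v : L2 t u -> L2 t v ->
  (\int[dv]_z (hw t u z * hw t v z)%:E < +oo)%E.
Proof.
move=> /L2P[mu uoo] /L2P[mv voo].
apply: (@le_lt_trans _ _ (nsq u + nsq v)%E); last by rewrite lte_add_pinfty.
have p1 f z : [set: Cn] z -> (0 <= (hw t f z ^+ 2)%:E)%E by rewrite lee_fin sqr_ge0.
rewrite /nsq -ge0_integralD//; try exact: measurable_hw_sqr; try exact: p1.
apply: ge0_le_integral => //.
- by move=> z _; rewrite lee_fin mulr_ge0 ?hw_ge0.
- by apply/measurable_EFinP; apply: measurable_funM; exact: measurable_hw.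
- by apply: emeasurable_funD; exact: measurable_hw_sqr.
- move=> z _; rewrite -EFinD lee_fin.
  have := sqr_ge0 (hw t u z - hw t v z); rewrite sqrrB.
  have := sqr_ge0 (hw t u z); have := sqr_ge0 (hw t v z); lra.
Qed.

Lemma L2_prod_integrable u v : L2 t u -> L2 t v ->
  integrableC dv (fun z => u z * v z * rC (gaussian_density t z)).
Proof.
move=> Lu Lv; have [/L2P[mu _] /L2P[mv _]] := (Lu, Lv).
apply: integrableCP; first by apply: mesCM; [exact: mesCM|exact: mesC_rho].
apply: le_lt_trans (hw_prod_lty Lu Lv).
rewrite le_eqVlt; apply/orP; left; apply/eqP; apply: eq_integral => z _.
by rewrite hwM !modCM modC_real ger0_norm.
Qed.

Lemma hwJ u z : hw t (fun z => (u z)^*%C) z = hw t u z.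
Proof. by rewrite /hw modC_conj. Qed.

Lemma L2J u : L2 t u -> L2 t (fun z => (u z)^*%C).
Proof.
move=> /L2P[mu uoo]; apply/L2P; split; first exact: mesCJ.
by rewrite /nsq; under eq_integral do rewrite hwJ.
Qed.

(* The factor 2 ^ n is the total mass of gk. *)
Lemma schur (Phi : Cn * Cn -> R) (H : Cn -> R) :
  measurable_fun setT Phi -> (forall p, 0 <= Phi p) ->
  measurable_fun setT H -> (forall w, 0 <= H w) ->
  (\int[dv]_z ((\int[dv]_w (Phi (z, w) * H w * gk t (z - w))%:E) ^+ 2) <=
   (2 ^+ n)%:E * \int[dv]_w ((H w ^+ 2)%:E *
     \int[dv]_z (Phi (z, w) ^+ 2 * gk t (z - w))%:E))%E.
Proof.
move=> mPhi Phi0 mH H0.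
have mg : measurable_fun setT (fun p : Cn * Cn => gk t (p.1 - p.2)).
  exact: measurable_gk_sub.
have mH2 : measurable_fun setT (fun p : Cn * Cn => H p.2).
  exact: (measurableT_comp mH measurable_snd).
have gs z : (\int[dv]_w (gk t (z - w))%:E = (2 ^+ n)%:E)%E.
  rewrite -(integral_gk_shift t0 z); apply: eq_integral => w _.
  by rewrite -gkN opprB.
pose F (p : Cn * Cn) := ((Phi p * H p.2) ^+ 2 * gk t (p.1 - p.2))%:E.
have mF : measurable_fun setT F.
  apply/measurable_EFinP; apply: measurable_funM => //.
  by apply: measurable_funX; exact: measurable_funM.
have F0 p : (0 <= F p)%E by rewrite lee_fin mulr_ge0 ?sqr_ge0 ?gk_ge0.
have m1F := measurable_fun_fubini_tonelli_F (m2 := dv) F mF F0.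
have mA : measurable_fun setT (fun z => \int[dv]_w (Phi (z, w) * H w * gk t (z - w))%:E)%E.
  apply: (measurable_fun_fubini_tonelli_F (m2 := dv)
    (fun p => (Phi p * H p.2 * gk t (p.1 - p.2))%:E)).
    by apply/measurable_EFinP; apply: measurable_funM => //; exact: measurable_funM.
  move=> p; rewrite lee_fin mulr_ge0 ?gk_ge0 // mulr_ge0 //.
pose G z := (\int[dv]_w F (z, w))%E.
have G0 z : [set: Cn] z -> (0 <= G z)%E by move=> _; exact: integral_ge0.
have p2 : (0 <= (2 ^+ n)%:E :> \bar R)%E by rewrite lee_fin exprn_ge0.
have GE : (\int[dv]_z ((2 ^+ n)%:E * G z) = (2 ^+ n)%:E * \int[dv]_z G z)%E.
  by apply: ge0_integralZl.
have H1 : (\int[dv]_z ((\int[dv]_w (Phi (z, w) * H w * gk t (z - w))%:E) ^+ 2) <=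
    \int[dv]_z ((2 ^+ n)%:E * G z))%E.
  apply: ge0_le_integral => //.
  - by move=> z _; exact: sqre_ge0.
  - by under eq_fun do rewrite expe2; exact: emeasurable_funM.
  - by apply: emeasurable_funM.
  (* Cauchy-Schwarz in w for the measure [gk t (z - w) dw]; Tonelli then exchanges z and w. *)
  - move=> z _; rewrite -(gs z).
    apply: (@cauchy_schwarz_weight _ _ _ dv (fun w => Phi (z, w) * H w)
      (fun w => gk t (z - w))).
    + apply: measurable_funM => //.
      exact: (measurableT_comp mPhi (pair1_measurable z)).
    + exact: (measurableT_comp mg (pair1_measurable z)).
    + by move=> w; rewrite mulr_ge0.
    + by move=> w; rewrite gk_ge0.
have H2 : (\int[dv]_z G z = \int[dv]_w \int[dv]_z F (z, w))%E.
  exact: (fubini_tonelli (m1 := dv) (m2 := dv) F mF F0).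
have chain (a b c x y z : \bar R) :
    (a <= b -> b = c * x -> x = y -> y = z -> a <= c * z)%E.
  by move=> ab bE xy yz; rewrite -yz -xy -bE.
apply: (chain _ _ _ _ _ _ H1 GE H2); apply: eq_integral => w _.
pose K z := (Phi (z, w) ^+ 2 * gk t (z - w))%:E.
have mK : measurable_fun setT K.
  apply/measurable_EFinP; apply: measurable_funM.
    by apply: measurable_funX; exact: (measurableT_comp mPhi (pair2_measurable w)).
  exact: (measurableT_comp mg (pair2_measurable w)).
have K0 z : [set: Cn] z -> (0 <= K z)%E.
  by move=> _; rewrite lee_fin mulr_ge0 ?sqr_ge0 ?gk_ge0.
have H20 : (0 <= (H w ^+ 2)%:E)%E by rewrite lee_fin sqr_ge0.
transitivity (\int[dv]_z ((H w ^+ 2)%:E * K z))%E.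
  by apply: eq_integral => z _; rewrite /F/K/= -EFinM exprMn; congr EFin; ring.
by apply: ge0_integralZl.
Qed.

(** Convolution with [gk] is bounded on L2 by its mass 2^n. One factor 2^n comes from [schur], the
    other from integrating [gk] over z. *)
Lemma schur1 (H : Cn -> R) : measurable_fun setT H -> (forall w, 0 <= H w) ->
  (\int[dv]_z ((\int[dv]_w (H w * gk t (z - w))%:E) ^+ 2) <=
   (4 ^+ n)%:E * \int[dv]_w (H w ^+ 2)%:E)%E.
Proof.
move=> mH H0; have := @schur (cst 1) H (measurable_cst _) (fun=> ler01) mH H0.
under eq_integral do under eq_integral do rewrite mul1r.
move=> /le_trans; apply.
rewrite (_ : 4 ^+ n = 2 ^+ n * 2 ^+ n); last by rewrite -exprMn -natrM.
rewrite EFinM -muleA; apply: lee_wpmul2l; first by rewrite lee_fin exprn_ge0.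
have mH2 : measurable_fun setT (fun w => (H w ^+ 2)%:E).
  by apply/measurable_EFinP; exact: measurable_funX.
have E : (\int[dv]_w ((2 ^+ n)%:E * (H w ^+ 2)%:E) =
    (2 ^+ n)%:E * \int[dv]_w (H w ^+ 2)%:E)%E.
  have p0 w : [set: Cn] w -> (0 <= (H w ^+ 2)%:E)%E by rewrite lee_fin sqr_ge0.
  by apply: ge0_integralZl => //; rewrite lee_fin exprn_ge0.
rewrite -E le_eqVlt; apply/orP; left; apply/eqP; apply: eq_integral => w _.
rewrite muleC -(integral_gk_shift t0 w); congr (_ * _)%E.
by apply: eq_integral => z _; rewrite expr1n mul1r.
Qed.

End L2_norm.

(** * The projection as an integral operator *)

Section norms.
Context {R : realType} (n : nat).
Local Notation C := (cplx R).
Local Notation Re := (@complex.Re R).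
Local Notation Im := (@complex.Im R).
Local Notation Cn := (Cn R n).
Implicit Types (z w : Cn).

(** A real-valued norm adapted to sums over coordinates, such as [dotC]; the norm of the matrix type
    is a maximum with values in [cplx R]. *)
Definition l1 z : R := \sum_(i < n) modC (z 0 i).

Lemma l1_ge0 z : 0 <= l1 z.
Proof. by apply: sumr_ge0 => i _; exact: modC_ge0. Qed.

Lemma modC_coord_le_l1 z i : modC (z 0 i) <= l1 z.
Proof. by rewrite /l1 (bigD1 i)//= lerDl sumr_ge0// => j _; exact: modC_ge0. Qed.

Lemma normCn_le_l1 z : `|z| <= rC (l1 z).
Proof.
have [->|z0] := eqVneq `|z| 0; first by rewrite le0CR l1_ge0.
have [[i j] zE] : exists i, `|z| = `|z i.1 i.2| by exact: mx_norm_neq0.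
rewrite zE /= (ord1 i) normC_modC leCR; exact: modC_coord_le_l1.
Qed.

Lemma coord_le_normCn z i : rC (modC (z 0 i)) <= `|z|.
Proof.
rewrite -normC_modC [leRHS]mx_normE -[leLHS]nngE num_le.
exact: (@le_bigmax _ _ _ _ (fun i : 'I_1 * 'I_n => `|z i.1 i.2|%:nng) (0, i)).
Qed.

Lemma normCn_rC z : exists2 r : R, 0 <= r & `|z| = rC r.
Proof.
have [->|z0] := eqVneq `|z| 0; first by exists 0.
have [r r0 E] : exists2 r : R, 0 < r & `|z| = rC r.
  by apply: pos_cplx; rewrite lt_def z0 normr_ge0.
by exists r => //; exact: ltW.
Qed.

Lemma l1_le z (r : R) : `|z| <= rC r -> l1 z <= n%:R * r.
Proof.
move=> zr; rewrite mulr_natl -[n in leRHS]card_ord -sumr_const.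
apply: ler_sum => i _; rewrite -leCR; exact: le_trans (coord_le_normCn z i) zr.
Qed.

Lemma continuous_epsdelta (f : Cn -> C) z (e : R) : {for z, continuous f} -> 0 < e ->
  exists2 dl : R, 0 < dl & forall w, `|z - w| < rC dl -> modC (f z - f w) < e.
Proof.
move=> /cvgrPdist_lt cf e0.
have /cf : 0 < rC e by rewrite ltCR.
move=> /nbhs_normP[d /= d0 H].
have [dl dl0 dE] := pos_cplx d0; exists dl => // w zw.
by rewrite -ltCR -normC_modC; apply: H; rewrite /ball_ /= dE.
Qed.

Let grid1 (k : nat) (x : R) : int := Num.floor (k.+1%:R * x).

Let grid (k : nat) z : 'rV[int * int]_n :=
  \row_i (grid1 k (coordC i z).1, grid1 k (coordC i z).2).

Let ungrid (k : nat) (q : 'rV[int * int]_n) : Cn :=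
  \row_i (((q 0 i).1%:~R / k.+1%:R) +i* ((q 0 i).2%:~R / k.+1%:R))%C.

Let grid1_dist k x : `|x - (grid1 k x)%:~R / k.+1%:R| <= k.+1%:R^-1.
Proof.
have := floor_itv (k.+1%:R * x); rewrite -/(grid1 k x) intrD => /andP[h1 h2].
have k0 : 0 < k.+1%:R :> R by rewrite ltr0n.
rewrite -(ler_pM2l k0) divff ?gt_eqF// -{1}(ger0_norm (ltW k0)) -normrM mulrBr.
rewrite mulrCA divff ?gt_eqF// mulr1 ger0_norm ?subr_ge0//; lra.
Qed.

Let grid_dist k z : `|z - ungrid k (grid k z)| <= rC (n%:R * (2 * k.+1%:R^-1)).
Proof.
apply: (le_trans (normCn_le_l1 _)); rewrite leCR.
rewrite mulr_natl -[n in leRHS]card_ord -sumr_const; apply: ler_sum => i _.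
apply: (le_trans (modC_le_ReIm _)); rewrite !mxE cReB cImB /= mulr_natl mulr2n.
by apply: lerD; exact: grid1_dist.
Qed.

Let measurable_grid_fiber k q : measurable [set z | grid k z = q].
Proof.
have m1 (i : 'I_n) (g : Cn -> R) (m : int) : measurable_fun setT g ->
    measurable [set z | grid1 k (g z) = m].
  move=> mg; rewrite (_ : [set _ | _] =
      setT `&` (fun z => k.+1%:R * g z) @^-1` `[m%:~R, (m + 1)%:~R[%classic).
    have mkg : measurable_fun setT (fun z => k.+1%:R * g z) by exact: measurable_funM.
    exact: mkg.
  apply/seteqP; split=> z /=; rewrite in_itv/= /grid1 -real_floor_eq ?num_real//.
    by move=> ->; rewrite eqxx.
  by move=> [_ /eqP].
rewrite (_ : [set _ | _] = \bigcap_(i in [set: 'I_n])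
    ([set z | grid1 k (coordC i z).1 = (q 0 i).1] `&`
     [set z | grid1 k (coordC i z).2 = (q 0 i).2])).
  apply: fin_bigcap_measurable => // i _; apply: measurableI; apply: (m1 i).
    exact: measurable_coordC1.
  exact: measurable_coordC2.
apply/seteqP; split=> z /=.
  by move=> <- i _; rewrite /grid mxE.
move=> H; apply/rowP => i; have [/= h1 h2] := H i I.
by rewrite /grid mxE h1 h2 -surjective_pairing.
Qed.

Let measurable_grid_fun k (g : 'rV[int * int]_n -> R) :
  measurable_fun setT (fun z => g (grid k z)).
Proof.
move=> _ B mB; rewrite setTI.
rewrite (_ : _ @^-1` _ = \bigcup_(q : 'rV[int * int]_n)
    ([set z | grid k z = q] `&` [set _ | B (g q)])).
  apply: countable_bigcupT_measurable; first exact: countableP.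
  move=> q; have [Bq|Bq] := pselect (B (g q)).
    rewrite (_ : _ `&` _ = [set z | grid k z = q]); first exact: measurable_grid_fiber.
    by apply/seteqP; split=> z /= => [[]|].
  rewrite (_ : _ `&` _ = set0); first exact: measurable0.
  by apply/seteqP; split=> z // -[].
apply/seteqP; split=> z /=; first by move=> Bz; exists (grid k z).
by move=> [q _ [<-]].
Qed.

(** The sigma-algebra is generated by coordinates, so openness does not give measurability at once.
    The function is the pointwise limit of its values at grid points of mesh 1/(k + 1): each
    approximation is constant on countably many cells, which are measurable. *)
Lemma continuous_mesC (f : Cn -> C) : continuous f -> mesC f.
Proof.
move=> cf.
have cvgf z (e : R) : 0 < e ->
    \forall k \near \oo, modC (f z - f (ungrid k (grid k z))) < e.
  move=> e0; have [dl dl0 H] := continuous_epsdelta (cf z) e0.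
  near=> k; apply: H; apply: (le_lt_trans (grid_dist k z)); rewrite ltCR.
  have kb : (2 * n%:R) / dl < k.+1%:R.
    apply: (lt_trans (archi_boundP _)); first by rewrite divr_ge0 ?mulr_ge0 ?(ltW dl0).
    rewrite ltr_nat ltnS; near: k; exact: nbhs_infty_ge.
  have k0 : 0 < k.+1%:R :> R by rewrite ltr0n.
  rewrite mulrA -ltr_pdivlMr ?invr_gt0// invrK.
  by move: kb; rewrite ltr_pdivrMr//; lra.
split.
  apply: (@measurable_fun_cvg _ _ _ _ (fun k z => Re (f (ungrid k (grid k z))))).
    by move=> k; exact: (measurable_grid_fun k (fun q => Re (f (ungrid k q)))).
  move=> z _; apply/cvgrPdist_lt => e e0; apply: filterS (cvgf z e e0) => k.
  by apply: le_lt_trans; rewrite -cReB ler_Re_modC.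
apply: (@measurable_fun_cvg _ _ _ _ (fun k z => Im (f (ungrid k (grid k z))))).
  by move=> k; exact: (measurable_grid_fun k (fun q => Im (f (ungrid k q)))).
move=> z _; apply/cvgrPdist_lt => e e0; apply: filterS (cvgf z e e0) => k.
by apply: le_lt_trans; rewrite -cImB ler_Im_modC.
Unshelve. all: by end_near. Qed.

Lemma entire_mesC (f : Cn -> C) : entire f -> mesC f.
Proof.
move=> ef; apply: continuous_mesC => z; exact: differentiable_continuous.
Qed.

End norms.

(** * Differentiability from a linear combination of the coordinates *)

Section differentiable_lincomb.
Context {R : realType} (n : nat).
Local Notation C := (cplx R).
Local Notation Cn := (Cn R n).

Lemma modC_sum (I : Type) (s : seq I) (F : I -> C) :
  modC (\sum_(i <- s) F i) <= \sum_(i <- s) modC (F i).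
Proof.
elim: s => [|i s IH]; first by rewrite !big_nil modC0.
by rewrite !big_cons (le_trans (modCD _ _))// lerD2l.
Qed.

Definition lincomb (c : 'I_n -> C) (h : Cn) : C := \sum_(i < n) h 0 i * c i.

Lemma modC_lincomb_le c (h : Cn) :
  modC (lincomb c h) <= l1 h * \sum_(i < n) modC (c i).
Proof.
apply: (le_trans (modC_sum _ _)); rewrite mulr_sumr; apply: ler_sum => i _.
by rewrite modCM ler_wpM2r ?modC_ge0 ?modC_coord_le_l1.
Qed.

Lemma nbhs_rC_ballI (V : normedModType C) (x : V) (P : V -> Prop) (r : R) : 0 < r ->
  (forall y, `|x - y| < rC r -> P y) -> \forall y \near x, P y.
Proof. by move=> r0 H; apply/nbhs_normP; exists (rC r) => //=; rewrite ltCR. Qed.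

(** Here [c] lists the partial derivatives; the differential they define is continuous by the [l1]
    bound, so only the remainder is left to check. *)
Lemma differentiable_lincomb (f : Cn -> C) (z0 : Cn) (c : 'I_n -> C) :
  (forall e : R, 0 < e -> exists2 dl : R, 0 < dl & forall h (r : R),
    0 <= r -> `|h| = rC r -> r < dl ->
    modC (f (h + z0) - f z0 - lincomb c h) <= e * r) ->
  differentiable f z0.
Proof.
move=> H.
have lin : linear (lincomb c : Cn -> C).
  move=> a u v; rewrite /lincomb scaler_sumr -big_split; apply: eq_bigr => i _.
  by rewrite !mxE mulrDl -mulrA.
pose L : {linear Cn -> C} := HB.pack (lincomb c : Cn -> C)
  (GRing.isLinear.Build C Cn C *:%R (lincomb c) lin).
have cL (x : Cn) : {for x, continuous (lincomb c : Cn -> C)}.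
  apply: (cvgrPdist_lt (FF := nbhs_filter x) (lincomb c) (lincomb c x)).2 => e0 /pos_cplx[e ee ->].
  pose M := \sum_(i < n) modC (c i).
  have M0 : 0 <= M by apply: sumr_ge0 => i _; exact: modC_ge0.
  have nM : 0 < n%:R * M + 1 by rewrite ltr_wpDl// mulr_ge0.
  apply: (@nbhs_rC_ballI _ x (fun y => `|lincomb c x - lincomb c y| < rC e) _
    (divr_gt0 ee nM)) => y xy.
  have -> : lincomb c x - lincomb c y = L (x - y) by rewrite linearB.
  rewrite normC_modC ltCR /=; apply: (le_lt_trans (modC_lincomb_le _ _)).
  have [r r0 rE] := normCn_rC (x - y).
  rewrite rE ltCR in xy.
  have := @l1_le _ _ (x - y) r; rewrite rE lexx => /(_ isT) l1r.
  apply: (le_lt_trans (ler_wpM2r M0 l1r)).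
  by move: xy; rewrite ltr_pdivlMr//; lra.
apply: (@differentiable_epsI _ _ _ _ _ L) => [x|]; first exact: cL.
move=> e e0; have [dl dl0 Hd] := H e e0.
apply/nbhs_norm0P; exists (rC dl); first by rewrite /= ltCR.
move=> h /= hd; have [r r0 rE] := normCn_rC h.
rewrite rE ltCR in hd.
by rewrite rE normC_modC -rCM leCR Hd.
Qed.

End differentiable_lincomb.

(** * Integrability of the kernel against L2 functions *)

Section projection.
Context {R : realType} (n : nat).
Local Notation C := (cplx R).
Local Notation Cn := (Cn R n).
Local Notation dv := (lebesgueC R n).
Implicit Types (z w : Cn) (u v f g h : Cn -> C).
Variable t : R.
Hypothesis t0 : 0 < t.

Let rho := @gaussian_density R n t.
Let rho0 z : 0 <= rho z := gaussian_density_ge0 t z.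

Lemma intC_sum (I : eqType) (s : seq I) (F : I -> Cn -> C) :
  (forall i, integrableC dv (F i)) ->
  integrableC dv (fun w => \sum_(i <- s) F i w) /\
  intC dv (fun w => \sum_(i <- s) F i w) = \sum_(i <- s) intC dv (F i).
Proof.
move=> IF; elim: s => [|i s [I1 E1]].
  have -> : (fun w : Cn => \sum_(i <- [::]) F i w) = fun=> 0.
    by apply/funext => w; rewrite big_nil.
  rewrite big_nil; split.
    by split; rewrite (_ : _ \o _ = cst 0%E)//; exact: integrable0.
  by rewrite /intC /Rintegral /= integral0.
have -> : (fun w => \sum_(j <- i :: s) F j w) = fun w => F i w + \sum_(j <- s) F j w.
  by apply/funext => w; rewrite big_cons.
by rewrite big_cons intCD// E1; split=> //; exact: integrableCD.
Qed.

Lemma measurable_l1 : measurable_fun setT (@l1 R n).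
Proof. by apply: measurable_sum => i; apply: measurable_modC; exact: mesC_coord. Qed.

Lemma mesC_expl1 (c : R) : mesC (fun w : Cn => rC (expR (c * l1 w))).
Proof.
apply: mesC_rC; apply: (measurableT_comp (@measurable_expR R)).
by apply: measurable_funM => //; exact: measurable_l1.
Qed.

(** These exponentials dominate the kernel and its difference quotients. Completing the square in
    each coordinate, with m its modulus, 2cm <= 8tc^2 + m^2/(8t): half of the Gaussian absorbs the
    growth and the other half is [gk]. The constants add up to the exponent of [M]. *)
Lemma L2_expl1 (c : R) : L2 t (fun w : Cn => rC (expR (c * l1 w))).
Proof.
apply/(L2P t0); split; first exact: mesC_expl1.
pose M := expR (n%:R * (8 * t * c ^+ 2)).
have mgk : measurable_fun setT (fun z => (gk t (z : Cn))%:E).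
  by apply/measurable_EFinP; exact: measurable_gk.
have g0 z : [set: Cn] z -> (0 <= (gk t z)%:E)%E by rewrite lee_fin gk_ge0.
have E : (\int[dv]_z (M%:E * (gk t z)%:E) = M%:E * \int[dv]_z (gk t z)%:E)%E.
  by apply: ge0_integralZl => //; rewrite lee_fin expR_ge0.
apply: (@le_lt_trans _ _ (\int[dv]_z (M%:E * (gk t z)%:E))%E); last first.
  by rewrite E integral_gk// -EFinM ltry.
apply: ge0_le_integral => //.
- by move=> z _; rewrite lee_fin sqr_ge0.
- by apply/measurable_EFinP; apply: measurable_funX; apply: measurable_hw; exact: mesC_expl1.
- exact: emeasurable_funM.
- move=> z _; rewrite -EFinM lee_fin /hw modC_real ger0_norm ?expR_ge0//.
  rewrite exprMn sr_sqr// gaussian_densityE// /gk mulrA mulrA ler_wpM2r//.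
    by rewrite invr_ge0 exprn_ge0// !mulr_ge0 ?pi_ge0// ltW.
  rewrite /M expr2 -!expRD ler_expR.
  have : c * l1 z + c * l1 z <= n%:R * (8 * t * c ^+ 2) + normsq z / (8 * t).
    rewrite normsq_modC mulr_suml mulr_natl -[n in X in _ <= X + _]card_ord -sumr_const.
    rewrite -big_split /l1 -mulr2n -mulrnAl mulr_sumr; apply: ler_sum => i _.
    set m := modC _.
    have t8 : 0 < 8 * t by rewrite mulr_gt0.
    rewrite -subr_ge0.
    have -> : 8 * t * c ^+ 2 + m ^+ 2 / (8 * t) - c *+ 2 * m =
      (8 * t * c - m) ^+ 2 / (8 * t) by rewrite -mulr_natr; field; rewrite gt_eqF.
    by rewrite divr_ge0 ?sqr_ge0// ltW.
  have -> : - normsq z / (4 * t) = - (normsq z / (8 * t)) + - normsq z / (8 * t).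
    by field; rewrite gt_eqF.
  lra.
Qed.

Lemma L2_le u v (c : R) : 0 <= c -> mesC u -> (forall z, modC (u z) <= c * modC (v z)) ->
  L2 t v -> L2 t u.
Proof.
move=> c0 mu uv /(L2P t0)[mv voo]; apply/(L2P t0); split=> //.
have H : (nsq t u <= (c ^+ 2)%:E * nsq t v)%E.
  apply: nsq_le => //; first exact: sqr_ge0.
  move=> z; rewrite -exprMn.
  apply: lerXn2r; [by rewrite nnegrE hw_ge0|by rewrite nnegrE mulr_ge0 ?hw_ge0|].
  by rewrite /hw [leRHS]mulrA ler_wpM2r// ltW// sr_gt0.
by apply: (le_lt_trans H); rewrite lte_mul_pinfty// lee_fin sqr_ge0.
Qed.

Lemma modC_dotC_le z w : modC (dotC z w) <= l1 z * l1 w.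
Proof.
apply: (le_trans (modC_sum _ _)); rewrite mulr_suml; apply: ler_sum => i _.
by rewrite modCM modC_conj ler_wpM2l ?modC_ge0 ?modC_coord_le_l1.
Qed.

Lemma modC_ker_le z w : modC (ker t z w) <= expR (l1 z / (4 * t) * l1 w).
Proof.
rewrite modC_ker ler_expR mulrAC ler_wpM2r ?invr_ge0 ?mulr_ge0 ?(ltW t0)//.
apply: le_trans (modC_dotC_le z w); apply: le_trans (ler_Re_modC _).
exact: ler_norm.
Qed.

Lemma L2_ker z : L2 t (ker t z).
Proof.
apply: (L2_le ler01 _ _ (L2_expl1 (l1 z / (4 * t)))); first exact: mesC_ker.
move=> w; rewrite mul1r [leRHS]modC_real ger0_norm ?expR_ge0//; exact: modC_ker_le.
Qed.

Lemma ker_integrable u z : L2 t u ->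
  integrableC dv (fun w => ker t z w * u w * rC (rho w)).
Proof. by move=> Lu; apply: L2_prod_integrable => //; exact: L2_ker. Qed.

(** The candidate for the projection, shown to coincide with [projH2] on L2 in [projH2E]. *)
Definition kproj u z : C := intC dv (fun w => ker t z w * u w * rC (rho w)).

Lemma ker_sr u z w :
  modC (ker t z w * u w * rC (rho w)) * sr t z = hw t u w * gk t (z - w).
Proof.
rewrite !modCM modC_real ger0_norm// -ker_gk// /hw /rho -sr_sqr//.
by ring.
Qed.

(** Serves the projection with [Phi = 1] and the Hankel operator with [Phi] a bound for |f z - f
    w|. *)
Lemma hw_intC_le u (F : Cn -> C) z (Phi : Cn -> R) : mesC u -> integrableC dv F ->
  measurable_fun setT Phi -> (forall w, 0 <= Phi w) ->
  (forall w, modC (F w) <= Phi w * modC (ker t z w * u w * rC (rho w))) ->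
  ((modC (intC dv F) * sr t z)%:E <= \int[dv]_w (Phi w * hw t u w * gk t (z - w))%:E)%E.
Proof.
move=> mu IF mPhi Phi0 FP.
have mF := measurable_modC (integrableC_mesC IF).
have s0 : (0 <= (sr t z)%:E)%E by rewrite lee_fin ltW// sr_gt0.
have mFE : measurable_fun setT (fun w => (modC (F w))%:E) by exact/measurable_EFinP.
have F0 w : [set: Cn] w -> (0 <= (modC (F w))%:E)%E by rewrite lee_fin modC_ge0.
have E : (\int[dv]_w ((sr t z)%:E * (modC (F w))%:E) =
    (sr t z)%:E * \int[dv]_w (modC (F w))%:E)%E by apply: ge0_integralZl.
apply: (@le_trans _ _ ((sr t z)%:E * \int[dv]_w (modC (F w))%:E)%E).
  by rewrite mulrC EFinM; apply: lee_wpmul2l => //; exact: modC_intC.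
move: E => <-; apply: ge0_le_integral => //.
- by move=> w _; rewrite lee_fin mulr_ge0 ?modC_ge0// ltW// sr_gt0.
- by apply/measurable_EFinP; exact: measurable_funM.
- apply/measurable_EFinP; apply: measurable_funM.
    by apply: measurable_funM => //; exact: measurable_hw.
  exact: (measurableT_comp (@measurable_gk_sub R n t) (pair1_measurable z)).
- move=> w _; rewrite lee_fin mulrC.
  apply: (le_trans (ler_wpM2r (ltW (sr_gt0 t0 z)) (FP w))).
  by rewrite -[leLHS]mulrA ker_sr mulrA.
Qed.

Lemma hw_proj_le u z : L2 t u ->
  ((hw t (kproj u) z)%:E <= \int[dv]_w (hw t u w * gk t (z - w))%:E)%E.
Proof.
move=> Lu; have [mu _] := (L2P t0 u).1 Lu.
have := @hw_intC_le u _ z (cst 1) mu (ker_integrable z Lu) (measurable_cst _) (fun=> ler01).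
move=> /(_ _)/le_trans; apply; first by move=> w; rewrite mul1r.
rewrite le_eqVlt; apply/orP; left; apply/eqP; apply: eq_integral => w _.
by rewrite mul1r.
Qed.

End projection.

(** * The integral operator maps L2 boundedly into H2 *)

Section projection.
Context {R : realType} (n : nat).
Local Notation C := (cplx R).
Local Notation Cn := (Cn R n).
Local Notation dv := (lebesgueC R n).
Implicit Types (z w : Cn) (u v f g h : Cn -> C).
Variable t : R.
Hypothesis t0 : 0 < t.

Let rho := @gaussian_density R n t.
Let rho0 z : 0 <= rho z := gaussian_density_ge0 t z.
Let ct : 0 < (4 * t)^-1. Proof. by rewrite invr_gt0 mulr_gt0. Qed.

Let alpha (h w : Cn) : C := rC (4 * t)^-1 * dotC h w.

Lemma ker_addl (h z w : Cn) : ker t (h + z) w = expC (alpha h w) * ker t z w.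
Proof. by rewrite /ker dotC_addl mulrDr expCD. Qed.

(** Lipschitz constant of [alpha] in its first argument; the factor n is the price of comparing [l1]
    with the maximum norm. *)
Let b w : R := n%:R * (4 * t)^-1 * l1 w.

Let b_ge0 w : 0 <= b w.
Proof. by rewrite !mulr_ge0 ?(ltW ct) ?l1_ge0. Qed.

Let alpha_le (h w : Cn) (r : R) : 0 <= r -> `|h| = rC r -> modC (alpha h w) <= r * b w.
Proof.
move=> r0 hr; have hl : l1 h <= n%:R * r by apply: l1_le; rewrite hr.
rewrite modCM modC_real (ger0_norm (ltW ct)).
have H : l1 h * l1 w <= n%:R * r * l1 w by rewrite ler_wpM2r ?l1_ge0.
apply: (le_trans (ler_wpM2l (ltW ct) (le_trans (modC_dotC_le h w) H))).
by rewrite /b le_eqVlt; apply/orP; left; apply/eqP; ring.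
Qed.

(** The polynomial factor b^2 is absorbed by b <= exp b, leaving exp(3b), which is an exponential of
    [l1] and so covered by [L2_expl1]. *)
Let exp_remainder (h w : Cn) (r : R) : 0 <= r -> r <= 1 -> `|h| = rC r ->
  modC (expC (alpha h w) - 1 - alpha h w) <= r ^+ 2 * (4 * expR (3 * b w)).
Proof.
move=> r0 r1 hr; have a0 := modC_ge0 (alpha h w).
have al := alpha_le w r0 hr; have b0 := b_ge0 w.
have ab : modC (alpha h w) <= b w by apply: (le_trans al); rewrite ler_piMl.
apply: (le_trans (modC_expC_sub _)).
have be : b w <= expR (b w) by have := expR_ge1Dx (b w); lra.
have e3 : expR (3 * b w) = expR (b w) * expR (b w) * expR (b w).
  by rewrite -!expRD; congr expR; ring.
have -> : r ^+ 2 * (4 * expR (3 * b w)) =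
    4 * ((r * expR (b w)) ^+ 2) * expR (b w) by rewrite e3; ring.
have eb : 0 <= expR (b w) := expR_ge0 _.
apply: ler_pM; [by rewrite mulr_ge0 ?sqr_ge0|exact: expR_ge0| |by rewrite ler_expR].
rewrite ler_pM2l// ler_pXn2r ?nnegrE ?mulr_ge0//.
by apply: (le_trans al); rewrite ler_wpM2l.
Qed.

Lemma ker_entire w : entire (fun z => ker t z w).
Proof.
move=> z0.
pose c (i : 'I_n) : C := rC (4 * t)^-1 * (w 0 i)^*%C * ker t z0 w.
refine (@differentiable_lincomb _ _ (fun z => ker t z w) z0 c _) => e e0.
pose M := 4 * expR (3 * b w) * modC (ker t z0 w).
have M0 : 0 <= M by rewrite !mulr_ge0 ?expR_ge0 ?modC_ge0.
have M1 : 0 < M + 1 by lra.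
exists (Num.min 1 (e / (M + 1))); first by rewrite lt_min ltr01 divr_gt0.
move=> h r r0 hr; rewrite lt_min ltr_pdivlMr// => /andP[r1 re].
have lc : lincomb c h = alpha h w * ker t z0 w.
  rewrite /lincomb /alpha /dotC mulr_sumr mulr_suml; apply: eq_bigr => i _.
  by rewrite /c; ring.
have -> : ker t (h + z0) w - ker t z0 w - lincomb c h =
    (expC (alpha h w) - 1 - alpha h w) * ker t z0 w by rewrite ker_addl lc; ring.
rewrite modCM.
apply: (le_trans (ler_wpM2r (modC_ge0 _) (exp_remainder w r0 (ltW r1) hr))).
have -> : r ^+ 2 * (4 * expR (3 * b w)) * modC (ker t z0 w) = r * M * r by rewrite /M; ring.
rewrite ler_wpM2r//; lra.
Qed.

Lemma H2_ker w : H2 t (fun z => ker t z w).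
Proof.
split; first exact: ker_entire.
have := L2J t0 (L2_ker t0 w); congr L2.
by apply/funext => z; rewrite -kerJ.
Qed.

(** Differentiation under the integral sign: the second-order remainder of the kernel is at most r^2
    times an integrable function, with r the norm of the increment. *)
Lemma proj_entire u : L2 t u -> entire (kproj t u).
Proof.
move=> Lu z0; have [mu _] := (L2P t0 u).1 Lu.
pose k w := ker t z0 w * u w * rC (rho w).
have Ik : integrableC dv k := ker_integrable t0 z0 Lu.
(* The exponent adds that of exp(3b) and that of the bound [modC_ker_le] for the kernel at [z0]. *)
have LM := L2_prod_integrable t0
  (L2_expl1 n t0 (3 * (n%:R * (4 * t)^-1) + l1 z0 / (4 * t))) Lu.
have mk := integrableC_mesC Ik.
have exp3k w : expR (3 * b w) * modC (k w) <=
    modC (rC (expR ((3 * (n%:R * (4 * t)^-1) + l1 z0 / (4 * t)) * l1 w)) * u w * rC (rho w)).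
  have -> : expR ((3 * (n%:R * (4 * t)^-1) + l1 z0 / (4 * t)) * l1 w) =
      expR (3 * b w) * expR (l1 z0 / (4 * t) * l1 w).
    by rewrite -expRD; congr expR; rewrite /b; ring.
  rewrite !modCM !modC_real (ger0_norm (rho0 w)) ger0_norm ?mulr_ge0 ?expR_ge0//.
  have H := ler_wpM2l (expR_ge0 (3 * b w)) (ler_wpM2r (rho0 w)
    (ler_wpM2r (modC_ge0 (u w)) (modC_ker_le t0 z0 w))).
  apply: (le_trans H); rewrite le_eqVlt; apply/orP; left; apply/eqP.
  by move: (rho w) => r; ring.
have mb : measurable_fun setT b by apply: measurable_funM => //; exact: measurable_l1.
have me3 : measurable_fun setT (fun w => expR (3 * b w)).
  by apply: (measurableT_comp (@measurable_expR R)); exact: measurable_funM.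
have E3oo : (\int[dv]_w (expR (3 * b w) * modC (k w))%:E < +oo)%E.
  apply: le_lt_trans (integrableC_lty LM); apply: ge0_le_integral => //.
  - by move=> w _; rewrite lee_fin mulr_ge0 ?expR_ge0 ?modC_ge0.
  - by apply/measurable_EFinP; apply: measurable_funM => //; exact: measurable_modC.
  - by apply/measurable_EFinP; apply: measurable_modC; exact: integrableC_mesC LM.
  - by move=> w _; rewrite lee_fin.
have Ibound (q : Cn -> C) : mesC q -> (exists2 c : R, 0 <= c & forall w,
    modC (q w) <= c * expR (3 * b w)) -> integrableC dv (fun w => q w * k w).
  move=> mq [c c0 qc]; apply: integrableCP; first exact: mesCM.
  pose E w := (expR (3 * b w) * modC (k w))%:E.
  have mE : measurable_fun setT E.
    by apply/measurable_EFinP; apply: measurable_funM => //; exact: measurable_modC.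
  have E0 w : [set: Cn] w -> (0 <= E w)%E.
    by rewrite lee_fin mulr_ge0 ?expR_ge0 ?modC_ge0.
  have cE : (\int[dv]_w (c%:E * E w) = c%:E * \int[dv]_w E w)%E.
    by apply: ge0_integralZl.
  apply: (@le_lt_trans _ _ (\int[dv]_w (c%:E * E w))%E); last first.
    by move: cE => ->; rewrite lte_mul_pinfty.
  apply: ge0_le_integral => //.
  - by move=> w _; rewrite lee_fin modC_ge0.
  - by apply/measurable_EFinP; apply: measurable_modC; exact: mesCM.
  - exact: emeasurable_funM.
  - move=> w _; rewrite -EFinM lee_fin modCM mulrA.
    by rewrite ler_wpM2r ?modC_ge0.
pose q i w : C := rC (4 * t)^-1 * ((w : Cn) 0 i)^*%C.
have mq i : mesC (q i) by apply: mesCM; [exact: mesC_cst|apply: mesCJ; exact: mesC_coord].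
(* In dimension 0 the space is a point. Otherwise 1 <= n, and [b] dominates each single
   coordinate. *)
have [n0|n0] := posnP n.
  have triv (z : Cn) : z = z0 by apply/rowP => i; have := ltn_ord i; rewrite {2}n0.
  apply: (@differentiable_lincomb _ _ _ _ (fun=> 0)) => e e0; exists 1 => // h r r0 _ _.
  rewrite (triv (h + z0)) subrr /lincomb big1 ?subrr ?modC0; last first.
    by move=> i _; rewrite mulr0.
  by rewrite mulr_ge0// ltW.
have nR : 1 <= n%:R :> R by rewrite ler1n.
have q_le i w : modC (q i w) <= 1 * expR (3 * b w).
  rewrite mul1r modCM modC_real modC_conj (ger0_norm (ltW ct)).
  have h1 : (4 * t)^-1 * modC (w 0 i) <= b w.
    rewrite /b -mulrA; apply: (@le_trans _ _ ((4 * t)^-1 * l1 w)).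
      by rewrite ler_wpM2l ?(ltW ct) ?modC_coord_le_l1.
    by rewrite ler_peMl// mulr_ge0 ?(ltW ct) ?l1_ge0.
  apply: (le_trans h1); have := expR_ge1Dx (3 * b w); have := b_ge0 w; lra.
have Iq i : integrableC dv (fun w => q i w * k w).
  by apply: Ibound => //; exists 1.
(* The i-th partial derivative at [z0], the integral of the differentiated kernel. *)
pose c i : C := intC dv (fun w => q i w * k w).
apply: (@differentiable_lincomb _ _ _ _ (c)) => e e0.
pose M := 4 * fine (\int[dv]_w (expR (3 * b w) * modC (k w))%:E)%E.
have M0 : 0 <= M.
  rewrite mulr_ge0// fine_ge0//; apply: integral_ge0 => w _.
  by rewrite lee_fin mulr_ge0 ?expR_ge0 ?modC_ge0.
have M1 : 0 < M + 1 by lra.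
exists (Num.min 1 (e / (M + 1))); first by rewrite lt_min ltr01 divr_gt0.
move=> h r r0 hr; rewrite lt_min ltr_pdivlMr// => /andP[r1 re].
have alE w : alpha h w * k w = \sum_(i < n) h 0 i * (q i w * k w).
  rewrite /alpha /dotC mulr_sumr mulr_suml; apply: eq_bigr => i _.
  by rewrite /q; ring.
have [Ial lc] := intC_sum (index_enum 'I_n) (fun i => integrableCZ (h 0 i) (Iq i)).
have {}lc : lincomb c h = intC dv (fun w => alpha h w * k w).
  rewrite (eq_intC dv alE) lc; apply: eq_bigr => i _.
  by rewrite intCZ.
have {}Ial : integrableC dv (fun w => alpha h w * k w).
  by rewrite (_ : (fun w => _) = (fun w => \sum_(i < n) h 0 i * (q i w * k w)))//;
     apply/funext.
have -> : kproj t u (h + z0) - kproj t u z0 - lincomb c h =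
    intC dv (fun w => (expC (alpha h w) - 1 - alpha h w) * k w).
  rewrite lc -intCB//; last exact: (ker_integrable t0 (h + z0) Lu).
  rewrite -intCB//; last first.
    by apply: integrableCB => //; exact: (ker_integrable t0 (h + z0) Lu).
  by apply: eq_intC => w; rewrite ker_addl /k; ring.
have malpha : mesC (alpha h).
  apply: mesCM; first exact: mesC_cst.
  by have := mesC_comp (pair1_measurable h) (@mesC_dotC2 R n).
have mrem : mesC (fun w => expC (alpha h w) - 1 - alpha h w).
  by apply: mesCB => //; apply: mesCB; [exact: mesC_expC|exact: mesC_cst].
have Irem : integrableC dv (fun w => (expC (alpha h w) - 1 - alpha h w) * k w).
  apply: Ibound => //; exists (r ^+ 2 * 4); first by rewrite mulr_ge0 ?sqr_ge0.
  by move=> w; rewrite -mulrA; exact: exp_remainder (ltW r1) hr.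
rewrite -lee_fin; apply: (le_trans (modC_intC Irem)).
pose E w := (expR (3 * b w) * modC (k w))%:E.
have mE : measurable_fun setT E.
  by apply/measurable_EFinP; apply: measurable_funM => //; exact: measurable_modC.
have E0 w : [set: Cn] w -> (0 <= E w)%E.
  by rewrite lee_fin mulr_ge0 ?expR_ge0 ?modC_ge0.
have r20 : (0 <= (r ^+ 2 * 4)%:E)%E by rewrite lee_fin mulr_ge0 ?sqr_ge0.
have cE : (\int[dv]_w ((r ^+ 2 * 4)%:E * E w) = (r ^+ 2 * 4)%:E * \int[dv]_w E w)%E.
  by apply: ge0_integralZl.
have IE : (\int[dv]_w E w = (fine (\int[dv]_w E w))%:E)%E.
  by rewrite fineK// ge0_fin_numE//; exact: integral_ge0.
apply: (@le_trans _ _ (\int[dv]_w ((r ^+ 2 * 4)%:E * E w))%E).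
  apply: ge0_le_integral => //.
  - by move=> w _; rewrite lee_fin modC_ge0.
  - by apply/measurable_EFinP; apply: measurable_modC; exact: mesCM.
  - exact: emeasurable_funM.
  - move=> w _; rewrite -EFinM lee_fin modCM mulrA ler_wpM2r ?modC_ge0//.
    by rewrite -mulrA; exact: exp_remainder (ltW r1) hr.
move: cE => ->; move: IE => ->; rewrite -EFinM lee_fin.
have -> : r ^+ 2 * 4 * fine (\int[dv]_w E w)%E = r * M * r by rewrite /M; ring.
rewrite ler_wpM2r//; lra.
Qed.

(** A pointwise bound by a convolution followed by [schur1]. The constant 4^n is crude but uniform
    in t, and it is available before orthogonality is. *)
Lemma nsq_proj_le u : L2 t u -> (nsq t (kproj t u) <= (4 ^+ n)%:E * nsq t u)%E.
Proof.
move=> Lu; have [mu _] := (L2P t0 u).1 Lu.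
have mp := entire_mesC (proj_entire Lu).
apply: le_trans (schur1 t0 (measurable_hw t mu) (hw_ge0 t0 u)).
have mker : measurable_fun setT
   (fun p : Cn * Cn => (hw t u p.2 * gk t (p.1 - p.2))%:E).
  apply/measurable_EFinP; apply: measurable_funM; last exact: measurable_gk_sub.
  exact: (measurableT_comp (measurable_hw t mu) measurable_snd).
have ker0 (p : Cn * Cn) : (0 <= (hw t u p.2 * gk t (p.1 - p.2))%:E)%E.
  by rewrite lee_fin mulr_ge0 ?hw_ge0 ?gk_ge0.
have mI := measurable_fun_fubini_tonelli_F (m2 := dv) _ mker ker0.
apply: ge0_le_integral => //.
- by move=> z _; rewrite lee_fin sqr_ge0.
- exact: measurable_hw_sqr.
- by under eq_fun do rewrite expe2; exact: emeasurable_funM.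
- move=> z _; rewrite EFin_expe lee_sqr; first exact: hw_proj_le.
    by rewrite lee_fin hw_ge0.
  by apply: integral_ge0 => w _; exact: (ker0 (z, w)).
Qed.

Lemma L2_proj u : L2 t u -> L2 t (kproj t u).
Proof.
move=> Lu; apply/(L2P t0); split; first exact: entire_mesC (proj_entire Lu).
apply: (le_lt_trans (nsq_proj_le Lu)).
have [_ uoo] := (L2P t0 u).1 Lu.
by rewrite lte_mul_pinfty// ?lee_fin// exprn_ge0.
Qed.

Lemma H2_proj u : L2 t u -> H2 t (kproj t u).
Proof. by move=> Lu; split; [exact: proj_entire|exact: L2_proj]. Qed.

Lemma H2_reproducing h z : H2 t h -> kproj t h z = h z.
Proof.
move=> [eh Lh]; apply: reproducing => //; first by have [] := (L2P t0 h).1 Lh.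
have := integrableC_lty (ker_integrable t0 z Lh); apply: le_lt_trans.
rewrite le_eqVlt; apply/orP; left; apply/eqP; apply: eq_integral => w _.
by rewrite !modCM modC_real ger0_norm.
Qed.

End projection.

(** * Hankel operators *)

(* Stated for abstract extended reals: with integrals in place of the variables, the same
   steps make unification unfold the integrals. *)
Lemma le_mul_chain (R : realType) (a b c d e1 e2 e3 e4 q k : \bar R) :
  (0 <= k -> a <= b -> b <= k * c -> c <= d -> d = k * e1 -> e1 = e2 -> e2 = e3 ->
   e3 <= e4 -> e4 = q -> a <= k * (k * q))%E.
Proof.
move=> k0 ab bc cd de e12 e23 e34 e4q; apply: (le_trans ab); apply: (le_trans bc).
apply: lee_wpmul2l => //; apply: (le_trans cd); rewrite de; apply: lee_wpmul2l => //.
by rewrite e12 e23 -e4q.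
Qed.

Section hankel_bound.
Context {R : realType} (n : nat).
Local Notation C := (cplx R).
Local Notation Cn := (Cn R n).
Local Notation dv := (lebesgueC R n).
Implicit Types (z w : Cn) (u v f g h : Cn -> C).
Variable t : R.
Hypothesis t0 : 0 < t.

Let rho := @gaussian_density R n t.
Let rho0 z : 0 <= rho z := gaussian_density_ge0 t z.

Let L2_mesC u : L2 t u -> mesC u. Proof. by move=> /(L2P t0)[]. Qed.

Lemma mule_le_sqrD (x : R) (y : \bar R) : 0 <= x -> (0 <= y)%E ->
  (x%:E * y <= (x ^+ 2)%:E + y ^+ 2)%E.
Proof.
move=> x0; case: y => [y|_|//]; last by rewrite expe2 mulyy addey// leey.
rewrite lee_fin => y0; rewrite -EFin_expe -EFinM -EFinD lee_fin.
by have := sqr_ge0 (x - y); have := sqr_ge0 x; have := sqr_ge0 y; rewrite sqrrB; lra.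
Qed.

(** Fubini moves the kernel to h; by conjugate symmetry it acts there as the conjugate of the
    reproducing integral, which returns h. *)
Lemma kproj_dot u h : L2 t u -> H2 t h ->
  intC dv (fun z => kproj t u z * (h z)^*%C * rC (rho z)) =
  intC dv (fun w => u w * (h w)^*%C * rC (rho w)).
Proof.
move=> Lu Hh; have [eh Lh] := Hh.
have mu := L2_mesC Lu; have mh := L2_mesC Lh.
pose a z := (h z)^*%C * rC (rho z).
pose f (p : Cn * Cn) := a p.1 * (ker t p.1 p.2 * u p.2 * rC (rho p.2)).
have ma : mesC a by apply: mesCM; [exact: mesCJ|exact: mesC_rho].
have mf : mesC f.
  apply: mesCM; first exact: (mesC_comp measurable_fst ma).
  apply: mesCM; last exact: (mesC_comp measurable_snd (@mesC_rho R n t)).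
  by apply: mesCM; [exact: mesC_ker2|exact: (mesC_comp measurable_snd mu)].
have fE z w : modC (f (z, w)) = hw t h z * (hw t u w * gk t (z - w)).
  rewrite -(ker_sr t0 u z w) /f /a /hw !modCM !modC_real modC_conj !(ger0_norm (rho0 _)).
  have -> : rho z = sr t z ^+ 2 by rewrite sr_sqr.
  by move: (rho w) => r; ring.
have mker : measurable_fun setT
   (fun p : Cn * Cn => (hw t u p.2 * gk t (p.1 - p.2))%:E).
  apply/measurable_EFinP; apply: measurable_funM; last exact: measurable_gk_sub.
  exact: (measurableT_comp (measurable_hw t mu) measurable_snd).
have ker0 (p : Cn * Cn) : (0 <= (hw t u p.2 * gk t (p.1 - p.2))%:E)%E.
  by rewrite lee_fin mulr_ge0 ?hw_ge0 ?gk_ge0.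
have mA := measurable_fun_fubini_tonelli_F (m2 := dv) _ mker ker0.
set A := fubini_F _ _ in mA.
have A0 z : (0 <= A z)%E by apply: integral_ge0 => w _; exact: (ker0 (z, w)).
have mh2 : measurable_fun setT (fun z => (hw t h z ^+ 2)%:E).
  exact: measurable_hw_sqr.
have mA2 : measurable_fun setT (fun z => A z ^+ 2)%E.
  by under eq_fun do rewrite expe2; exact: emeasurable_funM.
(* Absolute integrability: the inner integral is [hw t h z * A z], at most the sum of the squares,
   and [schur1] bounds the integral of [A ^ 2]. *)
have foo : (\int[dv]_z \int[dv]_w (modC (f (z, w)))%:E < +oo)%E.
  have D : (\int[dv]_z ((hw t h z ^+ 2)%:E + A z ^+ 2) =
      nsq t h + \int[dv]_z (A z ^+ 2))%E.
    apply: ge0_integralD => //; first by move=> z _; rewrite lee_fin sqr_ge0.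
    by move=> z _; exact: sqre_ge0.
  have A2 : (\int[dv]_z (A z ^+ 2) <= (4 ^+ n)%:E * nsq t u)%E.
    exact: (schur1 t0 (measurable_hw t mu) (hw_ge0 t0 u)).
  apply: (@le_lt_trans _ _ (\int[dv]_z ((hw t h z ^+ 2)%:E + A z ^+ 2))%E); last first.
    move: D => ->; rewrite lte_add_pinfty//; first by have [] := (L2P t0 h).1 Lh.
    apply: (le_lt_trans A2); rewrite lte_mul_pinfty// ?lee_fin ?exprn_ge0//.
    by have [] := (L2P t0 u).1 Lu.
  apply: ge0_le_integral => //.
  - by move=> z _; apply: integral_ge0 => w _; rewrite lee_fin modC_ge0.
  - apply: (measurable_fun_fubini_tonelli_F (m2 := dv) (fun p => (modC (f p))%:E)).
      by apply/measurable_EFinP; exact: measurable_modC.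
    by move=> p; rewrite lee_fin modC_ge0.
  - exact: emeasurable_funD.
  - move=> z _; apply: le_trans (mule_le_sqrD (hw_ge0 t0 h z) (A0 z)).
    have E : (\int[dv]_w ((hw t h z)%:E * (hw t u w * gk t (z - w))%:E) =
       (hw t h z)%:E * A z)%E.
      apply: ge0_integralZl => //; last by rewrite lee_fin hw_ge0.
        exact: (measurableT_comp mker (pair1_measurable z)).
      by move=> w _; exact: (ker0 (z, w)).
    rewrite -E le_eqVlt; apply/orP; left; apply/eqP; apply: eq_integral => w _.
    by rewrite fE EFinM.
have I1 z : integrableC dv (fun w => f (z, w)).
  exact: (integrableCZ (a z) (ker_integrable t0 z Lu)).
pose b w := u w * rC (rho w).
have fE2 z w : f (z, w) = b w * (ker t w z * h z * rC (rho z))^*%C.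
  have JM (x y : C) : (x * y)^*%C = x^*%C * y^*%C.
    by apply: cplx_eq; rewrite ?(cReJ, cImJ, cReM, cImM); ring.
  rewrite /f /a /b [_.1]/= [_.2]/= !JM -kerJ.
  have -> : ((rC (rho z))^*)%C = rC (rho z) by apply: cplx_eq => //=; rewrite oppr0.
  by ring.
have I2 w : integrableC dv (fun z => f (z, w)).
  have := integrableCZ (b w) (integrableCJ (ker_integrable t0 w Lh)).
  by congr integrableC; apply/funext => z; rewrite fE2.
transitivity (intC dv (fun z => intC dv (fun w => f (z, w)))).
  apply: eq_intC => z; rewrite /f /= intCZ; last exact: (ker_integrable t0 z Lu).
  by rewrite -/(kproj t u z) /a; ring.
rewrite (intC_fubini mf foo I1 I2); apply: eq_intC => w.
transitivity (b w * (intC dv (fun z => ker t w z * h z * rC (rho z)))^*%C).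
  rewrite -intCJ; last exact: (ker_integrable t0 w Lh).
  rewrite -intCZ; last by apply: integrableCJ; exact: (ker_integrable t0 w Lh).
  by apply: eq_intC => z; rewrite fE2.
by rewrite -/(kproj t h w) (H2_reproducing t0 w Hh) /b; ring.
Qed.

Lemma kproj_orthogonal u h : L2 t u -> H2 t h -> dotL2 t (u \- kproj t u) h = 0.
Proof.
move=> Lu Hh; have [eh Lh] := Hh; have LP := L2_proj t0 Lu.
rewrite dotL2E//; [|exact: mesCB (L2_mesC Lu) (L2_mesC LP)|exact: L2_mesC].
have Lhc := L2J t0 Lh.
have := intCB (L2_prod_integrable t0 Lu Lhc) (L2_prod_integrable t0 LP Lhc).
rewrite (kproj_dot Lu Hh) subrr => <-; apply: eq_intC => z /=.
by rewrite !mulrBl.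
Qed.

(** Existence makes [xget] return some p with the defining property. Since u - p is orthogonal to
    the kernel functions, which lie in H2, p and u have the same integral against the kernel; for p
    it is p itself. *)
Lemma projH2E u : L2 t u -> projH2 t u = kproj t u.
Proof.
move=> Lu; rewrite /projH2.
set S := [set p | _].
have Sk : S (kproj t u).
  split; [exact: H2_proj|move=> h Hh; exact: kproj_orthogonal].
have [Hp Op] := xgetPex (cst 0) (ex_intro S _ Sk).
set p := xget _ _ in Hp Op *; have [ep Lp] := Hp.
apply/funext => z; rewrite -(H2_reproducing t0 z Hp).
apply/esym/subr0_eq; rewrite -(Op _ (H2_ker t0 z)).
rewrite dotL2E//; [|exact: mesCB (L2_mesC Lu) (L2_mesC Lp)|]; last first.
  by have [_ /L2_mesC] := H2_ker t0 z.
rewrite -intCB; [|exact: ker_integrable|exact: ker_integrable].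
apply: eq_intC => w; cbv beta; rewrite -kerJ.
have -> : (u \- p) w = u w - p w by [].
by rewrite /rho; ring.
Qed.

(* With phi z = int Phi(z, w)^2 gk (z - w) dz, Schur's test bounds the square of the norm
   of the Hankel operator by phi integrated against |h|^2; the reproducing formula bounds
   |h|^2 by its own average against gk, so that only an average of phi is needed. *)
Lemma hankel_bound f h (Phi : Cn * Cn -> R) (S : R) :
  measurable_fun setT Phi -> (forall p, 0 <= Phi p) ->
  (forall z w, modC (f z - f w) <= Phi (z, w)) ->
  (forall x, (\int[dv]_w ((\int[dv]_z (Phi (z, w) ^+ 2 * gk t (z - w))%:E) *
     (gk t (w - x))%:E) <= S%:E)%E) ->
  dom_mul t f h -> (nsq t (hankel t f h) <= (4 ^+ n * S)%:E * nsq t h)%E.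
Proof.
move=> mPhi Phi0 fPhi HS [Hh Lfh]; have [eh Lh] := Hh; have mh := L2_mesC Lh.
have mhw := measurable_hw t mh.
have mg : measurable_fun setT (fun p : Cn * Cn => gk t (p.1 - p.2)).
  exact: measurable_gk_sub.
(* Writing [h z] by its reproducing formula puts [f z] under the integral, next to the [f w] of the
   projection. *)
have hankelE z : hankel t f h z =
    intC dv (fun w => (f z - f w) * (ker t z w * h w * rC (rho w))).
  rewrite /hankel projH2E//= -(H2_reproducing t0 z Hh) -intCZ; last exact: ker_integrable.
  rewrite -intCB; [|exact: integrableCZ (ker_integrable t0 z Lh)|exact: ker_integrable].
  by apply: eq_intC => w; rewrite /rho/=; ring.
have hIF z : integrableC dv (fun w => (f z - f w) * (ker t z w * h w * rC (rho w))).
  have := integrableCB (integrableCZ (f z) (ker_integrable t0 z Lh)) (ker_integrable t0 z Lfh).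
  by congr integrableC; apply/funext => w /=; rewrite /rho; ring.
have mHf : mesC (hankel t f h).
  rewrite /hankel projH2E//; apply: mesCB; first exact: L2_mesC Lfh.
  exact: L2_mesC (L2_proj t0 Lfh).
pose A z := (\int[dv]_w (Phi (z, w) * hw t h w * gk t (z - w))%:E)%E.
have HA z : ((hw t (hankel t f h) z)%:E <= A z)%E.
  rewrite /hw hankelE; apply: hw_intC_le => //.
  - exact: (measurableT_comp mPhi (pair1_measurable z)).
  - by move=> w; rewrite modCM ler_wpM2r ?modC_ge0.
have mker : measurable_fun setT (fun p : Cn * Cn =>
    (Phi p * hw t h p.2 * gk t (p.1 - p.2))%:E).
  apply/measurable_EFinP; apply: measurable_funM => //; apply: measurable_funM => //.
  exact: (measurableT_comp mhw measurable_snd).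
have ker0 (p : Cn * Cn) : (0 <= (Phi p * hw t h p.2 * gk t (p.1 - p.2))%:E)%E.
  rewrite lee_fin; apply: mulr_ge0; last exact: gk_ge0.
  by apply: mulr_ge0; [exact: Phi0|exact: hw_ge0].
have mA : measurable_fun setT A.
  exact: (measurable_fun_fubini_tonelli_F (m2 := dv) _ mker ker0).
have A0 z : (0 <= A z)%E by apply: integral_ge0 => w _; exact: (ker0 (z, w)).
have S1 : (nsq t (hankel t f h) <= \int[dv]_z (A z ^+ 2))%E.
  apply: ge0_le_integral => //.
  - by move=> z _; rewrite lee_fin sqr_ge0.
  - exact: measurable_hw_sqr.
  - by under eq_fun do rewrite expe2; exact: emeasurable_funM.
  - by move=> z _; rewrite EFin_expe lee_sqr// lee_fin hw_ge0.
have S2 := schur t0 mPhi Phi0 mhw (hw_ge0 t0 h).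
pose psi w := (\int[dv]_z (Phi (z, w) ^+ 2 * gk t (z - w))%:E)%E.
have mk2 : measurable_fun setT (fun p : Cn * Cn => (Phi p ^+ 2 * gk t (p.1 - p.2))%:E).
  by apply/measurable_EFinP; apply: measurable_funM => //; exact: measurable_funX.
have k20 (p : Cn * Cn) : (0 <= (Phi p ^+ 2 * gk t (p.1 - p.2))%:E)%E.
  by rewrite lee_fin mulr_ge0 ?sqr_ge0 ?gk_ge0.
have mpsi : measurable_fun setT psi.
  exact: (measurable_fun_fubini_tonelli_G (m1 := dv) _ mk2 k20).
have psi0 w : (0 <= psi w)%E by apply: integral_ge0 => z _; exact: (k20 (z, w)).
pose B (w x : Cn) := (hw t h x ^+ 2 * gk t (w - x))%:E.
have mB2 : measurable_fun setT (fun p : Cn * Cn => B p.1 p.2).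
  apply/measurable_EFinP; apply: measurable_funM => //; apply: measurable_funX.
  exact: (measurableT_comp mhw measurable_snd).
have B0 w x : (0 <= B w x)%E by rewrite lee_fin mulr_ge0 ?sqr_ge0 ?gk_ge0.
pose IB w := (\int[dv]_x B w x)%E.
have mIB : measurable_fun setT IB.
  exact: (measurable_fun_fubini_tonelli_F (m2 := dv) _ mB2 (fun p => B0 p.1 p.2)).
have IB0 w : (0 <= IB w)%E by apply: integral_ge0 => x _; exact: B0.
have p2 : (0 <= (2 ^+ n)%:E :> \bar R)%E by rewrite lee_fin exprn_ge0.
(* Since [h = kproj t h], [hw t h w] is at most its own average against [gk]; Cauchy-Schwarz with
   mass 2^n squares this. *)
have hB w : ((hw t h w ^+ 2)%:E <= (2 ^+ n)%:E * IB w)%E.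
  have h1 := hw_proj_le t0 w Lh.
  have -> : hw t h w = hw t (kproj t h) w by rewrite /hw (H2_reproducing t0 w Hh).
  rewrite [X in (X <= _)%E]EFin_expe.
  have I0 : (0 <= \int[dv]_x (hw t h x * gk t (w - x))%:E)%E.
    by apply: integral_ge0 => x _; rewrite lee_fin mulr_ge0 ?hw_ge0 ?gk_ge0.
  have h2 : ((hw t (kproj t h) w)%:E ^+ 2 <=
      (\int[dv]_x (hw t h x * gk t (w - x))%:E) ^+ 2)%E.
    by rewrite lee_sqr// lee_fin hw_ge0.
  apply: (le_trans h2).
  have gs : (\int[dv]_x (gk t (w - x))%:E = (2 ^+ n)%:E)%E.
    rewrite -(integral_gk_shift t0 w); apply: eq_integral => x _.
    by rewrite -gkN opprB.
  have mgw := measurableT_comp mg (pair1_measurable w).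
  have := cauchy_schwarz_weight dv mhw mgw (hw_ge0 t0 h) (fun x => gk_ge0 t0 (w - x)).
  by rewrite gs.
have hh0 w : (0 <= (hw t h w ^+ 2)%:E)%E by rewrite lee_fin sqr_ge0.
have mhE : measurable_fun setT (fun x => (hw t h x ^+ 2)%:E).
  by apply/measurable_EFinP; exact: measurable_funX.
have mIBpsi : measurable_fun setT (fun w => IB w * psi w)%E.
  exact: emeasurable_funM mIB mpsi.
have IBpsi0 w : (0 <= IB w * psi w)%E := mule_ge0 (IB0 w) (psi0 w).
have S3 : (\int[dv]_w ((hw t h w ^+ 2)%:E * psi w) <=
    \int[dv]_w ((2 ^+ n)%:E * (IB w * psi w)))%E.
  apply: ge0_le_integral; first exact: measurableT.
  - by move=> w _; exact: mule_ge0 (hh0 w) (psi0 w).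
  - exact: emeasurable_funM mhE mpsi.
  - exact: emeasurable_funM (measurable_cst _) mIBpsi.
  - by move=> w _; rewrite muleA; exact: lee_wpmul2r (psi0 w) _ _ (hB w).
have S4 : (\int[dv]_w ((2 ^+ n)%:E * (IB w * psi w)) =
    (2 ^+ n)%:E * \int[dv]_w (IB w * psi w))%E.
  by apply: ge0_integralZl; [exact: measurableT|exact: mIBpsi|move=> w _; exact: IBpsi0|exact: p2].
pose F (p : Cn * Cn) := (psi p.1 * B p.1 p.2)%E.
have mF : measurable_fun setT F.
  exact: emeasurable_funM (measurableT_comp mpsi measurable_fst) mB2.
have F0 p : (0 <= F p)%E := mule_ge0 (psi0 p.1) (B0 p.1 p.2).
have S5 : (\int[dv]_w (IB w * psi w) = \int[dv]_w \int[dv]_x F (w, x))%E.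
  apply: eq_integral => w _; rewrite muleC; apply/esym.
  have E : (\int[dv]_x (psi w * B w x) = psi w * \int[dv]_x B w x)%E; last exact: E.
  apply: ge0_integralZl; [exact: measurableT|
    exact: (measurableT_comp mB2 (pair1_measurable w))|
    move=> x _; exact: B0|exact: psi0].
(* After the exchange, |h x|^2 stands outside and the hypothesis on [S] applies for each x. *)
have S6 := fubini_tonelli (m1 := dv) (m2 := dv) F mF F0.
have S7 x : (\int[dv]_w F (w, x) <= S%:E * (hw t h x ^+ 2)%:E)%E.
  have mgx : measurable_fun setT (fun w => (gk t (w - x))%:E).
    by apply/measurable_EFinP; exact: (measurableT_comp mg (pair2_measurable x)).
  have gx0 w : (0 <= (gk t (w - x))%:E)%E by rewrite lee_fin gk_ge0.
  have E : (\int[dv]_w ((hw t h x ^+ 2)%:E * (psi w * (gk t (w - x))%:E)) =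
     (hw t h x ^+ 2)%:E * \int[dv]_w (psi w * (gk t (w - x))%:E))%E.
    apply: ge0_integralZl; [exact: measurableT|exact: emeasurable_funM mpsi mgx|
      move=> w _; exact: mule_ge0 (psi0 w) (gx0 w)|exact: hh0].
  have E2 : (\int[dv]_w F (w, x) =
     \int[dv]_w ((hw t h x ^+ 2)%:E * (psi w * (gk t (w - x))%:E)))%E.
    by apply: eq_integral => w _; rewrite /F /B [_.1]/= [_.2]/= EFinM muleCA.
  have chain (a b c d e : \bar R) : (a = b -> b = c * d -> 0 <= c -> d <= e -> a <= e * c)%E.
    by move=> -> -> c0 de; rewrite muleC; exact: lee_wpmul2r.
  exact: chain E2 E (hh0 x) (HS x).
have S0 : 0 <= S.
  have := HS 0; rewrite -lee_fin; apply: le_trans; apply: integral_ge0 => w _.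
  by apply: mule_ge0 (psi0 w) _; rewrite lee_fin gk_ge0.
have S0E : (0 <= S%:E)%E by rewrite lee_fin.
have S8 : (\int[dv]_x \int[dv]_w F (w, x) <= \int[dv]_x (S%:E * (hw t h x ^+ 2)%:E))%E.
  apply: ge0_le_integral; first exact: measurableT.
  - by move=> x _; apply: integral_ge0 => w _; exact: F0.
  - exact: (measurable_fun_fubini_tonelli_G (m1 := dv) F mF F0).
  - exact: emeasurable_funM (measurable_cst _) mhE.
  - by move=> x _; exact: S7.
have S9 : (\int[dv]_x (S%:E * (hw t h x ^+ 2)%:E) = S%:E * nsq t h)%E.
  by apply: ge0_integralZl; [exact: measurableT|exact: mhE|move=> x _; exact: hh0|exact: S0E].
(* One factor 2^n from Schur's test and one from [hB] give 4^n. *)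
have := le_mul_chain p2 S1 S2 S3 S4 S5 S6 S8 S9.
rewrite (_ : 4 ^+ n = 2 ^+ n * 2 ^+ n); last by rewrite -exprMn -natrM.
by rewrite !EFinM !muleA.
Qed.

End hankel_bound.

(** * Oscillation over cubes *)

Section limits.
Context {R : realType}.

Lemma cvge0_at_right (F : R -> \bar R) :
  (forall e : R, 0 < e -> exists2 d : R, 0 < d & forall t, 0 < t -> t < d ->
    (0 <= F t)%E /\ (F t <= e%:E)%E) ->
  F t @[t --> 0^'+] --> 0%E.
Proof.
move=> H.
have near_right (d : R) : 0 < d -> \forall t \near 0^'+, 0 < t /\ t < d.
  move=> d0; near=> t; split; near: t; first exact: nbhs_right_gt.
  exact: nbhs_right_lt.
apply/fine_cvgP; split.
  have [d d0 Hd] := H 1 ltr01.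
  apply: filterS (near_right d d0) => t [t0 td]; have [F0 F1] := Hd t t0 td.
  by rewrite ge0_fin_numE// (le_lt_trans F1)// ltry.
apply/cvgrPdist_le => e e0; have [d d0 Hd] := H e e0.
apply: filterS (near_right d d0) => t [t0 td]; have [F0 F1] := Hd t t0 td.
rewrite sub0r normrN /= ger0_norm ?fine_ge0//.
have Ff : F t \is a fin_num by rewrite ge0_fin_numE// (le_lt_trans F1)// ltry.
by rewrite -lee_fin fineK.
Unshelve. all: by end_near. Qed.

Lemma cvge0_at_right_lt (F : R -> \bar R) : F t @[t --> 0^'+] --> 0%E ->
  forall e : R, 0 < e -> exists2 d : R, 0 < d & (F d <= e%:E)%E.
Proof.
move=> /fine_cvgP[Ffin /cvgrPdist_le cF] e e0.
have H : \forall t \near 0^'+, [/\ 0 < t, F t \is a fin_num & `|0 - (fine \o F) t| <= e].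
  near=> t; split; near: t; [exact: nbhs_right_gt|exact: Ffin|exact: cF].
have [d [d0 Fd Fe]] := filter_ex H; exists d => //.
rewrite -(fineK Fd) lee_fin; apply: le_trans Fe.
by rewrite sub0r normrN /= ler_norm.
Unshelve. all: by end_near. Qed.

End limits.

Section vmo.
Context {R : realType} (n : nat).
Local Notation C := (cplx R).
Local Notation Cn := (Cn R n).
Local Notation dv := (lebesgueC R n).
Implicit Types (z w x : Cn) (f : Cn -> C).

Lemma Linfty_bounded f : Linfty f -> mesC f /\
  exists2 M : R, 0 <= M & {ae dv, forall z, modC (f z) <= M}.
Proof.
(* The essential supremum norm is 0 by convention when the whole space is null; any bound then holds
   almost everywhere. *)
move=> [mf]; rewrite unlock /=; case: ifPn => [_ foo|T0 _]; split=> //.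
  have H := ess_sup_ge dv (abse \o (EFin \o (@modC R \o f))).
  set y := ess_sup _ _ in foo H.
  exists (Num.max 0 (fine y)); first by rewrite le_max lexx.
  apply: filterS H => z /=; rewrite ger0_norm ?modC_ge0// => zy.
  move: foo zy; case: y => [r _|//|_].
    by rewrite lee_fin le_max => ->; rewrite orbT.
  by rewrite leeNy_eq.
exists 0 => //; exists setT; split=> //.
by apply/eqP; rewrite eq_le measure_ge0 andbT leNgt.
Qed.

Lemma VMO_small f : VMO f -> forall e : R, 0 < e -> exists2 a : R, 0 < a &
  forall E, cube E -> (dv E <= a%:E)%E -> (osc f E <= e%:E)%E.
Proof.
move=> [_ _ /cvge0_at_right_lt H] e /H[a a0 Ha]; exists a => // E cE Ea.
by apply: le_trans Ha; apply: ereal_sup_ubound; exists E.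
Qed.

Lemma normsqD_le z w : normsq (z + w) <= 2 * normsq z + 2 * normsq w.
Proof. by have := normsq_ge0 (z - w); rewrite normsqB normsqD; lra. Qed.

Definition centered_cube x (l : R) : set Cn :=
  [set z | forall i, `|(coordC i (z - x)).1| <= l /\ `|(coordC i (z - x)).2| <= l].

Lemma cube_centered_cube x l : 0 < l -> cube (centered_cube x l).
Proof.
move=> l0; exists (\row_i (((coordC i x).1 - l) +i* ((coordC i x).2 - l))%C), (2 * l).
split; first by rewrite mulr_gt0.
apply/seteqP; split=> z /= H i; have := H i; rewrite /coordC !mxE /=;
  case: (z 0 i) (x 0 i) => [a b] [c d] /=; rewrite !ler_norml => -[h1 h2]; lra.
Qed.

Lemma measurable_centered_cube x l : measurable (centered_cube x l).
Proof.
have m1 (g : Cn -> R) (c : R) : measurable_fun setT g ->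
    measurable [set z | `|g z| <= c].
  move=> mg; have mag : measurable_fun setT (fun z => `|g z|) by exact: measurableT_comp.
  rewrite (_ : [set _ | _] = setT `&` (fun z => `|g z|) @^-1` `]-oo, c]%classic).
    exact: mag.
  by apply/seteqP; split=> z /=; rewrite in_itv/=; [|case].
have msub : measurable_fun setT (fun z => z - x) := proj1 (lebesgueC_shift (- x)).
have E : centered_cube x l = \bigcap_(i in [set: 'I_n])
    ([set z | `|(coordC i (z - x)).1| <= l] `&` [set z | `|(coordC i (z - x)).2| <= l]).
  apply/predeqP => z; split=> [H i _|H i]; first exact: H.
  exact: (H i I).
rewrite E; apply: fin_bigcap_measurable => // i _.
apply: measurableI; apply: m1.
  exact: (measurableT_comp (measurable_coordC1 i) msub).
exact: (measurableT_comp (measurable_coordC2 i) msub).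
Qed.

Lemma in_centered_cube_normsq x l z : centered_cube x l z ->
  normsq (z - x) <= 2 * n%:R * l ^+ 2.
Proof.
move=> H; rewrite /normsq -mulrA mulrCA mulr_natl -[n in leRHS]card_ord -sumr_const.
apply: ler_sum => i _; have [h1 h2] := H i.
have sq (a : R) : `|a| <= l -> a ^+ 2 <= l ^+ 2.
  move=> al; rewrite -(real_normK (num_real a)) ler_pXn2r// nnegrE//.
  exact: le_trans al.
by have := sq _ h1; have := sq _ h2; lra.
Qed.

Lemma notin_centered_cube_normsq x l z : 0 <= l -> ~ centered_cube x l z ->
  l ^+ 2 <= normsq (z - x).
Proof.
move=> l0 H; apply: contrapT => /negP; rewrite -ltNge => lt; apply: H => i.
have sq (a : R) : a ^+ 2 <= normsq (z - x) -> `|a| <= l.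
  move=> al; rewrite -(@ler_pXn2r _ 2%N)// ?nnegrE// real_normK ?num_real//.
  exact: le_trans al (ltW lt).
have ci : (coordC i (z - x)).1 ^+ 2 + (coordC i (z - x)).2 ^+ 2 <= normsq (z - x).
  by rewrite /normsq (bigD1 i)//= lerDl sumr_ge0// => j _; rewrite addr_ge0 ?sqr_ge0.
by split; apply: sq; apply: le_trans ci; rewrite ?lerDl ?lerDr sqr_ge0.
Qed.

(** On the cube the Gaussian around x is at least exp(-2n l^2 / s), so its integral bounds the
    volume. With l = L sqrt t and s = t the result is a constant times t^n. *)
Lemma lebesgueC_cube_le x (l s : R) : 0 < s ->
  (dv (centered_cube x l) <= (expR (2 * n%:R * l ^+ 2 / s) * (pi * s) ^+ n)%:E)%E.
Proof.
move=> s0; set Q := centered_cube x l; have mQ := measurable_centered_cube x l.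
set c := expR _; have c0 : 0 <= c := expR_ge0 _.
have mG : measurable_fun setT (fun z => (expR (- normsq (z - x) / s))%:E).
  apply/measurable_EFinP.
  exact: (measurableT_comp (@measurable_gauss R n s) (proj1 (lebesgueC_shift (- x)))).
have G0 z : (0 <= (expR (- normsq (z - x) / s))%:E)%E by rewrite lee_fin expR_ge0.
have E : (\int[dv]_z (c%:E * (expR (- normsq (z - x) / s))%:E) =
    c%:E * \int[dv]_z (expR (- normsq (z - x) / s))%:E)%E.
  by apply: ge0_integralZl.
rewrite EFinM -(integral_gauss_shift x s0) -E -(setIT Q) -integral_indic//.
apply: ge0_le_integral => //.
- by apply/measurable_EFinP; exact: measurable_indic.
- exact: emeasurable_funM.
- move=> z _; rewrite -EFinM lee_fin indicE; case: (boolP (z \in Q)) => [|_]; last first.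
    by rewrite mulr_ge0 ?expR_ge0.
  rewrite inE => /in_centered_cube_normsq zQ; rewrite /c -expRD.
  rewrite -[X in X <= _]expR0 ler_expR mulNr subr_ge0 ler_wpM2r//.
  by rewrite invr_ge0 ltW.
Qed.

End vmo.

(** * The kernel integral of a bounded VMO function *)

Section vmo_bound.
Context {R : realType}.

Lemma integral_lin3 d (T : measurableType d) (mu : {measure set T -> \bar R})
    (u1 u2 u3 : T -> R) (i1 i2 i3 c1 c2 c3 : R) :
  measurable_fun setT u1 -> measurable_fun setT u2 -> measurable_fun setT u3 ->
  (forall x, 0 <= u1 x) -> (forall x, 0 <= u2 x) -> (forall x, 0 <= u3 x) ->
  0 <= c1 -> 0 <= c2 -> 0 <= c3 ->
  (\int[mu]_x (u1 x)%:E = i1%:E)%E -> (\int[mu]_x (u2 x)%:E = i2%:E)%E ->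
  (\int[mu]_x (u3 x)%:E = i3%:E)%E ->
  (\int[mu]_x (c1 * u1 x + c2 * u2 x + c3 * u3 x)%:E =
    (c1 * i1 + c2 * i2 + c3 * i3)%:E)%E.
Proof.
move=> m1 m2 m3 p1 p2 p3 q1 q2 q3 e1 e2 e3.
have Z (u : T -> R) (c i : R) : measurable_fun setT u -> (forall x, 0 <= u x) -> 0 <= c ->
    (\int[mu]_x (u x)%:E = i%:E)%E -> (\int[mu]_x (c * u x)%:E = (c * i)%:E)%E.
  move=> mu' u0 c0 e; rewrite EFinM -e -ge0_integralZl//.
  - exact/measurable_EFinP.
  - by move=> x _; rewrite lee_fin.
have D (u v : T -> R) (i j : R) : measurable_fun setT u -> measurable_fun setT v ->
    (forall x, 0 <= u x) -> (forall x, 0 <= v x) ->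
    (\int[mu]_x (u x)%:E = i%:E)%E -> (\int[mu]_x (v x)%:E = j%:E)%E ->
    (\int[mu]_x (u x + v x)%:E = (i + j)%:E)%E.
  move=> mu' mv u0 v0 ei ej; rewrite EFinD -ei -ej -ge0_integralD//.
  - by move=> x _; rewrite lee_fin.
  - exact/measurable_EFinP.
  - by move=> x _; rewrite lee_fin.
  - exact/measurable_EFinP.
have mc (u : T -> R) (c : R) : measurable_fun setT u -> measurable_fun setT (fun x => c * u x).
  by move=> mu'; exact: measurable_funM.
apply: (D).
- by apply: measurable_funD; exact: mc.
- exact: mc.
- by move=> x; rewrite addr_ge0// mulr_ge0.
- by move=> x; rewrite mulr_ge0.
- apply: (D); [exact: mc|exact: mc| | |exact: Z|exact: Z].
  + by move=> x; rewrite mulr_ge0.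
  + by move=> x; rewrite mulr_ge0.
- exact: Z.
Qed.

Variable n : nat.
Local Notation C := (cplx R).
Local Notation Cn := (Cn R n).
Local Notation dv := (lebesgueC R n).
Implicit Types (z w x : Cn) (f : Cn -> C).

(** [gk] with half of its exponent held back: the spared factor exp(-|z|^2 / (16t)) produces the
    tail estimate, and the mass is still finite, namely 4^n. *)
Definition gk2 t z : R := expR (- normsq z / (16 * t)) / (4 * pi * t) ^+ n.

Lemma gk2_ge0 t z : 0 < t -> 0 <= gk2 t z.
Proof. by move=> t0; rewrite divr_ge0 ?expR_ge0// exprn_ge0// !mulr_ge0 ?pi_ge0 ?ltW. Qed.

Lemma measurable_gk2_sub t w : measurable_fun setT (fun z => gk2 t (z - w)).
Proof.
apply: measurable_funM => //.
exact: (measurableT_comp (@measurable_gauss R n (16 * t)) (proj1 (lebesgueC_shift (- w)))).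
Qed.

Lemma integral_gk2_shift t w : 0 < t -> (\int[dv]_z (gk2 t (z - w))%:E = (4 ^+ n)%:E)%E.
Proof.
move=> t0; have c0 : 0 < (4 * pi * t) ^+ n by rewrite exprn_gt0// !mulr_gt0// pi_gt0.
under eq_integral do rewrite /gk2 mulrC EFinM.
rewrite ge0_integralZl//; last 2 first.
- apply/measurable_EFinP.
  exact: (measurableT_comp (@measurable_gauss R n _) (proj1 (lebesgueC_shift (- w)))).
- by rewrite lee_fin invr_ge0 ltW.
rewrite integral_gauss_shift ?mulr_gt0// -EFinM (_ : pi * (16 * t) = 4 * (4 * pi * t)); last by ring.
by rewrite (exprMn _ 4) mulrCA mulVf ?mulr1// gt_eqF.
Qed.

(** If both points lie in the cube, |f z - f w|^2 <= 2M |f z - f w| and each [gk] is at most its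
    maximum. Otherwise one point is far from x, and the spared Gaussian factors are small. *)
Lemma vmo_pointwise f x z w (t L M : R) : 0 < t -> 0 <= L ->
  modC (f z) <= M -> modC (f w) <= M ->
  modC (f z - f w) ^+ 2 * gk t (z - w) * gk t (w - x) <=
  2 * M / ((4 * pi * t) ^+ n) ^+ 2 *
    (\1_(centered_cube x (L * Num.sqrt t)) z * \1_(centered_cube x (L * Num.sqrt t)) w *
     modC (f z - f w)) +
  4 * M ^+ 2 * expR (- (L ^+ 2 / 32)) * gk2 t (w - x) * gk2 t (z - w).
Proof.
move=> t0 L0 fz fw; set Q := centered_cube _ _; set D := modC _.
have D0 : 0 <= D by exact: modC_ge0.
have DM : D <= 2 * M by apply: (le_trans (modCB _ _)); rewrite mulr2n mulrDl !mul1r lerD.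
have k0 : 0 < (4 * pi * t) ^+ n by rewrite exprn_gt0 ?mulr_gt0 ?pi_gt0.
set k := _ ^+ n in k0 *.
have M0 : 0 <= M by apply: le_trans fz; exact: modC_ge0.
have l2 : (L * Num.sqrt t) ^+ 2 = L ^+ 2 * t by rewrite exprMn sqr_sqrtr// ltW.
have l0 : 0 <= L * Num.sqrt t by rewrite mulr_ge0// sqrtr_ge0.
have DD : D ^+ 2 <= 4 * M ^+ 2.
  by rewrite (_ : 4 * M ^+ 2 = (2 * M) ^+ 2); [rewrite ler_pXn2r// nnegrE mulr_ge0|ring].
have gkE y : gk t y = gk2 t y * expR (- normsq y / (16 * t)).
  rewrite /gk /gk2 [RHS]mulrAC -expRD; congr (expR _ / _).
  by field; rewrite gt_eqF.
have gkk (y : Cn) : gk t y <= k^-1.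
  rewrite /gk -/k ler_pdivrMr// mulVf ?gt_eqF// -expR0 ler_expR mulNr oppr_le0.
  by rewrite divr_ge0 ?normsq_ge0// mulr_ge0// ltW.
have gg0 : 0 <= gk2 t (w - x) * gk2 t (z - w) by rewrite mulr_ge0 ?gk2_ge0.
(* From |z - w|^2 + |w - x|^2 >= L^2 t / 2 the spared exponent is at least L^2 / 32. *)
have far : L ^+ 2 * t <= 2 * normsq (z - w) + 2 * normsq (w - x) ->
    D ^+ 2 * gk t (z - w) * gk t (w - x) <=
    4 * M ^+ 2 * expR (- (L ^+ 2 / 32)) * gk2 t (w - x) * gk2 t (z - w).
  move=> H; set tau := expR _.
  have E : gk t (z - w) * gk t (w - x) = gk2 t (w - x) * gk2 t (z - w) *
      expR (- (normsq (z - w) + normsq (w - x)) / (16 * t)).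
    by rewrite !gkE mulrACA -expRD opprD [RHS]mulrC [in RHS]mulrDl mulrC; congr (_ * _); rewrite mulrC.
  have le_tau : expR (- (normsq (z - w) + normsq (w - x)) / (16 * t)) <= tau.
    rewrite ler_expR mulNr lerN2 ler_pdivlMr ?mulr_gt0//.
    rewrite (_ : L ^+ 2 / 32 * (16 * t) = L ^+ 2 * t / 2); last by field.
    by rewrite ler_pdivrMr//; move: (L ^+ 2 * t) H => a H; lra.
  rewrite -mulrA E -[leRHS]mulrA [leRHS]mulrAC -[leRHS]mulrA; apply: ler_pM => //.
  - exact: sqr_ge0.
  - by rewrite mulr_ge0// expR_ge0.
  - by rewrite ler_wpM2l.
have rhs0 : 0 <= 4 * M ^+ 2 * expR (- (L ^+ 2 / 32)) * gk2 t (w - x) * gk2 t (z - w).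
  by apply: mulr_ge0; [apply: mulr_ge0; [apply: mulr_ge0; [rewrite mulr_ge0 ?sqr_ge0|
    exact: expR_ge0]|exact: gk2_ge0]|exact: gk2_ge0].
have A0 : 0 <= 2 * M / k ^+ 2 by apply: divr_ge0; [exact: mulr_ge0|exact: exprn_ge0 _ (ltW k0)].
have lhs2 : 0 <= 2 * M / k ^+ 2 * (\1_Q z * \1_Q w * D).
  by rewrite mulr_ge0// mulr_ge0// mulr_ge0.
have [zQ|zQ] := pselect (Q z); last first.
  apply: le_trans (lerD lhs2 (lexx _)); rewrite add0r; apply: far.
  have := notin_centered_cube_normsq l0 zQ; rewrite l2 => h; apply: (le_trans h).
  by rewrite (_ : z - x = (z - w) + (w - x)) ?normsqD_le// addrA subrK.
have [wQ|wQ] := pselect (Q w); last first.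
  apply: le_trans (lerD lhs2 (lexx _)); rewrite add0r; apply: far.
  have := notin_centered_cube_normsq l0 wQ; rewrite l2 => h; apply: (le_trans h).
  by have := normsq_ge0 (z - w); have := normsq_ge0 (w - x); lra.
apply: le_trans (lerD (lexx _) rhs0); rewrite addr0 !indicE !mem_set// !mul1r.
rewrite expr2 -mulrA [leRHS]mulrAC; apply: ler_pM.
- exact: mulr_ge0.
- by rewrite mulr_ge0 ?gk_ge0.
- by rewrite ler_wpM2r.
- by rewrite expr2 invfM; apply: ler_pM; rewrite ?gk_ge0.
Qed.

Lemma integral_mean_dev_le f Q (V d : R) : measurable Q -> mesC f -> dv Q = V%:E ->
  (osc f Q <= d%:E)%E ->
  (\int[dv]_z (\1_Q z * modC (f z - mean f Q))%:E <= (V * d)%:E)%E.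
Proof.
move=> mQ mf QV; rewrite /osc; set m := mean f Q => H.
have E : (\int[dv]_z (\1_Q z * modC (f z - m))%:E = \int[dv]_(z in Q) (modC (f z - m))%:E)%E.
  rewrite [RHS]integral_mkcond; apply: eq_integral => z _.
  by rewrite patchE indicE; case: ifPn => _; rewrite ?mul1r ?mul0r.
(* On a null cube the oscillation says nothing, but there the integral vanishes anyway. *)
rewrite E; have [V0|V0] := eqVneq V 0.
  rewrite null_set_integral//; first by rewrite V0 mul0r.
    apply/measurable_EFinP; apply: (measurable_funS measurableT) => //.
    by apply: measurable_modC; apply: mesCB => //; exact: mesC_cst.
  by apply: (etrans QV); rewrite V0.
have V1 : 0 < V by rewrite lt0r V0 -lee_fin -QV measure_ge0.
move: H; rewrite QV inver (negbTE V0).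
set I := (\int[dv]_(z in Q) _)%E => H.
have -> : I = (V%:E * ((V^-1)%:E * I))%E by rewrite muleA -EFinM mulfV// mul1e.
by rewrite EFinM lee_wpmul2l// lee_fin ltW.
Qed.

(** Comparing f z and f w with the mean over the cube Q bounds the near part by 2 |Q| times the
    integral of |f - mean|, at most 2 |Q|^2 d. As |Q| is at most a constant times (4 pi t)^n, the
    square of this power cancels and the bound does not depend on t; 16^n is the product of the
    masses of the two [gk2]. *)
Lemma vmo_double f x (t L M d : R) : mesC f -> 0 < t -> 0 < L -> 0 <= M -> 0 <= d ->
  {ae dv, forall z, modC (f z) <= M} ->
  (osc f (centered_cube x (L * Num.sqrt t)) <= d%:E)%E ->
  (\int[dv]_w ((\int[dv]_z (modC (f z - f w) ^+ 2 * gk t (z - w))%:E) *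
     (gk t (w - x))%:E) <=
   (4 * M * expR (2 * n%:R * L ^+ 2) ^+ 2 * d +
    4 * M ^+ 2 * 16 ^+ n * expR (- (L ^+ 2 / 32)))%:E)%E.
Proof.
move=> mf t0 L0 M0 d0 fM; set Q := centered_cube _ _ => Qd.
have mQ : measurable Q := measurable_centered_cube x _.
have k0 : 0 < (4 * pi * t) ^+ n by rewrite exprn_gt0 ?mulr_gt0 ?pi_gt0.
set k := (4 * pi * t) ^+ n in k0 *.
set ec := expR (2 * n%:R * L ^+ 2).
have QV : (dv Q <= (ec * k)%:E)%E.
  apply: (le_trans (lebesgueC_cube_le x _ t0)); rewrite lee_fin.
  have -> : 2 * n%:R * (L * Num.sqrt t) ^+ 2 / t = 2 * n%:R * L ^+ 2.
    by rewrite exprMn sqr_sqrtr ?ltW// mulrA mulfK// gt_eqF.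
  apply: ler_wpM2l; first exact: expR_ge0.
  have pt0 : 0 <= pi * t by rewrite mulr_ge0 ?pi_ge0 ?ltW.
  apply: lerXn2r; rewrite ?nnegrE//; last by move: pt0; rewrite -mulrA; move: (pi * t) => a; lra.
  by rewrite -mulrA mulr_ge0.
have [V EV] : exists V : R, dv Q = V%:E.
  exists (fine (dv Q)); rewrite fineK// ge0_fin_numE ?measure_ge0//.
  by rewrite (le_lt_trans QV)// ltry.
have V0 : 0 <= V by rewrite -lee_fin -EV measure_ge0.
have Vk : V <= ec * k by rewrite -lee_fin -EV.
pose a z := modC (f z - mean f Q).
have a0 z : 0 <= a z by exact: modC_ge0.
have ma : measurable_fun setT a.
  by apply: measurable_modC; apply: mesCB => //; exact: mesC_cst.
have mI : measurable_fun setT (\1_Q : Cn -> R) by exact: measurable_indic.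
have mIa : measurable_fun setT (fun z => \1_Q z * a z) by exact: measurable_funM.
have Ia0 : (0 <= \int[dv]_z (\1_Q z * a z)%:E)%E.
  by apply: integral_ge0 => z _; rewrite lee_fin mulr_ge0.
have Ia := integral_mean_dev_le mQ mf EV Qd.
have [J EJ] : exists J : R, (\int[dv]_z (\1_Q z * a z)%:E = J%:E)%E.
  exists (fine (\int[dv]_z (\1_Q z * a z)%:E)%E); rewrite fineK// ge0_fin_numE//.
  by apply: (le_lt_trans Ia); rewrite ltry.
have J0 : 0 <= J by rewrite -lee_fin -EJ.
have Jd : J <= V * d by rewrite -lee_fin -EJ.
have EQ : (\int[dv]_z (\1_Q z)%:E = V%:E)%E.
  by rewrite integral_indic// setIT.
set tau := expR (- (L ^+ 2 / 32)); have tau0 : 0 <= tau := expR_ge0 _.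
pose A := 2 * M / k ^+ 2; pose B := 4 * M ^+ 2 * tau.
have A0 : 0 <= A by apply: divr_ge0; [exact: mulr_ge0|exact: exprn_ge0 _ (ltW k0)].
have B0 : 0 <= B by rewrite mulr_ge0// mulr_ge0// sqr_ge0.
pose F (p : Cn * Cn) : R := modC (f p.1 - f p.2) ^+ 2 * gk t (p.1 - p.2).
have mF : measurable_fun setT F.
  apply: measurable_funM; last exact: measurable_gk_sub.
  apply: measurable_funX; apply: measurable_modC; apply: mesCB.
    exact: (mesC_comp measurable_fst mf).
  exact: (mesC_comp measurable_snd mf).
have F0 p : 0 <= F p by rewrite mulr_ge0 ?sqr_ge0// gk_ge0.
have I0 z : 0 <= \1_Q z :> R by rewrite indicE ler0n.
have mg2 w := @measurable_gk2_sub t w.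
have g20 w z : 0 <= gk2 t (z - w) by exact: gk2_ge0.
have Ia0' z : 0 <= \1_Q z * a z by rewrite mulr_ge0.
(* The bound on f holds almost everywhere only, so w is first fixed where it holds and the estimate
   is made for almost every z. *)
have inner w : modC (f w) <= M ->
    ((\int[dv]_z (F (z, w))%:E) * (gk t (w - x))%:E <=
     (A * J * \1_Q w + A * V * (\1_Q w * a w) + B * 4 ^+ n * gk2 t (w - x))%:E)%E.
  move=> fw; set c := A * \1_Q w; set b := A * (\1_Q w * a w).
  set e := B * gk2 t (w - x).
  have -> : (A * J * \1_Q w + A * V * (\1_Q w * a w) + B * 4 ^+ n * gk2 t (w - x) =
      c * J + b * V + e * 4 ^+ n) by rewrite /c /b /e; ring.
  have c0 : 0 <= c by exact: mulr_ge0.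
  have b0 : 0 <= b by exact: mulr_ge0.
  have e0 : 0 <= e by exact: mulr_ge0.
  rewrite -(integral_lin3 mIa mI (mg2 w) Ia0' I0 (g20 w) c0 b0 e0 EJ EQ
    (integral_gk2_shift w t0)).
  have mFw : measurable_fun setT (fun z => F (z, w)).
    exact: (measurableT_comp mF (pair2_measurable w)).
  have Z : (\int[dv]_z ((F (z, w))%:E * (gk t (w - x))%:E) =
      (\int[dv]_z (F (z, w))%:E) * (gk t (w - x))%:E)%E.
    apply: ge0_integralZr; [exact: measurableT|exact/measurable_EFinP|move=> z _|].
      by rewrite lee_fin.
    by rewrite lee_fin gk_ge0.
  rewrite -Z; apply: ae_ge0_le_integral.
  - exact: measurableT.
  - by move=> z _; rewrite -EFinM lee_fin mulr_ge0// gk_ge0.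
  - by apply: emeasurable_funM => //; exact/measurable_EFinP.
  - by move=> z _; rewrite lee_fin addr_ge0// ?addr_ge0// mulr_ge0.
  - apply/measurable_EFinP; apply: measurable_funD; first apply: measurable_funD;
      exact: measurable_funM.
  apply: filterS fM => z fz _; rewrite -EFinM lee_fin.
  apply: (le_trans (vmo_pointwise x t0 (ltW L0) fz fw)).
  apply: lerD; last by rewrite -/tau -/B.
  rewrite -/Q -/k -/A /c /b.
  have -> : A * \1_Q w * (\1_Q z * a z) + A * (\1_Q w * a w) * \1_Q z =
    A * (\1_Q z * \1_Q w * (a z + a w)) by ring.
  rewrite ler_wpM2l// ler_wpM2l ?mulr_ge0//.
  have -> : f z - f w = (f z - mean f Q) - (f w - mean f Q) by rewrite opprB addrA subrK.
  exact: modCB.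
pose I w := (\int[dv]_z (F (z, w))%:E)%E.
have mI' : measurable_fun setT I.
  apply: (measurable_fun_fubini_tonelli_G (m1 := dv) (fun p => (F p)%:E)).
    exact/measurable_EFinP.
  by move=> p; rewrite lee_fin.
have I'0 w : (0 <= I w)%E by apply: integral_ge0 => z _; rewrite lee_fin.
have outer : (\int[dv]_w (I w * (gk t (w - x))%:E) <=
    (A * J * V + A * V * J + B * 4 ^+ n * 4 ^+ n)%:E)%E.
  have c0 : 0 <= A * J by exact: mulr_ge0.
  have b0 : 0 <= A * V by exact: mulr_ge0.
  have e0 : 0 <= B * 4 ^+ n by rewrite mulr_ge0// exprn_ge0.
  rewrite -(integral_lin3 mI mIa (mg2 x) I0 Ia0' (g20 x) c0 b0 e0 EQ EJ
    (integral_gk2_shift x t0)).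
  apply: ae_ge0_le_integral.
  - exact: measurableT.
  - by move=> w _; rewrite mule_ge0// lee_fin gk_ge0.
  - apply: emeasurable_funM => //; apply/measurable_EFinP.
    exact: (measurableT_comp (@measurable_gk_sub R n t) (pair2_measurable x)).
  - by move=> z _; rewrite lee_fin addr_ge0// ?addr_ge0// mulr_ge0.
  - apply/measurable_EFinP; apply: measurable_funD; first apply: measurable_funD;
      exact: measurable_funM.
  by apply: filterS fM => w fw _; exact: inner.
apply: (le_trans outer); rewrite lee_fin; apply: lerD; last first.
  rewrite /B -mulrA -exprMn -natrM.
  by rewrite [leRHS]mulrAC.
have -> : A * J * V + A * V * J = 2 * (A * (V * J)) by ring.
have VJ : V * J <= (ec * k) * ((ec * k) * d).
  by apply: ler_pM => //; apply: (le_trans Jd); exact: ler_wpM2r.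
have two0 : (0 : R) <= 2 by [].
apply: (le_trans (ler_wpM2l two0 (ler_wpM2l A0 VJ))).
rewrite (_ : 2 * _ = 4 * M * ec ^+ 2 * d)// /A; field.
by rewrite gt_eqF.
Qed.

End vmo_bound.

(** * Uniformly continuous symbols *)

Section uniformly_continuous.
Context {R : realType} (n : nat).
Local Notation C := (cplx R).
Local Notation Cn := (Cn R n).
Implicit Types (z w x : Cn) (g : Cn -> C).

Lemma UC_epsdelta g : UC g -> forall e : R, 0 < e -> exists2 d : R, 0 < d &
  forall z w, l1 (z - w) < d -> modC (g z - g w) < e.
Proof.
move=> ug e e0; have re0 : 0 < rC e by rewrite ltCR.
have := ug _ (entourage_ball C (PosNum re0)).
rewrite /= -entourage_ballE => -[d /= d0 H].
have [r r0 dE] := pos_cplx d0; exists r => // z w zw.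
have /= := H (z, w); rewrite -!ball_normE /= normC_modC ltCR => K.
by apply: K; apply: (le_lt_trans (normCn_le_l1 _)); rewrite dE ltCR.
Qed.

Lemma UC_continuous g : UC g -> continuous g.
Proof.
move=> ug z; apply: (proj2 (@cvgrPdist_lt _ _ _ (nbhs z) (nbhs_filter z) _ _)) => e /pos_cplx[r r0 ->].
have [d d0 H] := UC_epsdelta ug r0.
apply: (@nbhs_rC_ballI _ Cn z (fun w => `|g z - g w| < rC r) (d / n.+1%:R)).
  by rewrite divr_gt0.
move=> w zw; rewrite normC_modC ltCR; apply: H; apply: (le_lt_trans (l1_le (ltW zw))).
by rewrite mulrCA -[ltRHS]mulr1 ltr_pM2l// ltr_pdivrMr// mul1r ltr_nat.
Qed.

Lemma l1Z (c : R) z : l1 (rC c *: z) = `|c| * l1 z.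
Proof. by rewrite /l1 mulr_sumr; apply: eq_bigr => i _; rewrite mxE modCM modC_real. Qed.

(* Cut the segment from w to z in pieces of length at most d. *)
Lemma UC_linear g : UC g -> forall e : R, 0 < e -> exists2 d : R, 0 < d &
  forall z w, modC (g z - g w) <= e * (1 + l1 (z - w) / d).
Proof.
move=> ug e e0; have [d d0 H] := UC_epsdelta ug e0; exists d => // z w.
(* The added 1 makes each piece strictly shorter than d, while m stays below 1 + l1 / d. *)
pose m := (Num.truncn (l1 (z - w) / d)).+1.
have m0 : (0 < m%:R :> R) by rewrite ltr0n.
have x0 : 0 <= l1 (z - w) / d by rewrite divr_ge0 ?l1_ge0// ltW.
have mx : m%:R <= 1 + l1 (z - w) / d.
  by rewrite /m -addn1 natrD addrC lerD2l; have /andP[] := truncn_itv x0.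
have xm : l1 (z - w) / d < m%:R by exact: truncnS_gt.
pose p k := w + rC (k%:R / m%:R) *: (z - w).
have pS k : p k.+1 - p k = rC m%:R^-1 *: (z - w).
  rewrite /p opprD addrACA subrr add0r -scalerBl; congr (_ *: _).
  by rewrite -rCB -natr1 mulrDl mul1r addrC addKr.
have step k : modC (g (p k.+1) - g (p k)) <= e.
  apply/ltW/H; rewrite pS l1Z ger0_norm ?invr_ge0// mulrC ltr_pdivrMr//.
  by rewrite mulrC -ltr_pdivrMr.
have sum k : modC (g (p k) - g w) <= k%:R * e.
  elim: k => [|k IH].
    by rewrite /p mul0r scale0r addr0 subrr modC0 mul0r.
  rewrite -(subrK (g (p k)) (g (p k.+1))) -addrA (le_trans (modCD _ _))//.
  by rewrite -natr1 mulrDl mul1r [leRHS]addrC lerD.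
have pm : p m = z by rewrite /p divff ?gt_eqF// scale1r addrC subrK.
have := sum m; rewrite pm => h.
by apply: (le_trans h); rewrite mulrC ler_wpM2l// ltW.
Qed.

(** With q = |z - w|^2 / d^2, a <= 1 + a^2 in each coordinate gives 1 + l1 / d <= (n + 1)(1 + q),
    and 1 + q <= exp q. Hence [e / n.+1] below and t < d^2 / 32. The denominator 32t is chosen so
    that the square of the bound times [gk] is a multiple of [gk2]. *)
Lemma UC_gauss_bound g : UC g -> forall e : R, 0 < e -> exists2 t1 : R, 0 < t1 &
  forall t, 0 < t -> t < t1 ->
  forall z w, modC (g z - g w) <= e * expR (normsq (z - w) / (32 * t)).
Proof.
move=> ug e e0.
have e1 : 0 < e / n.+1%:R by rewrite divr_gt0.
have [d d0 H] := UC_linear ug e1; exists (d ^+ 2 / 32); first by rewrite divr_gt0 ?exprn_gt0.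
move=> t t0 tt1 z w; apply: (le_trans (H z w)).
set y := z - w; have d2 : 0 < d ^+ 2 by rewrite exprn_gt0.
have N0 := normsq_ge0 y.
have h1 : l1 y / d <= n%:R + normsq y / d ^+ 2.
  rewrite /l1 normsq_modC !mulr_suml -[n in n%:R]card_ord -sumr_const -big_split/=.
  apply: ler_sum => i _; rewrite -expr_div_n; set a := _ / d.
  by have := sqr_ge0 (a - 1); have := sqr_ge0 a; rewrite sqrrB; lra.
have h2 : 1 + normsq y / d ^+ 2 <= expR (normsq y / (32 * t)).
  apply: le_trans (expR_ge1Dx _); rewrite lerD2l ler_wpM2l// lef_pV2 ?posrE ?mulr_gt0//.
  by move: tt1; rewrite ltr_pdivlMr// mulrC => /ltW.
rewrite -mulrA ler_pM2l// [leLHS]mulrC ler_pdivrMr// [leRHS]mulrC.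
apply: (@le_trans _ _ (n.+1%:R * (1 + normsq y / d ^+ 2))); last by rewrite ler_wpM2l.
have q0 : 0 <= normsq y / d ^+ 2 by rewrite divr_ge0// ltW.
have := mulr_ge0 (ler0n R n) q0; rewrite -natr1.
by move: h1; set l := l1 y / d; set q := normsq y / d ^+ 2; move=> h1 nq; nra.
Qed.

End uniformly_continuous.

(** * Operator norms and semicommutators *)

Section operator_norms.
Context {R : realType} (n : nat).
Local Notation C := (cplx R).
Local Notation Cn := (Cn R n).
Local Notation dv := (lebesgueC R n).
Implicit Types (z w x : Cn) (f g h u v : Cn -> C).
Variable t : R.
Hypothesis t0 : 0 < t.

Lemma nsq_mul_le f u (M : R) : mesC f -> mesC u -> 0 <= M ->
  {ae dv, forall z, modC (f z) <= M} ->
  (nsq t (f \* u)%R <= (M ^+ 2)%:E * nsq t u)%E.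
Proof.
move=> mf mu M0 fM; have mfu : mesC (f \* u) by exact: mesCM.
rewrite -(integral_hw_sqrZ t (sqr_ge0 M) mu); apply: ae_ge0_le_integral.
- exact: measurableT.
- by move=> z _; rewrite lee_fin sqr_ge0.
- exact: measurable_hw_sqr.
- by move=> z _; rewrite -EFinM lee_fin mulr_ge0// sqr_ge0.
- by apply: emeasurable_funM => //; exact: measurable_hw_sqr.
apply: filterS fM => z fz _; rewrite -EFinM lee_fin -exprMn.
apply: lerXn2r; [by rewrite nnegrE hw_ge0|by rewrite nnegrE mulr_ge0 ?hw_ge0|].
by rewrite /hw modCM -mulrA ler_wpM2r// mulr_ge0 ?modC_ge0// ltW// sr_gt0.
Qed.

Lemma L2_mul f u : Linfty f -> L2 t u -> L2 t (f \* u).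
Proof.
move=> /Linfty_bounded[mf [M M0 fM]] /(L2P t0)[mu uoo].
apply/(L2P t0); split; first exact: mesCM.
apply: (le_lt_trans (nsq_mul_le mf mu M0 fM)).
by rewrite lte_mul_pinfty// lee_fin sqr_ge0.
Qed.

(** The supremum of an empty set is -oo, so a nonzero element of the domain has to be exhibited; the
    constant 1 will do. *)
Lemma opnorm_ge0 (D : set (Cn -> C)) (X : (Cn -> C) -> Cn -> C) h :
  D h -> h <> cst 0 -> (0 <= opnorm t D X)%E.
Proof.
move=> Dh h0; apply: (@le_trans _ _ (normL2 t (X h) / normL2 t h)%E).
  by rewrite mule_ge0 ?inve_ge0 ?Lnorm_ge0.
by apply: ereal_sup_ubound; exists h.
Qed.

Lemma opnorm_le (D : set (Cn -> C)) (X : (Cn -> C) -> Cn -> C) (c : R) : 0 <= c ->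
  (forall h, D h -> [/\ L2 t h, L2 t (X h) & (nsq t (X h) <= (c ^+ 2)%:E * nsq t h)%E]) ->
  (opnorm t D X <= c%:E)%E.
Proof.
move=> c0 H; apply: ge_ereal_sup => _ [h [Dh h0] <-].
have [/(L2P t0)[mh hoo] /(L2P t0)[mX Xoo] le] := H h Dh.
rewrite !normL2E//; have := nsq_ge0 t h; have := nsq_ge0 t (X h).
move: hoo Xoo le; case: (nsq t h) => [a|//|//] _; case: (nsq t (X h)) => [b|//|//] _.
rewrite -EFinM !lee_fin /= => ba b0 a0; rewrite inver sqrtr_eq0.
have sb : Num.sqrt b <= c * Num.sqrt a.
  by rewrite -(ger0_norm c0) -sqrtr_sqr -sqrtrM ?sqr_ge0// ler_wsqrtr.
(* If h has norm 0, so has its image, and the quotient is 0 times an inverse, that is 0. *)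
case: ifPn => [a1|]; last first.
  rewrite -ltNge => a1; rewrite -EFinM lee_fin ler_pdivrMr// sqrtr_gt0.
  exact: a1.
have -> : Num.sqrt b = 0.
  apply/eqP; rewrite eq_le sqrtr_ge0 andbT (le_trans sb)//.
  by rewrite ler0_sqrtr// mulr0.
by rewrite mul0e lee_fin.
Qed.

End operator_norms.

(** * Semicommutators and the adjoint Hankel operator *)

Section semicommutators.
Context {R : realType} (n : nat).
Local Notation C := (cplx R).
Local Notation Cn := (Cn R n).
Local Notation dv := (lebesgueC R n).
Implicit Types (z w x : Cn) (f g h u v : Cn -> C).
Variable t : R.
Hypothesis t0 : 0 < t.

Local Notation rho := (gaussian_density t).

Lemma L2_hankel g h : dom_mul t g h -> L2 t (hankel t g h).
Proof.
by move=> [Hh Lgh]; rewrite /hankel projH2E//; apply: L2B => //; exact: L2_proj.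
Qed.

Lemma semicommutatorE f g h : dom_semicommutator t f g h ->
  L2 t (f \* hankel t g h) /\
  semicommutator t f g h = (fun z => - kproj t (f \* hankel t g h) z).
Proof.
move=> [Hh Lgh Lfp Lfgh].
have E : f \* hankel t g h = (fun z => (f \* g \* h) z - (f \* projH2 t (g \* h)) z).
  by apply/funext => z; rewrite /hankel /=; ring.
split; first by rewrite E; exact: L2B.
rewrite /semicommutator /toeplitz (projH2E t0 Lfp) (projH2E t0 Lfgh).
apply/funext => z /=; rewrite E /kproj -opprB; congr (- _).
rewrite -intCB; [|exact: ker_integrable|exact: ker_integrable].
by apply: eq_intC => w /=; ring.
Qed.

Lemma semicommutator_L2 f g h : dom_semicommutator t f g h ->
  L2 t (semicommutator t f g h) /\
  nsq t (semicommutator t f g h) = nsq t (kproj t (f \* hankel t g h)).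
Proof.
move=> /semicommutatorE[Lfv ->].
have E : nsq t (fun z => - kproj t (f \* hankel t g h) z) = nsq t (kproj t (f \* hankel t g h)).
  by apply: eq_integral => z _; rewrite /hw modCN.
split=> //; have [mp poo] := (L2P t0 _).1 (L2_proj t0 Lfv).
by apply/(L2P t0); split; [exact: mesCN|rewrite E].
Qed.

(** Cauchy-Schwarz in the form 2ab <= s a^2 + b^2 / s, which avoids roots of extended reals; s will
    be the bound for the squared Hankel norm. *)
Lemma modC_dot_le u v (s : R) : 0 < s -> L2 t u -> L2 t v ->
  ((modC (intC dv (fun z => u z * (v z)^*%C * rC (rho z))))%:E <=
    (s / 2)%:E * nsq t u + (s^-1 / 2)%:E * nsq t v)%E.
Proof.
move=> s0 Lu Lv; have [mu _] := (L2P t0 u).1 Lu; have [mv _] := (L2P t0 v).1 Lv.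
have Lvc := L2J t0 Lv.
have h1 : 0 <= s / 2 by rewrite divr_ge0// ltW.
have h2 : 0 <= s^-1 / 2 by rewrite divr_ge0// invr_ge0 ltW.
rewrite -(integral_hw_sqrZ t h1 mu) -(integral_hw_sqrZ t h2 mv).
have D : (\int[dv]_z ((s / 2)%:E * (hw t u z ^+ 2)%:E + (s^-1 / 2)%:E * (hw t v z ^+ 2)%:E) =
    \int[dv]_z ((s / 2)%:E * (hw t u z ^+ 2)%:E) +
    \int[dv]_z ((s^-1 / 2)%:E * (hw t v z ^+ 2)%:E))%E.
  apply: ge0_integralD; [exact: measurableT|move=> z _| |move=> z _|].
  - by rewrite -EFinM lee_fin mulr_ge0// sqr_ge0.
  - by apply: emeasurable_funM => //; exact: measurable_hw_sqr.
  - by rewrite -EFinM lee_fin mulr_ge0// sqr_ge0.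
  - by apply: emeasurable_funM => //; exact: measurable_hw_sqr.
rewrite -D.
apply: (le_trans (modC_intC (L2_prod_integrable t0 Lu Lvc))).
apply: ge0_le_integral.
- exact: measurableT.
- by move=> z _; rewrite lee_fin modC_ge0.
- apply/measurable_EFinP; apply: measurable_modC; apply: mesCM; last exact: mesC_rho.
  by apply: mesCM => //; exact: mesCJ.
- by apply: emeasurable_funD; apply: emeasurable_funM => //; exact: measurable_hw_sqr.
move=> z _; rewrite -!EFinM -EFinD lee_fin !modCM modC_conj modC_real.
rewrite ger0_norm ?gaussian_density_ge0// -hwM//.
set a := hw t u z; set b := hw t v z.
rewrite -subr_ge0 (_ : _ - _ = s / 2 * (a - s^-1 * b) ^+ 2); last first.
  by field; rewrite gt_eqF.
by rewrite mulr_ge0// sqr_ge0.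
Qed.

Lemma nsqE u : L2 t u ->
  nsq t u = (modC (intC dv (fun z => u z * (u z)^*%C * rC (rho z))))%:E.
Proof.
move=> Lu; have [mu uoo] := (L2P t0 u).1 Lu.
have E z : u z * (u z)^*%C * rC (rho z) = rC (hw t u z ^+ 2).
  rewrite expr2 hwM// -expr2 modC_sqr; case: (u z) => a b.
  by apply: cplx_eq => /=; ring.
have -> : intC dv (fun z => u z * (u z)^*%C * rC (rho z)) = rC (fine (nsq t u)).
  rewrite (eq_intC dv E); apply: cplx_eq => //=.
  by rewrite /Rintegral integral0_eq.
by rewrite modC_real ger0_norm ?fine_ge0 ?nsq_ge0// fineK// ge0_fin_numE ?nsq_ge0.
Qed.

Lemma LinftyJ f : Linfty f -> Linfty (fun z => (f z)^*%C).
Proof.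
move=> [mf foo]; split; first exact: mesCJ.
rewrite (_ : EFin \o (@modC R \o (fun z => (f z)^*%C)) = EFin \o (@modC R \o f))//.
by apply/funext => z /=; rewrite modC_conj.
Qed.

(* |P(fv)|^2 = <v, conj f P(fv)> = <v, H_(conj f) P(fv)>, since v is orthogonal
   to H2. *)
Lemma nsq_kproj_mul_le f u (s : R) : 0 < s -> Linfty f -> L2 t u ->
  (forall h, H2 t h -> (nsq t (hankel t (fun z => (f z)^*%C) h) <= s%:E * nsq t h)%E) ->
  (nsq t (kproj t (f \* (u \- kproj t u)))%R <= s%:E * nsq t (u \- kproj t u)%R)%E.
Proof.
move=> s0 foo Lu H; set v := u \- kproj t u; set p := kproj t _.
have Lv : L2 t v by apply: L2B => //; exact: L2_proj.
have Lfv : L2 t (f \* v) by exact: L2_mul.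
have Hp : H2 t p by exact: H2_proj.
have Lp : L2 t p by case: Hp.
pose q z := (f z)^*%C * p z.
have Lq : L2 t q by exact: (L2_mul t0 (LinftyJ foo) Lp).
have Dp : dom_mul t (fun z => (f z)^*%C) p by [].
have hq : hankel t (fun z => (f z)^*%C) p = (fun z => q z - kproj t q z).
  by rewrite /hankel projH2E.
have Lh := L2_hankel Dp.
have Lc : L2 t (kproj t q) by exact: L2_proj.
have [mv _] := (L2P t0 v).1 Lv; have [mc _] := (L2P t0 _).1 Lc.
have O := kproj_orthogonal t0 Lu (H2_proj t0 Lq).
rewrite (dotL2E _ mv mc) in O.
have E : intC dv (fun z => p z * (p z)^*%C * rC (rho z)) =
    intC dv (fun z => v z * (hankel t (fun z => (f z)^*%C) p z)^*%C * rC (rho z)).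
  rewrite (kproj_dot t0 Lfv Hp) -[LHS]subr0 -[in LHS]O -intCB.
  - apply: eq_intC => z; rewrite hq /q /=.
    by rewrite rmorphB rmorphM /= conjcK; ring.
  - exact: L2_prod_integrable Lfv (L2J t0 Lp).
  - exact: L2_prod_integrable Lv (L2J t0 Lc).
(* With this s the Hankel term is at most half of |p|^2 and is absorbed on the left. *)
have := modC_dot_le s0 Lv Lh.
rewrite -E -nsqE//; have := H p Hp.
have [_] := (L2P t0 p).1 Lp; have [_] := (L2P t0 v).1 Lv; have [_] := (L2P t0 _).1 Lh.
have := nsq_ge0 t p; have := nsq_ge0 t v; have := nsq_ge0 t (hankel t (fun z => (f z)^*%C) p).
case: (nsq t p) => [a|//|//]; case: (nsq t v) => [b|//|//].
case: (nsq t (hankel _ _ _)) => [c|//|//] c0 b0 a0 _ _ _.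
rewrite -!EFinM -EFinD !lee_fin => ca ac.
have ca' : s^-1 / 2 * c <= a / 2.
  rewrite mulrAC ler_pdivrMr// divfK// mulrC ler_pdivrMr// mulrC.
  exact: ca.
by move: ac; rewrite mulrAC; lra.
Qed.

End semicommutators.

(** * Smallness of the Hankel operators as t tends to 0 *)

Section small_time.
Context {R : realType} (n : nat).
Local Notation C := (cplx R).
Local Notation Cn := (Cn R n).
Local Notation dv := (lebesgueC R n).
Implicit Types (z w x : Cn) (f g h u v : Cn -> C) (t : R).

(** Order of choices: L makes the Gaussian tail at most e/2, then d the oscillation term, and t
    finally makes all cubes of half side L sqrt t small enough for oscillation at most d. *)
Lemma VMO_kernel_small f : (0 < n)%N -> VMO f -> Linfty f -> forall e : R, 0 < e ->
  exists2 t1 : R, 0 < t1 & forall t, 0 < t -> t < t1 -> forall x,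
  (\int[dv]_w ((\int[dv]_z (modC (f z - f w) ^+ 2 * gk t (z - w))%:E) *
     (gk t (w - x))%:E) <= e%:E)%E.
Proof.
move=> n0 vf foo e e0; have [mf [M M0 fM]] := Linfty_bounded foo.
set K := 4 * M ^+ 2 * 16 ^+ n.
have K0 : 0 <= K by rewrite mulr_ge0 ?exprn_ge0// mulr_ge0// sqr_ge0.
(* Since exp x >= 1 + x, the value x = 2K/e + 1 gives K exp(-x) <= e/2; the 1 keeps L positive when
   K = 0. *)
have b0 : 0 < 32 * (2 * K / e + 1).
  by rewrite mulr_gt0// ltr_wpDl// divr_ge0 ?mulr_ge0// ltW.
pose L := Num.sqrt (32 * (2 * K / e + 1)).
have L0 : 0 < L by rewrite sqrtr_gt0.
have L2E : L ^+ 2 / 32 = 2 * K / e + 1 by rewrite sqr_sqrtr ?ltW// mulrAC divff// mul1r.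
have tail : K * expR (- (L ^+ 2 / 32)) <= e / 2.
  rewrite L2E expRN ler_pdivrMr ?expR_gt0//.
  apply: (@le_trans _ _ (e / 2 * (1 + (2 * K / e + 1)))); last first.
    by rewrite ler_wpM2l ?expR_ge1Dx// divr_ge0// ltW.
  rewrite (_ : e / 2 * _ = K + e); first by rewrite lerDl ltW.
  by field; rewrite gt_eqF.
set ec := expR (2 * n%:R * L ^+ 2); have ec0 : 0 < ec := expR_gt0 _.
set c := 4 * M * ec ^+ 2; have c0 : 0 <= c by rewrite !mulr_ge0// ltW.
have c1 : 0 < c + 1 by rewrite ltr_wpDl.
pose d := e / 2 / (c + 1); have d0 : 0 < d by rewrite !divr_gt0.
have cd : c * d <= e / 2.
  rewrite /d mulrA ler_pdivrMr// mulrC; apply: ler_wpM2l; last by rewrite lerDl.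
  by rewrite divr_ge0// ltW.
have [a a0 Ha] := VMO_small vf d0.
have p0 : 0 < ec * pi ^+ n by rewrite mulr_gt0// exprn_gt0// pi_gt0.
exists (Num.min 1 (a / (ec * pi ^+ n))); first by rewrite lt_min ltr01 divr_gt0.
move=> t t0; rewrite lt_min => /andP[t1 ta] x.
have l0 : 0 < L * Num.sqrt t by rewrite mulr_gt0// sqrtr_gt0.
have Qa : (dv (centered_cube x (L * Num.sqrt t)) <= a%:E)%E.
  apply: (le_trans (lebesgueC_cube_le x _ t0)); rewrite lee_fin.
  have -> : 2 * n%:R * (L * Num.sqrt t) ^+ 2 / t = 2 * n%:R * L ^+ 2.
    by rewrite exprMn (sqr_sqrtr (ltW t0)) mulrA mulfK// gt_eqF.
  rewrite -/ec exprMn mulrA; apply: (@le_trans _ _ (ec * pi ^+ n * t)).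
    (* Here t^n <= t, from t < 1 and n > 0. *)
    by apply: (ler_wpM2l (ltW p0)); rewrite ler_iXnr// ltW.
  by move: ta; rewrite ltr_pdivlMr// mulrC => /ltW.
apply: (le_trans (vmo_double mf t0 L0 M0 (ltW d0) fM (Ha _ (cube_centered_cube x l0) Qa))).
by rewrite lee_fin -/ec -/c -/K (splitr e) lerD.
Qed.

(** Symbols with increments of equal modulus obey the same bound; this covers f and its conjugate,
    whose membership in VMO then need not be shown. *)
Lemma hankel_small f f' : (forall z w, modC (f' z - f' w) = modC (f z - f w)) ->
  (0 < n)%N -> VMO f -> Linfty f -> forall e : R, 0 < e ->
  exists2 t1 : R, 0 < t1 & forall t, 0 < t -> t < t1 -> forall h, dom_mul t f' h ->
  (nsq t (hankel t f' h) <= e%:E * nsq t h)%E.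
Proof.
move=> ff' n0 vf foo e e0; have [mf _] := Linfty_bounded foo.
have q0 : 0 < (4 : R) ^+ n by rewrite exprn_gt0.
have [|t1 t10 H] := VMO_kernel_small n0 vf foo (_ : 0 < e / 4 ^+ n).
  by rewrite divr_gt0.
exists t1 => // t t0 tt1 h Dh.
have mPhi : measurable_fun setT (fun p : Cn * Cn => modC (f p.1 - f p.2)).
  apply: measurable_modC; apply: mesCB.
    exact: (mesC_comp measurable_fst mf).
  exact: (mesC_comp measurable_snd mf).
have le z w : modC (f' z - f' w) <= modC (f (z, w).1 - f (z, w).2) by rewrite ff'.
have := hankel_bound t0 mPhi (fun p => modC_ge0 _) le (H t t0 tt1) Dh.
by rewrite mulrC divfK// gt_eqF.
Qed.

Lemma UC_hankel_small g : UC g -> forall e : R, 0 < e ->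
  exists2 t1 : R, 0 < t1 & forall t, 0 < t -> t < t1 -> forall h, dom_mul t g h ->
  (nsq t (hankel t g h) <= e%:E * nsq t h)%E.
Proof.
move=> ug e e0; have q0 : 0 < (32 : R) ^+ n by rewrite exprn_gt0.
(* 32^n collects 4^n from [hankel_bound], 4^n from the mass of [gk2] and 2^n from that of [gk]. *)
pose r := Num.sqrt (e / 32 ^+ n).
have r0 : 0 < r by rewrite sqrtr_gt0 divr_gt0.
have r2 : r ^+ 2 = e / 32 ^+ n by rewrite sqr_sqrtr// ltW// divr_gt0.
have [t1 t10 H] := UC_gauss_bound ug r0; exists t1 => // t t0 tt1 h Dh.
pose Phi (p : Cn * Cn) := r * expR (normsq (p.1 - p.2) / (32 * t)).
have mPhi : measurable_fun setT Phi.
  apply: measurable_funM => //; apply: (measurableT_comp (@measurable_expR R)).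
  apply: measurable_funM => //.
  exact: (measurableT_comp (@measurable_normsq R n) (@measurable_subC R n)).
have Phi0 p : 0 <= Phi p by rewrite mulr_ge0 ?expR_ge0// ltW.
have HPhi z w : Phi (z, w) ^+ 2 * gk t (z - w) = r ^+ 2 * gk2 t (z - w).
  rewrite /Phi /gk /gk2 exprMn -expRM_natl /= -!mulrA; congr (_ * _).
  rewrite !mulrA -[r * _ * _]mulrA -expRD; congr (r * expR _ / _).
  by field; rewrite gt_eqF.
have r20 : (0 <= (r ^+ 2)%:E)%E by rewrite lee_fin sqr_ge0.
have inner w : (\int[dv]_z (Phi (z, w) ^+ 2 * gk t (z - w))%:E = (r ^+ 2 * 4 ^+ n)%:E)%E.
  have E : (\int[dv]_z ((r ^+ 2)%:E * (gk2 t (z - w))%:E) =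
      (r ^+ 2)%:E * \int[dv]_z (gk2 t (z - w))%:E)%E.
    apply: ge0_integralZl => //; first by apply/measurable_EFinP; exact: measurable_gk2_sub.
    by move=> z _; rewrite lee_fin gk2_ge0.
  rewrite EFinM -(integral_gk2_shift w t0) -E; apply: eq_integral => z _.
  by rewrite HPhi EFinM.
have HS x : (\int[dv]_w ((\int[dv]_z (Phi (z, w) ^+ 2 * gk t (z - w))%:E) *
    (gk t (w - x))%:E) <= (r ^+ 2 * 8 ^+ n)%:E)%E.
  have E : (\int[dv]_w ((r ^+ 2 * 4 ^+ n)%:E * (gk t (w - x))%:E) =
      (r ^+ 2 * 4 ^+ n)%:E * \int[dv]_w (gk t (w - x))%:E)%E.
    apply: ge0_integralZl; [exact: measurableT| |move=> w _|].
    - apply/measurable_EFinP.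
      exact: (measurableT_comp (@measurable_gk_sub R n t) (pair2_measurable x)).
    - by rewrite lee_fin gk_ge0.
    - by rewrite lee_fin mulr_ge0 ?sqr_ge0// exprn_ge0.
  have -> : (\int[dv]_w ((\int[dv]_z (Phi (z, w) ^+ 2 * gk t (z - w))%:E) *
      (gk t (w - x))%:E) = \int[dv]_w ((r ^+ 2 * 4 ^+ n)%:E * (gk t (w - x))%:E))%E.
    by apply: eq_integral => w _; congr (_ * _)%E; exact: inner.
  rewrite E integral_gk_shift// -EFinM lee_fin -mulrA -exprMn.
  by rewrite -natrM.
have := hankel_bound t0 mPhi Phi0 (fun z w => H t t0 tt1 z w) HS Dh.
have -> : 4 ^+ n * (r ^+ 2 * 8 ^+ n) = e; last by [].
rewrite r2 mulrCA -exprMn -natrM divfK// gt_eqF//.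
Qed.

Lemma L2_cst1 t : 0 < t -> L2 t (cst 1 : Cn -> C).
Proof.
move=> t0; apply: (L2_le t0 ler01 _ _ (L2_expl1 n t0 1)); first exact: mesC_cst.
move=> z; rewrite !mul1r modC_real ger0_norm ?expR_ge0//.
rewrite (_ : modC _ = 1); last by have := modC_real (1 : R); rewrite normr1.
by rewrite -expR0 ler_expR l1_ge0.
Qed.

Lemma H2_cst1 t : 0 < t -> H2 t (cst 1 : Cn -> C).
Proof. by move=> t0; split; [move=> z; exact: differentiable_cst|exact: L2_cst1]. Qed.

Lemma cst1_neq0 : (cst 1 : Cn -> C) <> cst 0.
Proof.
by move=> /(congr1 (fun f => f 0)) /eqP; rewrite oner_eq0.
Qed.

(** Uniform continuity forces at most linear growth, so the constant 1 lies in the domain of the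
    semicommutator. *)
Lemma UC_L2 t g : 0 < t -> UC g -> L2 t g.
Proof.
move=> t0 ug; have [d d0 H] := UC_linear ug (ltr01).
have mg : mesC g by apply: continuous_mesC; exact: UC_continuous.
pose c := modC (g 0) + 1 + d^-1.
have g0 : 0 <= modC (g 0) := modC_ge0 _.
have di : 0 <= d^-1 by rewrite invr_ge0 ltW.
apply: (L2_le (c := c) t0 _ mg _ (L2_expl1 n t0 1)); first by rewrite /c; lra.
move=> z; rewrite mul1r modC_real ger0_norm ?expR_ge0//.
have := H z 0; rewrite mul1r subr0 => h.
have h2 : modC (g z) <= modC (g z - g 0) + modC (g 0) by rewrite -[X in modC X <= _](subrK (g 0)) modCD.
have l0 := l1_ge0 z; have e1 := expR_ge1Dx (l1 z).
apply: (@le_trans _ _ (c * (1 + l1 z))); last by rewrite ler_wpM2l// /c; lra.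
by rewrite /c; have := mulr_ge0 di l0; have := mulr_ge0 g0 l0; nra.
Qed.

End small_time.

(** * Nontrivial domains and a bound for bounded symbols *)

Section semicommutator_bounds.
Context {R : realType} (n : nat).
Local Notation C := (cplx R).
Local Notation Cn := (Cn R n).
Local Notation dv := (lebesgueC R n).
Implicit Types (f g h : Cn -> C).
Variable t : R.
Hypothesis t0 : 0 < t.

Lemma dom_mul_cst1 f : Linfty f -> dom_mul t f (cst 1).
Proof. by move=> foo; split; [exact: H2_cst1|apply: L2_mul => //; exact: L2_cst1]. Qed.

Lemma dom_semicommutator_cst1 f g : Linfty f -> Linfty g \/ UC g ->
  dom_semicommutator t f g (cst 1).
Proof.
move=> foo gg; have Lg : L2 t (g \* cst 1).
  case: gg => [goo|ug]; first by apply: L2_mul => //; exact: L2_cst1.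
  rewrite (_ : g \* cst 1 = g); first exact: UC_L2.
  by apply/funext => z /=; rewrite mulr1.
split=> //; first exact: H2_cst1.
- by apply: L2_mul => //; rewrite projH2E//; exact: L2_proj.
- rewrite (_ : f \* g \* cst 1 = f \* (g \* cst 1)); first exact: L2_mul.
  by apply/funext => z /=; rewrite mulrA.
Qed.

Lemma nsq_hankel_le g h (M : R) : mesC g -> 0 <= M ->
  {ae dv, forall z, modC (g z) <= M} -> dom_mul t g h ->
  (nsq t (hankel t g h) <= (2 * (1 + 4 ^+ n) * M ^+ 2)%:E * nsq t h)%E.
Proof.
move=> mg M0 gM [Hh Lgh]; have [_ Lh] := Hh.
have [mh hoo] := (L2P t0 h).1 Lh.
have LP := L2_proj t0 Lgh.
have [mgh ghoo] := (L2P t0 _).1 Lgh; have [mP Poo] := (L2P t0 _).1 LP.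
have := nsqB_le t0 mgh mP; have := nsq_mul_le t0 mg mh M0 gM.
have := nsq_proj_le t0 Lgh; rewrite /hankel projH2E//.
move: hoo ghoo Poo (nsq_ge0 t h) (nsq_ge0 t (g \* h)) (nsq_ge0 t (kproj t (g \* h))).
set N := nsq t (_ \- _).
case: (nsq t h) => [a|//|//]; case: (nsq t (g \* h)) => [b|//|//].
case: (nsq t (kproj _ _)) => [c|//|//] _ _ _ a0 b0 c0.
rewrite -!EFinM -EFinD !lee_fin => cb ba h1; apply: (le_trans h1); rewrite lee_fin.
have q0 : 0 <= (4 : R) ^+ n by rewrite exprn_ge0.
have : 4 ^+ n * b <= 4 ^+ n * (M ^+ 2 * a) by rewrite ler_wpM2l.
set q := 4 ^+ n in q0 cb *; set m := M ^+ 2 * a in ba * => qbm.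
have -> : 2 * (1 + q) * M ^+ 2 * a = 2 * (m + q * m) by rewrite /m; ring.
lra.
Qed.

End semicommutator_bounds.

Theorem theorem4p9 (R : realType) (n : nat) (n_gt0 : (0 < n)%N)
    (f : Cn R n -> cplx R) (f_VMO : VMO f) (f_Linfty : Linfty f) :
  opnorm t (dom_mul t f) (hankel t f) @[t --> 0^'+] --> 0%E /\
  (forall g : Cn R n -> cplx R, Linfty g \/ UC g ->
    opnorm t (dom_semicommutator t f g) (semicommutator t f g)
      @[t --> 0^'+] --> 0%E).
Proof.
split=> [|g gg]; apply: cvge0_at_right => e e0; have e2 : 0 < e ^+ 2 by rewrite exprn_gt0.
  have [t1 t10 H] := hankel_small (fun z w => erefl (modC (f z - f w))) n_gt0 f_VMO f_Linfty e2.
  exists t1 => // t t0 tt1; split.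
    exact: opnorm_ge0 (dom_mul_cst1 t0 f_Linfty) (@cst1_neq0 R n).
  apply: (opnorm_le t0 (ltW e0)) => h Dh; split; first by case: Dh => -[].
    exact: L2_hankel.
  exact: H.
suff [t1 t10 H] : exists2 t1 : R, 0 < t1 & forall t, 0 < t -> t < t1 ->
    forall h, dom_semicommutator t f g h ->
    (nsq t (kproj t (f \* hankel t g h))%R <= (e ^+ 2)%:E * nsq t h)%E.
  exists t1 => // t t0 tt1; split.
    exact: opnorm_ge0 (dom_semicommutator_cst1 t0 f_Linfty gg) (@cst1_neq0 R n).
  apply: (opnorm_le t0 (ltW e0)) => h Dh; have [Ls ->] := semicommutator_L2 t0 Dh.
  by split=> //; [case: Dh => -[]|exact: H].
(* The factors P f and H_g are bounded in turn: for bounded g the outer constant p is small, for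
   uniformly continuous g the inner constant q. *)
have chain (a b c : \bar R) (p q : R) : 0 <= p -> (a <= p%:E * b)%E -> (b <= q%:E * c)%E ->
    p * q <= e ^+ 2 -> (0 <= c)%E -> (a <= (e ^+ 2)%:E * c)%E.
  move=> p0 ab bc pq c0; apply: (le_trans ab).
  apply: (@le_trans _ _ (p%:E * (q%:E * c))%E); first by rewrite lee_wpmul2l.
  by rewrite muleA -EFinM lee_wpmul2r// lee_fin.
have small (k : R) : 0 <= k -> exists2 s : R, 0 < s & k * s <= e ^+ 2.
  move=> k0; exists (e ^+ 2 / (k + 1)); first by rewrite divr_gt0// ltr_wpDl.
  rewrite mulrA ler_pdivrMr ?ltr_wpDl// mulrC ler_wpM2l ?lerDl//.
  exact: ltW.
case: gg => [goo|ug].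
  have [mg [M M0 gM]] := Linfty_bounded goo.
  have k0 : 0 <= 2 * (1 + 4 ^+ n) * M ^+ 2.
    by rewrite mulr_ge0 ?sqr_ge0// mulr_ge0// addr_ge0// exprn_ge0.
  have [s s0 ks] := small _ k0.
  have fJ z w : modC ((f z)^*%C - (f w)^*%C) = modC (f z - f w).
    by rewrite -rmorphB modC_conj.
  have [t1 t10 H] := hankel_small fJ n_gt0 f_VMO f_Linfty s0.
  exists t1 => // t t0 tt1 h [Hh Lgh _ _].
  have Dh : dom_mul t g h by [].
  have := nsq_hankel_le t0 mg M0 gM Dh.
  have HE : hankel t g h = (g \* h) \- kproj t (g \* h) by rewrite /hankel projH2E.
  rewrite HE => N2; apply: (chain _ _ _ _ _ (ltW s0) _ N2).
  - apply: nsq_kproj_mul_le => // p Hp; apply: H => //; split=> //.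
    by apply: L2_mul => //; [exact: LinftyJ|case: Hp].
  - by rewrite mulrC.
  - exact: nsq_ge0.
have [mf [M M0 fM]] := Linfty_bounded f_Linfty.
have k0 : 0 <= 4 ^+ n * M ^+ 2 by rewrite mulr_ge0 ?sqr_ge0// exprn_ge0.
have [s s0 ks] := small _ k0.
have [t1 t10 H] := UC_hankel_small ug s0; exists t1 => // t t0 tt1 h Dh.
have [Hh Lgh _ _] := Dh; have [Lfv _] := semicommutatorE t0 Dh.
have Dg : dom_mul t g h by [].
apply: (chain _ _ _ _ _ k0 _ (H t t0 tt1 h Dg) ks (nsq_ge0 t h)).
apply: (le_trans (nsq_proj_le t0 Lfv)); have [mv _] := (L2P t0 _).1 (L2_hankel t0 Dg).
rewrite EFinM -muleA; apply: lee_wpmul2l; first by rewrite lee_fin exprn_ge0.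
exact: nsq_mul_le.
Qed.
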